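(* Let $r\ge 2$ be a real number and let $f\in W^{1,2}_0(\mathbb D)$, where $\mathbb D\subset\mathbb R^2$ is the unit disc. Then $$\|f\mid L^{r}(\mathbb D)\|\le A_{r,2}(\mathbb D)\,\|\nabla f\mid L^{2}(\mathbb D)\|,$$ where the exact (smallest possible) constant $A_{r,2}(\mathbb D)$ in this inequality satisfies $$A_{r,2}(\mathbb D)\le \inf_{p\in\left(\frac{2r}{r+2},2\right)}\left(\frac{p-1}{2-p}\right)^{\frac{p-1}{p}}\frac{\pi^{\frac{2-r}{2r}}\,2^{-\frac1p}}{\sqrt{\Gamma(2/p)\,\Gamma(3-2/p)}}.$$
   Context: $W^{1,2}_0(\mathbb D)$ is the closure of $C_0^\infty(\mathbb D)$ (smooth functions with compact support in $\mathbb D$) in the norm $\|f\mid W^{1,2}(\mathbb D)\|=\left(\iint_{\mathbb D}|f|^2\,dxdy\right)^{1/2}+\left(\iint_{\mathbb D}|\nabla f|^2\,dxdy\right)^{1/2}$. The notation $\|g\mid L^s(\mathbb D)\|$ means the $L^s$-norm of $g$ (of $|g|$ if $g$ is vector-valued) with respect to Lebesgue measure on $\mathbb D$. $\Gamma$ is the Gamma function. $A_{r,2}(\mathbb D)$ is the smallest constant $A$ such that $\|f\mid L^r(\mathbb D)\|\le A\|\nabla f\mid L^2(\mathbb D)\|$ for all $f\in W^{1,2}_0(\mathbb D)$. *)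

(* Defs.v *)
From mathcomp Require Import all_boot all_order all_algebra.
From mathcomp Require Import all_classical all_reals all_analysis.

Set Implicit Arguments.
Unset Strict Implicit.
Unset Printing Implicit Defensive.
Import Order.TTheory GRing.Theory Num.Theory.
Import numFieldNormedType.Exports.

Local Open Scope classical_set_scope.
Local Open Scope ring_scope.

(* The topology and norm that [R * R] carries in the library are those of the
   maximum norm; compactness, continuity and directional derivatives are the
   same as for the Euclidean norm.  The Euclidean length of a vector is
   [euclid]. *)
Definition euclid (R : realType) (v : R * R) : R :=
  Num.sqrt (v.1 ^+ 2 + v.2 ^+ 2).

Definition unit_disc (R : realType) : set (R * R) := [set z | euclid z < 1].

Definition mu2 (R : realType) :
    {measure set (measurableTypeR R * measurableTypeR R) -> \bar R} :=
  (@lebesgue_measure R \x @lebesgue_measure R)%E.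

(* The integral converges exactly when x > 0. *)
Definition Gamma (R : realType) (x : R) : R :=
  \int[@lebesgue_measure R]_(t in `]0, +oo[) (t `^ (x - 1) * expR (- t)).

(* The L^s norm over D: [f \_ D] extends the restriction of f to D by zero. *)
Definition LnormOn (R : realType) (D : set (R * R)) (s : R)
    (f : R * R -> R) : \bar R :=
  Lnorm (@mu2 R) s%:E (EFin \o (f \_ D)).

(* [false] is the first variable, [true] the second. *)
Definition partial (R : realType) (j : bool) (f : R * R -> R)
    (z : R * R) : R :=
  'D_(if j then (0, 1) else (1, 0)) f z.

Definition grad (R : realType) (f : R * R -> R) (z : R * R) : R * R :=
  (partial false f z, partial true f z).

(* C^infinity: every iterated partial derivative exists and is continuous. *)
Definition smooth (R : realType) (f : R * R -> R) : Prop :=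
  forall s : seq bool,
    continuous (foldr (@partial R) f s : R * R -> R) /\
    forall z : R * R,
      derivable (foldr (@partial R) f s : R * R -> R) z (1, 0) /\
      derivable (foldr (@partial R) f s : R * R -> R) z (0, 1).

(* C_0^infinity(D); an element is represented by its extension by zero to the
   whole plane, which is smooth since the support is a compact subset of D. *)
Definition test_fun (R : realType) (D : set (R * R))
    (phi : R * R -> R) : Prop :=
  [/\ smooth phi,
      compact (closure [set z : R * R | phi z != 0]) &
      closure [set z : R * R | phi z != 0] `<=` D].

(* Measurability is Borel measurability, and f is a representative of its
   class; every Lebesgue-measurable function is a.e. equal to a Borel one. *)
Definition in_L2 (R : realType) (D : set (R * R)) (f : R * R -> R) : Prop :=
  measurable_fun (D : set (measurableTypeR R * measurableTypeR R)) f /\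
   (LnormOn D 2 f < +oo)%E.

Definition weak_gradient (R : realType) (D : set (R * R)) (f : R * R -> R)
    (g : R * R -> R * R) : Prop :=
  forall phi : R * R -> R, test_fun D phi ->
    (\int[@mu2 R]_(z in D) (f z * partial false phi z))
      = - (\int[@mu2 R]_(z in D) ((g z).1 * phi z)) /\
    (\int[@mu2 R]_(z in D) (f z * partial true phi z))
      = - (\int[@mu2 R]_(z in D) ((g z).2 * phi z)).

(* [W12 D f g]: f belongs to W^{1,2}(D) and g represents its gradient, which
   the weak-gradient condition determines up to a null subset of D. *)
Definition W12 (R : realType) (D : set (R * R)) (f : R * R -> R)
    (g : R * R -> R * R) : Prop :=
  [/\ in_L2 D f, in_L2 D (fun z => (g z).1), in_L2 D (fun z => (g z).2) &
      weak_gradient D f g].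

(* The W^{1,2}(D) norm of a function with gradient g. *)
Definition W12_norm (R : realType) (D : set (R * R)) (f : R * R -> R)
    (g : R * R -> R * R) : \bar R :=
  (LnormOn D 2 f + LnormOn D 2 (fun z => euclid (g z)))%E.

(* [W120 D f g]: f belongs to the closure of C_0^infinity(D) in W^{1,2}(D),
   and g represents its gradient. *)
Definition W120 (R : realType) (D : set (R * R)) (f : R * R -> R)
    (g : R * R -> R * R) : Prop :=
  W12 D f g /\
  forall eps : R, 0 < eps -> exists phi : R * R -> R,
    test_fun D phi /\
    (W12_norm D (fun z => (f z - phi z)%R) (fun z => (g z - grad phi z)%R)
      < eps%:E)%E.

Definition sobolev_ineq (R : realType) (D : set (R * R)) (r : R)
    (A : \bar R) : Prop :=
  forall (f : R * R -> R) (g : R * R -> R * R), W120 D f g ->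
    (LnormOn D r f <= A * LnormOn D 2 (fun z => euclid (g z)))%E.

(* A_{r,2}(D), as the infimum of the admissible real constants (+oo if there
   is none); it is the smallest one as soon as it satisfies the inequality. *)
Definition sobolev_const (R : realType) (D : set (R * R)) (r : R) : \bar R :=
  ereal_inf [set A%:E | A in [set A : R | sobolev_ineq D r A%:E]].

(* Main.v *)
(* Put t = 2/p - 1, so that 0 < t < 2/r.  For a test function phi on the disc,
   let W = |phi|^(1/t).  Following Cordero-Erausquin, Nazaret and Villani, the
   density W^2 is transported to a multiple of the bubble
   (1 + |z|^(2/(1-t)))^(-2), not by Brenier's map but by the triangular (Knothe)
   map T = (T1(x), T2(x, y)), which only needs one-dimensional primitives: since
   the Jacobian of T is the product of the two diagonal derivatives, AM-GM still
   bounds its square root by div T / 2.  Integrating W div T by parts and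
   splitting W^(1-t) |grad phi| |T| by Young's inequality into |grad phi|^2, the
   indicator of the disc and W^2 |T|^(2/(1-t)) gives
     (int |phi|^(2/t))^t <= c_t int |grad phi|^2
   where c_t involves only the area pi of the disc and integrals of the bubble;
   the latter reduce to Gamma(1 + t) Gamma(2 - t) = Gamma(2/p) Gamma(3 - 2/p).
   Hoelder's inequality on the disc lowers the exponent from 2/t to r and
   produces exactly the constant of the statement for p; density of the test
   functions concludes. *)

(* With t = 2/p - 1, the exponent 2/t is the Sobolev conjugate 2p/(2-p) of p and 2/(1-t) is the dual
   exponent of p, so the bubble is the power 2/t of Talenti's extremal function for p in the plane.
   Talenti's inequality followed by Hoelder's inequality on the gradient, from L^p to L^2, leads to
   the same constant; keeping the indicator of the disc as a third factor in Young's inequality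
   merges the two steps. The power of |T| is forced: raising W^(2(1-t)) |T|^2 to the power 1/(1-t)
   gives W^2 |T|^(2/(1-t)), where W^2 appears alone, and the change of variables then turns its
   integral into one over the bubble. Regularity shapes the argument. Transport is performed between
   continuous positive densities on squares: W^2 + e on [-1, 1]^2 and a multiple of the bubble on
   [-M, M]^2, while a continuous majorant stands for the indicator of the disc. For fixed M, e and
   the excess of the majorant tend to 0 together; then the weights in Young's inequality are
   optimised; then M tends to infinity. *)
Require Import Defs.
From mathcomp Require Import all_boot all_order all_algebra.
From mathcomp Require Import all_classical all_reals all_analysis.
From mathcomp Require Import measurable_realfun ring lra.
Import Order.TTheory GRing.Theory Num.Theory.
Import numFieldNormedType.Exports.
Local Open Scope classical_set_scope.
Local Open Scope ring_scope.

Set Implicit Arguments.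
Unset Strict Implicit.
Unset Printing Implicit Defensive.

(** * Continuous functions and integrals on the plane *)

Section continuous_plane.
Context {R : realType}.
Notation mu := (@lebesgue_measure R).

(** The measurable sets of the plane are those of the product sigma-algebra. An open set belongs to
    it as the union of the countably many rational boxes that it contains; the other boxes are
    replaced by the empty set. *)
Lemma open_measurable_plane (U : set (R * R)) : open U ->
  measurable (U : set (measurableTypeR R * measurableTypeR R)).
Proof.
move=> oU.
pose B (q : (rat * rat) * (rat * rat)) : set (R * R) :=
  [set z : R * R | (z.1 \in `](ratr q.1.1), (ratr q.1.2)[) /\
           (z.2 \in `](ratr q.2.1), (ratr q.2.2)[)].
have -> : U = \bigcup_q (if `[< B q `<=` U >] then B q else set0).
  apply/seteqP; split => [z Uz|z [q _]]; last by case: asboolP => // BU /BU.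
  have : nbhs z U by apply: open_nbhs_nbhs; split.
  rewrite -nbhs_ballE => -[e /= e0 zeU].
  have h (x : R) : exists q : rat * rat, (x \in `](ratr q.1), (ratr q.2)[) /\
      forall y, y \in `](ratr q.1), (ratr q.2)[ -> ball x e y.
    have [q1 m1] : exists q : rat, ratr q \in `](x - e), x[.
      by apply: rat_in_itvoo; rewrite ltrBlDr ltrDl.
    have [q2 m2] : exists q : rat, ratr q \in `]x, (x + e)[.
      by apply: rat_in_itvoo; rewrite ltrDl.
    move: m1 m2; rewrite !in_itv/= => /andP[x1e x1] /andP[x2 x2e].
    exists (q1, q2); split; rewrite ?in_itv/= ?x1//= => y.
    rewrite in_itv/= => /andP[y1 y2]; rewrite /ball/= ltr_distlC.
    by apply/andP; split; [exact: lt_trans y1|exact: lt_trans x2e].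
  have [q1 [q1z q1b]] := h z.1; have [q2 [q2z q2b]] := h z.2.
  exists (q1, q2) => //; case: asboolP => [_|nBU]; first by split.
  case: nBU => w [w1 w2]; apply: zeU; split; [exact: q1b|exact: q2b].
apply: countable_bigcupT_measurable => // q; case: ifP => // _.
have -> : B q = [set` `](ratr q.1.1 : R), (ratr q.1.2)[] `*`
                [set` `](ratr q.2.1 : R), (ratr q.2.2)[] by [].
exact: measurableX.
Qed.

Lemma continuous_measurable_plane (f : R * R -> R) : continuous f ->
  measurable_fun (setT : set (measurableTypeR R * measurableTypeR R)) f.
Proof.
move=> /continuousP cf.
apply: (measurability _ (RGenOpens.measurableE R)) => _ [_ [a [b ->] <-]].
by rewrite setTI; apply: open_measurable_plane; apply: cf; exact: interval_open.
Qed.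

Lemma continuous_itv_integrable (f : R -> R) a b : continuous f ->
  mu.-integrable `[a, b] (EFin \o f).
Proof.
move=> cf; apply: continuous_compact_integrable; first exact: segment_compact.
exact: continuous_subspaceT.
Qed.

Lemma continuous_pair1 (f : R * R -> R) x : continuous f ->
  continuous (fun y => f (x, y)).
Proof.
move=> cf y; apply: (@continuous_comp _ _ _ (fun y => (x, y))); last exact: cf.
exact: (cvg_pair (cvg_cst x) cvg_id).
Qed.

Lemma continuous_pair2 (f : R * R -> R) y : continuous f ->
  continuous (fun x => f (x, y)).
Proof.
move=> cf x; apply: (@continuous_comp _ _ _ (fun x => (x, y))); last exact: cf.
exact: (cvg_pair cvg_id (cvg_cst y)).
Qed.

Lemma continuous_bounded_rect (f : R * R -> R) a b c d : continuous f ->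
  exists2 M, 0 <= M & forall x y, x \in `[a, b] -> y \in `[c, d] -> `|f (x, y)| <= M.
Proof.
move=> cf.
have : compact (f @` (`[a, b] `*` `[c, d])).
  apply: continuous_compact; first exact: continuous_subspaceT.
  by apply: compact_setX; exact: segment_compact.
move=> /compact_bounded[M [_ Mf]]; exists (`|M| + 1); first by rewrite addr_ge0.
move=> x y xab ycd; apply: Mf; first by rewrite ltr_pwDr// ler_norm.
by exists (x, y).
Qed.

Lemma continuous_param_integral (f : R * R -> R) c d : continuous f ->
  continuous (fun x => \int[mu]_(y in `[c, d]) f (x, y)).
Proof.
move=> cf x.
(* Continuity at x is local, so a constant dominating f for parameters in [x - 1, x + 1]
   suffices. *)
have [M M0 fM] := continuous_bounded_rect (x - 1) (x + 1) c d cf.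
apply: (@continuity_under_integral R _ _ mu (fun x y => f (x, y)) `[c, d]%classic _ (x - 1) (x + 1) _ _ (fun=> M)) => //.
- by move=> z _; apply: continuous_itv_integrable; exact: continuous_pair1.
- by apply: aeW => y _ z _; exact: continuous_pair2.
- by apply: continuous_itv_integrable; exact: cst_continuous.
- move=> z zx; apply: aeW => y ycd; apply: fM => //.
  by move: zx; rewrite /= !in_itv/= => /andP[/ltW -> /ltW ->].
- by rewrite inE/= in_itv/= ltrDl ltrBlDr ltrDl ltr01.
Qed.

(** Fubini's theorem for [k], the extension of f by zero from the rectangle, which is bounded with
    support of finite area; [h1] and [h2] identify its sections. *)
Lemma Rintegral_swap (f : R * R -> R) a b c d : continuous f ->
  \int[mu]_(x in `[a, b]) \int[mu]_(y in `[c, d]) f (x, y) =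
  \int[mu]_(y in `[c, d]) \int[mu]_(x in `[a, b]) f (x, y).
Proof.
move=> cf; pose k := f \_ (`[a, b] `*` `[c, d]).
have mk : measurable_fun (setT : set (measurableTypeR R * measurableTypeR R))
    (EFin \o k).
  apply/measurable_EFinP; apply/(measurable_restrictT _ _).1.
    exact: measurableX.
  exact: measurable_funS (continuous_measurable_plane cf).
have [M M0 fM] := continuous_bounded_rect a b c d cf.
have kx x : (fun y => k (x, y)) =
    if x \in `[a, b] then (fun y => f (x, y)) \_ `[c, d] else cst 0.
  apply/funext => y; rewrite /k /patch in_setX/= !mem_setE.
  by case: (x \in _) => //=; case: (y \in _).
have ky y : (fun x => k (x, y)) =
    if y \in `[c, d] then (fun x => f (x, y)) \_ `[a, b] else cst 0.
  apply/funext => x; rewrite /k /patch in_setX/= !mem_setE andbC.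
  by case: (y \in _) => //=; case: (x \in _).
have mB : measurable (`[a, b] `*` `[c, d] : set (measurableTypeR R * measurableTypeR R)).
  exact: measurableX.
have ik : (mu \x mu)%E.-integrable setT (EFin \o k).
  rewrite /k -restrict_EFin; apply/(integrable_mkcond _ mB).1.
  apply: measurable_bounded_integrable => //.
  - rewrite [X in (X < _)%E]product_measure1E//= !lebesgue_measure_itv/=.
    by case: ifP; case: ifP => // _ _; rewrite ?mul0e ?mule0//= -!EFinB -EFinM ltry.
  - exact: measurable_funS (continuous_measurable_plane cf).
  - exists M; split=> [|N MN]; first exact: num_real.
    by move=> [x y] [xab ycd]; apply: le_trans (ltW MN); exact: fM.
have h1 x : (\int[mu]_y (EFin \o k) (x, y) = (((fun x => \int[mu]_(y in `[c, d]) f (x, y)) \_ `[a, b])%R x)%:E)%E.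
  rewrite (_ : (\int[mu]_y _)%E = (\int[mu]_y (EFin \o (fun y => k (x, y))) y)%E) // kx /patch (_ : (x \in `[a, b]%classic) = (x \in `[a, b])); last by rewrite mem_setE.
  case: ifP => _; last by rewrite integral0_eq.
  rewrite [RHS]fineK.
    by rewrite integral_mkcond restrict_EFin.
  by apply: integrable_fin_num => //; apply: continuous_itv_integrable; exact: continuous_pair1.
have h2 y : (\int[mu]_x (EFin \o k) (x, y) = (((fun y => \int[mu]_(x in `[a, b]) f (x, y)) \_ `[c, d])%R y)%:E)%E.
  rewrite (_ : (\int[mu]_x _)%E = (\int[mu]_x (EFin \o (fun x => k (x, y))) x)%E) // ky /patch (_ : (y \in `[c, d]%classic) = (y \in `[c, d])); last by rewrite mem_setE.
  case: ifP => _; last by rewrite integral0_eq.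
  rewrite [RHS]fineK.
    by rewrite integral_mkcond restrict_EFin.
  by apply: integrable_fin_num => //; apply: continuous_itv_integrable; exact: continuous_pair2.
rewrite [LHS]Rintegral_mkcond [RHS]Rintegral_mkcond /Rintegral; congr fine.
transitivity (\int[mu]_x \int[mu]_y (EFin \o k) (x, y))%E.
  by apply: eq_integral => x _; rewrite h1.
rewrite Fubini//; by apply: eq_integral => y _; rewrite h2.
Qed.

End continuous_plane.

Section continuous_itv.
Context {R : realType}.
Notation mu := (@lebesgue_measure R).
Implicit Types (f g F : R -> R) (a b c d : R).

Lemma Rintegral_itv_cst a b k : a <= b -> \int[mu]_(x in `[a, b]) k = k * (b - a).
Proof.
move=> ab; rewrite Rintegral_cst//= lebesgue_measure_itv/= lte_fin.
by case: ltgtP ab => //= -> _; rewrite subrr mulr0.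
Qed.

Lemma le_Rintegral_itv f g a b : continuous f -> continuous g ->
  (forall x, x \in `[a, b] -> f x <= g x) ->
  \int[mu]_(x in `[a, b]) f x <= \int[mu]_(x in `[a, b]) g x.
Proof. by move=> cf cg fg; apply: le_Rintegral => //; exact: continuous_itv_integrable. Qed.

Lemma Rintegral_itv_split f a b x : continuous f -> a <= x -> x <= b ->
  \int[mu]_(t in `[a, b]) f t =
  \int[mu]_(t in `[a, x]) f t + \int[mu]_(t in `[x, b]) f t.
Proof.
move=> cf ax xb; apply/eqP; rewrite addrC -subr_eq Rintegral_itvB ?bnd_simp//.
  rewrite Rintegral_itv_obnd_cbnd//; apply: integrableS (continuous_itv_integrable a b cf) => //.
  by apply: subset_itvr; rewrite bnd_simp.
exact: continuous_itv_integrable.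
Qed.

Lemma is_derive_Rintegral_itv f a x : continuous f -> a < x ->
  is_derive x (1 : R) (fun x => \int[mu]_(t in `[a, x]) f t) (f x).
Proof.
move=> cf ax; have xx1 : x < x + 1 by rewrite ltrDl.
have [df dfE] := continuous_FTC1_closed xx1 (continuous_itv_integrable a (x + 1) cf) ax (cf x).
by apply: DeriveDef; [exact: df|rewrite -derive1E; exact: dfE].
Qed.

Lemma Rintegral_itv_primitive f F a b : a < b -> continuous f -> continuous F ->
  (forall x, x \in `]a, b[ -> is_derive x (1 : R) F (f x)) ->
  \int[mu]_(x in `[a, b]) f x = F b - F a.
Proof.
move=> ab cf cF dF; rewrite /Rintegral (@continuous_FTC2 _ f F)//=.
- exact: continuous_subspaceT.
- split; [by move=> x /dF[] dx _; exact: dx|apply: cvg_at_right_filter; exact: cF|apply: cvg_at_left_filter; exact: cF].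
- by move=> x /dF[_ <-]; rewrite derive1E.
Qed.

(** Precomposition with it extends a function continuous only within [a, b] to one continuous on the
    line, which is the hypothesis of the integration lemmas above. *)
Definition clip a b (x : R) := Num.max a (Num.min b x).

Lemma clip_itv a b x : a <= b -> clip a b x \in `[a, b].
Proof. by move=> ab; rewrite in_itv/= /clip le_max lexx/= ge_max ab ge_min lexx. Qed.

Lemma clip_id a b x : x \in `[a, b] -> clip a b x = x.
Proof. by rewrite in_itv/= /clip => /andP[ax xb]; rewrite min_r// max_r. Qed.

Lemma continuous_clip a b : continuous (clip a b).
Proof.
move=> x; apply: continuous_max; first exact: cst_continuous.
by apply: continuous_min; [exact: cst_continuous|exact: cvg_id].
Qed.

Lemma continuous_comp_clip f a b : a <= b -> {within `[a, b], continuous f} ->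
  continuous (fun x => f (clip a b x)).
Proof.
move=> ab /subspace_continuousP cf x U fU.
have wU : \forall z \near clip a b x, z \in `[a, b] -> U (f z).
  by have := cf _ (clip_itv x ab) U fU.
have cU : \forall z \near x, clip a b z \in `[a, b] -> U (f (clip a b z)).
  exact: (continuous_clip wU).
by apply: filterS cU => z; apply; exact: clip_itv.
Qed.

End continuous_itv.

(** * Triangular transport *)

Section transport.
Context {R : realType}.
Notation mu := (@lebesgue_measure R).
Variables (f g : R -> R) (a b c d : R).
Hypotheses (ab : a < b) (cd : c < d).
Hypotheses (cf : continuous f) (cg : continuous g).
Hypotheses (f0 : forall x, 0 < f x) (g0 : forall x, 0 < g x).
Hypothesis fg : \int[mu]_(x in `[a, b]) f x = \int[mu]_(x in `[c, d]) g x.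

Let A x := \int[mu]_(t in `[a, x]) f t.
Let B x := \int[mu]_(t in `[c, x]) g t.

Let B_incr u v : c <= u -> u < v -> B u < B v.
Proof.
move=> cu uv; rewrite /B (Rintegral_itv_split cg cu (ltW uv)) ltrDl.
have [w wuv gw] := @EVT_min R g u v (ltW uv) (continuous_subspaceT cg).
apply: (@lt_le_trans _ _ (\int[mu]_(x in `[u, v]) g w)).
  by rewrite Rintegral_itv_cst ?ltW// mulr_gt0// subr_gt0.
by apply: le_Rintegral_itv => //; exact: cst_continuous.
Qed.

Let Bc : B c = 0. Proof. by rewrite /B set_itv1 Rintegral_set1. Qed.

(** Clipping v makes the inverse [G] of [B], chosen below, a total function whose continuity makes
    sense on the whole line. *)
Let Binv v : exists2 u, u \in `[c, d] & B u = clip 0 (B d) v.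
Proof.
have Bd : 0 < B d by rewrite -Bc; apply: B_incr.
apply: IVT; first exact: ltW.
  apply: parameterized_integral_continuous; first exact: ltW.
  exact: continuous_itv_integrable.
rewrite Bc (min_l (ltW Bd)) (max_r (ltW Bd)).
by have := clip_itv v (ltW Bd); rewrite in_itv.
Qed.

Let G v := projT1 (cid2 (Binv v)).

Let Gcd v : G v \in `[c, d]. Proof. by rewrite /G; case: cid2. Qed.

Let BG v : B (G v) = clip 0 (B d) v.
Proof. by rewrite /G; case: cid2. Qed.

Let B_inj u v : u \in `[c, d] -> v \in `[c, d] -> B u = B v -> u = v.
Proof.
rewrite !in_itv/= => /andP[cu _] /andP[cv _].
by case: (ltgtP u v) => // uv Buv; [have := B_incr cu uv|have := B_incr cv uv];
  rewrite Buv ltxx.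
Qed.

Let BK u : u \in `[c, d] -> G (B u) = u.
Proof.
move=> ucd; apply: B_inj => //; rewrite BG clip_id//.
move: ucd; rewrite !in_itv/= => /andP[cu ud]; apply/andP; split.
  by move: cu; rewrite -Bc le_eqVlt => /predU1P[->//|cu]; apply/ltW/B_incr.
move: ud; rewrite le_eqVlt => /predU1P[->//|ud]; exact/ltW/B_incr.
Qed.

(** The minimum m of g over [c, d] bounds the slope of [B] from below, so [G] increases distances by
    a factor of at most 1/m; this is where its continuity comes from. *)
Let B_dist : exists2 m, 0 < m &
  forall u v, u \in `[c, d] -> v \in `[c, d] -> m * `|u - v| <= `|B u - B v|.
Proof.
have [w wcd gw] := @EVT_min R g c d (ltW cd) (continuous_subspaceT cg).
exists (g w) => // u v.
wlog uv : u v / u <= v.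
  move=> h ucd vcd; have [uv|/ltW] := leP u v; first exact: (h _ _ uv).
  by move=> vu; rewrite distrC (distrC (B u)) h.
rewrite !in_itv/= => /andP[cu ud] /andP[cv vd].
rewrite distrC ger0_norm ?subr_ge0// distrC /B (Rintegral_itv_split cg cu uv).
rewrite [X in `|X|]addrC addKr -(Rintegral_itv_cst (g w) uv).
apply: le_trans (ler_norm _); apply: le_Rintegral_itv => //.
  exact: cst_continuous.
move=> x; rewrite in_itv/= => /andP[ux xv]; apply: gw.
by rewrite in_itv/= (le_trans cu)//= (le_trans xv).
Qed.

Let continuous_G : continuous G.
Proof.
have [m m0 mB] := B_dist.
move=> v; apply/cvgrPdist_lt => e e0; near=> w.
rewrite -(ltr_pM2l m0); apply: le_lt_trans (mB _ _ (Gcd v) (Gcd w)) _.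
rewrite !BG; near: w.
have /cvgrPdist_lt := @continuous_clip R 0 (B d) v.
by apply; rewrite mulr_gt0.
Unshelve. all: by end_near. Qed.

Let is_derive_G u : u \in `]c, d[ -> is_derive (B u) (1 : R) G (g u)^-1.
Proof.
move=> ucd; apply: is_derive_inverse.
- near=> v; apply: BK; apply: subset_itv_oo_cc.
  by near: v; exact: near_in_itvoo.
- near=> v.
  have cv : c < v.
    have : v \in `]c, d[ by near: v; exact: near_in_itvoo.
    by rewrite in_itv => /andP[].
  have [dB _] := is_derive_Rintegral_itv cg cv.
  exact/differentiable_continuous/derivable1_diffP.
- by apply: is_derive_Rintegral_itv => //; move: ucd; rewrite in_itv => /andP[].
- by rewrite gt_eqF.
Unshelve. all: by end_near. Qed.

(** The monotone rearrangement: T solves B (T x) = A x, where [A] and [B] are the cumulative masses,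
    and differentiating this relation gives T' = f / g(T). *)
Let transport_map : exists T : R -> R,
  [/\ continuous T, T a = c, T b = d, forall x, T x \in `[c, d] &
    forall x, x \in `]a, b[ ->
      (T x \in `]c, d[) /\ is_derive x (1 : R) T (f x / g (T x))].
Proof.
have Af x y : a <= x -> x < y -> A x < A y.
  move=> ax xy; rewrite /A (Rintegral_itv_split cf ax (ltW xy)) ltrDl.
  have [w wxy fw] := @EVT_min R f x y (ltW xy) (continuous_subspaceT cf).
  apply: (@lt_le_trans _ _ (\int[mu]_(x in `[x, y]) f w)).
    by rewrite Rintegral_itv_cst ?ltW// mulr_gt0// subr_gt0.
  by apply: le_Rintegral_itv => //; exact: cst_continuous.
have Aa : A a = 0 by rewrite /A set_itv1 Rintegral_set1.
have ABd : A b = B d by exact: fg.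
have AB x : x \in `[a, b] -> A x \in `[0, B d].
  rewrite !in_itv/= -Aa -ABd => /andP[]; rewrite !le_eqVlt => ax xb.
  apply/andP; split.
    by case/predU1P: ax => [->|/(Af _ _ (lexx a)) ->]; rewrite ?eqxx ?orbT.
  case/predU1P: xb => [->|xb]; rewrite ?eqxx// Af ?orbT//.
  by case/predU1P: ax => [->|/ltW].
have cA : continuous (fun x => A (clip a b x)).
  apply: continuous_comp_clip; first exact: ltW.
  apply: parameterized_integral_continuous; first exact: ltW.
  exact: continuous_itv_integrable.
exists (fun x => G (A (clip a b x))); split.
- by move=> x; apply: (continuous_comp (cA x)); exact: continuous_G.
- rewrite clip_id ?in_itv/= ?lexx ?ltW// Aa -Bc BK// in_itv/= lexx ltW//.
- by rewrite clip_id ?in_itv/= ?lexx ?ltW// ABd BK// in_itv/= lexx ltW.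
- by move=> x; exact: Gcd.
move=> x xab; have xab' : x \in `[a, b] by exact: subset_itv_oo_cc.
move: (xab); rewrite in_itv/= => /andP[ax xb].
have GAx : B (G (A x)) = A x by rewrite BG clip_id// AB.
(* A x lies strictly between 0 and B d, so interior points go to interior points, the only ones
   where the derivative of the inverse is known. *)
have Gx : G (A x) \in `]c, d[.
  have := Gcd (A x); rewrite !in_itv/= !le_eqVlt => /andP[h1 h2]; apply/andP; split.
    case/predU1P: h1 => // cG; move: GAx; rewrite -cG Bc => /eqP.
    by rewrite lt_eqF// -Aa Af.
  case/predU1P: h2 => // Gd; move: GAx; rewrite Gd -ABd => /eqP.
  by rewrite gt_eqF// Af// ltW.
rewrite clip_id//; split => //.
apply: (@near_eq_is_derive _ _ _ (G \o A)).
  near=> y; rewrite /= clip_id//; apply: subset_itv_oo_cc.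
  by near: y; exact: near_in_itvoo.
have dA := is_derive_Rintegral_itv cf ax.
have dG := is_derive_G Gx; rewrite GAx in dG.
rewrite mulrC; exact: is_derive1_comp.
Unshelve. all: by end_near. Qed.

(** For a primitive P of h, the integrand h(T) f / g(T) is the derivative of P o T, whose increment
    over [a, b] is that of P over [c, d]. *)
Lemma transport : exists T : R -> R,
  [/\ continuous T, T a = c /\ T b = d, (forall x, T x \in `[c, d]),
    (forall x, x \in `]a, b[ -> is_derive x (1 : R) T (f x / g (T x))) &
    forall h : R -> R, continuous h ->
      \int[mu]_(x in `[a, b]) (h (T x) * (f x / g (T x))) =
      \int[mu]_(u in `[c, d]) h u].
Proof.
have [T [cT Ta Tb Tcd dT]] := transport_map; exists T; split => //.
  by move=> x /dT[].
move=> h ch; pose P u := \int[mu]_(t in `[c, u]) h t.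
have cP : continuous (fun u => P (clip c d u)).
  apply: continuous_comp_clip; first exact: ltW.
  apply: parameterized_integral_continuous; first exact: ltW.
  exact: continuous_itv_integrable.
have cPT : continuous (P \o T).
  have -> : P \o T = (fun u => P (clip c d u)) \o T.
    by apply/funext => x /=; rewrite clip_id.
  by move=> x; apply: (continuous_comp (cT x)); exact: cP.
have -> : \int[mu]_(u in `[c, d]) h u = (P \o T) b - (P \o T) a.
  by rewrite /= Ta Tb /P set_itv1 Rintegral_set1 subr0.
apply: Rintegral_itv_primitive => // x.
- apply: cvgM; first by apply: (continuous_comp (cT x)); exact: ch.
  apply: cvgM; first exact: cf.
  apply: cvgV; first by rewrite gt_eqF.
  by apply: (continuous_comp (cT x)); exact: cg.
move=> /dT[]; rewrite in_itv/= => /andP[cTx _] dTx.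
have dP := is_derive_Rintegral_itv ch cTx.
exact: is_derive1_comp.
Qed.

End transport.

Section continuous_combinators.
Context {R : realType} {X : topologicalType}.
Implicit Types (f g : X -> R).

Lemma ctsD f g : continuous f -> continuous g -> continuous (fun x => f x + g x).
Proof. by move=> cf cg x; apply: cvgD; [exact: cf|exact: cg]. Qed.

Lemma ctsN f : continuous f -> continuous (fun x => - f x).
Proof. by move=> cf x; apply: cvgN; exact: cf. Qed.

Lemma ctsM f g : continuous f -> continuous g -> continuous (fun x => f x * g x).
Proof. by move=> cf cg x; apply: cvgM; [exact: cf|exact: cg]. Qed.

Lemma ctsV f : continuous f -> (forall x, f x != 0) -> continuous (fun x => (f x)^-1).
Proof. by move=> cf f0 x; apply: cvgV => //; exact: cf. Qed.

Lemma ctsX f n : continuous f -> continuous (fun x => f x ^+ n).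
Proof.
move=> cf x; apply: (@continuous_comp _ _ _ f (fun y => y ^+ n)); first exact: cf.
exact: exprn_continuous.
Qed.

Lemma cts_comp (h : R -> R) f : continuous h -> continuous f ->
  continuous (fun x => h (f x)).
Proof. by move=> ch cf x; apply: (@continuous_comp _ _ _ f h); [exact: cf|exact: ch]. Qed.

Lemma cts_sqrt f : continuous f -> continuous (fun x => Num.sqrt (f x)).
Proof. by apply: cts_comp; exact: sqrt_continuous. Qed.

Lemma cts_cst (k : R) : continuous (fun _ : X => k).
Proof. exact: cst_continuous. Qed.

End continuous_combinators.

Lemma cts_id {R : realType} : continuous (fun x : R => x).
Proof. by move=> x; exact: cvg_id. Qed.

Lemma cts_fst {R : realType} : continuous (fun z : R * R => z.1).
Proof. by move=> z; exact: cvg_fst. Qed.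

Lemma cts_snd {R : realType} : continuous (fun z : R * R => z.2).
Proof. by move=> z; exact: cvg_snd. Qed.

Ltac cts := lazymatch goal with
  | |- continuous ?f => let f' := eval cbv beta in f in
    lazymatch f' with
    | (fun _ => ?k) => exact (@cts_cst _ _ k)
    | (fun x => x) => exact cts_id
    | (fun z => z.1) => exact cts_fst
    | (fun z => z.2) => exact cts_snd
    | (fun x => @?g x + @?h x) => apply (@ctsD _ _ g h); cts
    | (fun x => - @?g x) => apply (@ctsN _ _ g); cts
    | (fun x => @?g x * @?h x) => apply (@ctsM _ _ g h); cts
    | (fun x => @?g x ^+ ?n) => apply (@ctsX _ _ g n); cts
    | (fun x => Num.sqrt (@?g x)) => apply (@cts_sqrt _ _ g); cts
    | _ => try assumption
    end
  end.

Section Rintegral_continuous.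
Context {R : realType}.
Notation mu := (@lebesgue_measure R).
Implicit Types (f g : R -> R) (a b : R).

Lemma RintegralD_itv f g a b : continuous f -> continuous g ->
  \int[mu]_(x in `[a, b]) (f x + g x) =
  \int[mu]_(x in `[a, b]) f x + \int[mu]_(x in `[a, b]) g x.
Proof. by move=> cf cg; rewrite RintegralD//; exact: continuous_itv_integrable. Qed.

Lemma RintegralB_itv f g a b : continuous f -> continuous g ->
  \int[mu]_(x in `[a, b]) (f x - g x) =
  \int[mu]_(x in `[a, b]) f x - \int[mu]_(x in `[a, b]) g x.
Proof. by move=> cf cg; rewrite RintegralB//; exact: continuous_itv_integrable. Qed.

Lemma RintegralZl_itv k f a b : continuous f ->
  \int[mu]_(x in `[a, b]) (k * f x) = k * \int[mu]_(x in `[a, b]) f x.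
Proof. by move=> cf; rewrite RintegralZl//; exact: continuous_itv_integrable. Qed.

Lemma Rintegral_itv_gt0 f a b : a < b -> continuous f -> (forall x, x \in `[a, b] -> 0 < f x) ->
  0 < \int[mu]_(x in `[a, b]) f x.
Proof.
move=> ab cf f0.
have [w wab fw] := @EVT_min R f a b (ltW ab) (continuous_subspaceT cf).
apply: (@lt_le_trans _ _ (\int[mu]_(x in `[a, b]) f w)).
  by rewrite (Rintegral_itv_cst _ (ltW ab)) mulr_gt0 ?subr_gt0// f0.
by apply: le_Rintegral_itv => //; exact: cst_continuous.
Qed.

(** The common shape of the transport inequality when integrated in y on a slice and then in x: q1
    and q2 are divergence terms, q3 is the Young term on the source and q4 the one on the target. *)
Lemma le_Rintegral_comb (p q1 q2 q3 q4 : R -> R) (k k' l a b : R) : a <= b ->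
  continuous p -> continuous q1 -> continuous q2 -> continuous q3 -> continuous q4 ->
  (forall x, x \in `[a, b] ->
    k * p x - k' <= q1 x + q2 x + q3 x + l * q4 x) ->
  k * \int[mu]_(x in `[a, b]) p x - k' * (b - a) <=
  \int[mu]_(x in `[a, b]) q1 x + \int[mu]_(x in `[a, b]) q2 x +
  \int[mu]_(x in `[a, b]) q3 x + l * \int[mu]_(x in `[a, b]) q4 x.
Proof.
move=> ab cp c1 c2 c3 c4 pq.
have c12 : continuous (fun x : R => q1 x + q2 x : R) by cts.
have c123 : continuous (fun x : R => q1 x + q2 x + q3 x : R) by cts.
have c4' := ctsM (@cts_cst _ _ l) c4.
have cp' := ctsM (@cts_cst _ _ k) cp.
rewrite -(Rintegral_itv_cst k' ab) -!RintegralZl_itv// -RintegralB_itv//; last by cts.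
by rewrite -!RintegralD_itv//; apply: le_Rintegral_itv => //; cts.
Qed.

End Rintegral_continuous.

(** * The divergence inequality for the Knothe map between two squares *)

Section knothe.
Context {R : realType}.
Notation mu := (@lebesgue_measure R).
Variables (a b c d : R) (W Wx Wy G V H : R * R -> R) (e C k : R).
Hypotheses (ab : a < b) (cd : c < d).
Hypotheses (cW : continuous W) (cWx : continuous Wx) (cWy : continuous Wy).
Hypotheses (cG : continuous G) (cV : continuous V) (cH : continuous H).
Hypothesis dWx : forall x y, is_derive x (1 : R) (fun x => W (x, y)) (Wx (x, y)).
Hypothesis dWy : forall x y, is_derive y (1 : R) (fun y => W (x, y)) (Wy (x, y)).
Hypothesis Wa1 : forall y, W (a, y) = 0.
Hypothesis Wb1 : forall y, W (b, y) = 0.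
Hypothesis Wa2 : forall x, W (x, a) = 0.
Hypothesis Wb2 : forall x, W (x, b) = 0.
Hypotheses (W0 : forall z, 0 <= W z) (G0 : forall z, 0 < G z) (V0 : forall z, 0 <= V z).
Hypotheses (e0 : 0 < e) (k0 : 0 <= k).
Hypothesis GC : forall u v, u \in `[c, d] -> v \in `[c, d] -> 1 <= C * Num.sqrt (G (u, v)).
Hypothesis mass : \int[mu]_(x in `[a, b]) \int[mu]_(y in `[a, b]) (W (x, y) ^+ 2 + e) =
  \int[mu]_(u in `[c, d]) \int[mu]_(v in `[c, d]) G (u, v).
Hypothesis WH : forall x y u v, x \in `[a, b] -> y \in `[a, b] ->
  u \in `[c, d] -> v \in `[c, d] ->
  - (u * Wx (x, y) + v * Wy (x, y)) <= H (x, y) + k * (W (x, y) ^+ 2 * V (u, v)).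

Let F z := W z ^+ 2 + e.
Let F0 z : 0 < F z. Proof. by rewrite /F ltr_wpDl// sqr_ge0. Qed.
Let cF : continuous F. Proof. by rewrite /F; cts. Qed.

Let F1 x := \int[mu]_(y in `[a, b]) F (x, y).
Let G1 u := \int[mu]_(v in `[c, d]) G (u, v).
Let cF1 : continuous F1. Proof. exact: continuous_param_integral. Qed.
Let cG1 : continuous G1. Proof. exact: continuous_param_integral. Qed.
Let F10 x : 0 < F1 x.
Proof. by apply: Rintegral_itv_gt0 => //; exact: continuous_pair1. Qed.
Let G10 x : 0 < G1 x.
Proof. by apply: Rintegral_itv_gt0 => //; exact: continuous_pair1. Qed.

Let I1 u := \int[mu]_(v in `[c, d]) Num.sqrt (G (u, v)).
Let J1 u := \int[mu]_(v in `[c, d]) (G (u, v) * V (u, v)).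
Let cI1 : continuous I1.
Proof. by apply: (continuous_param_integral (f := fun z => Num.sqrt (G z))); cts. Qed.
Let cJ1 : continuous J1.
Proof. by apply: (continuous_param_integral (f := fun z => G z * V z)); cts. Qed.

(* Here u = T1(x) and r = T1'(x); the pointwise step is AM-GM in the form
   2 sqrt(F / G) <= r + D y, where D is the derivative of T2 in y and
   r * D y = F / G.  The parameter e keeps F positive. *)
Let slice (x u r : R) : x \in `[a, b] -> u \in `[c, d] -> 0 < r ->
  F1 x = r * G1 u ->
  2 * (r * I1 u) - 2 * e * C * (b - a) <=
  \int[mu]_(y in `[a, b]) (r * W (x, y) + u * Wx (x, y)) +
  \int[mu]_(y in `[a, b]) H (x, y) + k * (r * J1 u).
Proof.
move=> xab ucd r0 F1r.
have cWx1 : continuous (fun y => W (x, y)) by exact: continuous_pair1.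
have cWxx1 : continuous (fun y => Wx (x, y)) by exact: continuous_pair1.
have cWyx1 : continuous (fun y => Wy (x, y)) by exact: continuous_pair1.
have cHx1 : continuous (fun y => H (x, y)) by exact: continuous_pair1.
have cFx : continuous (fun y => F (x, y)) by exact: continuous_pair1.
have cGu : continuous (fun v => G (u, v)) by exact: continuous_pair1.
have cVu : continuous (fun v => V (u, v)) by exact: continuous_pair1.
have cphi : continuous (fun y => r^-1 * F (x, y)) by cts.
have phi0 y : 0 < r^-1 * F (x, y) by rewrite mulr_gt0// invr_gt0.
have Gu0 v : 0 < G (u, v) by [].
(* Division by r = T1'(x) gives the slice of F at x the mass of the slice of G at u = T1(x), so the
   second component of the map exists. *)
have masses : \int[mu]_(y in `[a, b]) (r^-1 * F (x, y)) = \int[mu]_(v in `[c, d]) G (u, v).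
  by rewrite RintegralZl_itv// -/(F1 x) F1r mulrA mulVf ?mul1r// gt_eqF.
have [T [cT [Ta Tb] Tcd dT sT]] := transport ab cd cphi cGu phi0 Gu0 masses.
pose D y := r^-1 * F (x, y) / G (u, T y).
have cGT : continuous (fun y => G (u, T y)) by exact: (cts_comp (h := fun v => G (u, v))).
have cVT : continuous (fun y => V (u, T y)) by exact: (cts_comp (h := fun v => V (u, v))).
have cD : continuous D.
  by apply: ctsM => //; apply: ctsV => // y; rewrite gt_eqF.
have pw y : y \in `[a, b] ->
  2 * r * (Num.sqrt (G (u, T y)) * D y) - 2 * e * C <=
  (r * W (x, y) + u * Wx (x, y)) + (Wy (x, y) * T y + W (x, y) * D y) + H (x, y) +
  k * r * (G (u, T y) * V (u, T y) * D y).
  move=> yab; have := WH xab yab ucd (Tcd y).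
  set s := Num.sqrt (G (u, T y)).
  have s0 : 0 < s by rewrite sqrtr_gt0.
  have sG : G (u, T y) = s ^+ 2 by rewrite sqr_sqrtr// ltW.
  pose q := Num.sqrt (F (x, y)).
  have q0 : 0 < q by rewrite sqrtr_gt0.
  have qF : F (x, y) = q ^+ 2 by rewrite sqr_sqrtr// ltW.
  have Wq : W (x, y) <= q by rewrite -[leLHS]ger0_norm// -sqrtr_sqr (ler_sqrt _ (ltW (F0 _))) /F lerDl ltW.
  have W2 : W (x, y) ^+ 2 = q ^+ 2 - e by rewrite -qF addrK.
  have Cs : s^-1 <= C by rewrite -(ler_pM2r s0) mulVf ?gt_eqF// GC.
  have DE : r * s ^+ 2 * D y = q ^+ 2.
    by rewrite /D sG qF; field; rewrite !gt_eqF.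
  have rD : 2 * q * s^-1 <= r + D y.
    rewrite -subr_ge0 (_ : _ - _ = (r - q / s) ^+ 2 / r).
      by rewrite divr_ge0 ?sqr_ge0// ltW.
    by rewrite /D sG qF; field; rewrite !gt_eqF.
  have DE2 : 2 * r * (s * D y) = 2 * q ^+ 2 * s^-1.
    by rewrite /D sG qF; field; rewrite !gt_eqF.
  rewrite DE2 sG.
  have -> : k * r * (s ^+ 2 * V (u, T y) * D y) = k * (q ^+ 2 * V (u, T y)).
    by rewrite -DE; ring.
  (* The transported density is q^2 = W^2 + e, but the divergence is multiplied by W. As W <= q, the
     product is at least 2 W^2 / s = 2 q^2 / s - 2 e / s, and 1 / s <= C. *)
  have key : 2 * q ^+ 2 * s^-1 - 2 * e * C <= W (x, y) * (r + D y).
    have h1 : W (x, y) * (2 * q * s^-1) <= W (x, y) * (r + D y) by rewrite ler_wpM2l.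
    have h2 : W (x, y) ^+ 2 * (2 * s^-1) <= W (x, y) * (2 * q * s^-1).
      rewrite expr2 -!mulrA ler_wpM2l// mulrCA ler_wpM2l// ler_wpM2r//.
      by rewrite invr_ge0 ltW.
    have h3 : e * s^-1 <= e * C by rewrite ler_wpM2l// ltW.
    rewrite W2 in h2; nra.
  have h4 : k * (W (x, y) ^+ 2 * V (u, T y)) <= k * (q ^+ 2 * V (u, T y)).
    by rewrite ler_wpM2l// ler_wpM2r// W2 gerBl ltW.
  move: key h4; lra.
have pi :
  2 * r * I1 u - 2 * e * C * (b - a) <=
  \int[mu]_(y in `[a, b]) (r * W (x, y) + u * Wx (x, y)) + 0 +
  \int[mu]_(y in `[a, b]) H (x, y) + k * r * J1 u.
  rewrite /I1 /J1 -(sT (fun v => Num.sqrt (G (u, v)))); last by cts.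
  rewrite -(sT (fun v => G (u, v) * V (u, v))); last by cts.
  (* The integrand is the y-derivative of W T, and W vanishes on both horizontal sides. *)
  have -> : 0 = \int[mu]_(y in `[a, b]) (Wy (x, y) * T y + W (x, y) * D y).
    transitivity (W (x, b) * T b - W (x, a) * T a).
      by rewrite Wa2 Wb2 !mul0r subrr.
    symmetry; apply: (@Rintegral_itv_primitive _ _ (fun y => W (x, y) * T y)); [by []|by cts|by cts|].
    move=> y yab; have dTy := dT y yab; have dW := dWy x y.
    apply: is_derive_eq.
    by rewrite /GRing.scale/= addrC mulrC; congr (_ + _); rewrite mulrC.
  apply: (@le_Rintegral_comb _ (fun y => Num.sqrt (G (u, T y)) * D y)
    (fun y => r * W (x, y) + u * Wx (x, y))
    (fun y => Wy (x, y) * T y + W (x, y) * D y)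
    (fun y => H (x, y)) (fun y => G (u, T y) * V (u, T y) * D y)) => //;
  [exact: ltW|by cts..].
by move: pi; rewrite addr0 !mulrA.
Qed.

(** The slice inequality is used at u = T1(x) and r = T1'(x) and integrated in x; the factor r lets
    the change of variables by T1 turn the outer integrals of [I1] and [J1] into integrals over
    [c, d]. The error term pays for the e added to W^2, with C bounding 1 / sqrt G on the target. *)
Lemma knothe_ineq :
  2 * (\int[mu]_(u in `[c, d]) \int[mu]_(v in `[c, d]) Num.sqrt (G (u, v))) -
    2 * e * C * (b - a) ^+ 2 <=
  \int[mu]_(x in `[a, b]) \int[mu]_(y in `[a, b]) H (x, y) +
  k * \int[mu]_(u in `[c, d]) \int[mu]_(v in `[c, d]) (G (u, v) * V (u, v)).
Proof.
have [T [cT [Ta Tb] Tcd dT sT]] := transport ab cd cF1 cG1 F10 G10 mass.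
pose r x := F1 x / G1 (T x).
have cr : continuous r.
  apply: ctsM => //; apply: ctsV; first exact: cts_comp.
  by move=> x; rewrite gt_eqF.
have sl x : x \in `[a, b] -> 2 * (I1 (T x) * r x) - 2 * e * C * (b - a) <=
  \int[mu]_(y in `[a, b]) (r x * W (x, y) + T x * Wx (x, y)) +
  \int[mu]_(y in `[a, b]) H (x, y) + k * (J1 (T x) * r x).
  move=> xab; rewrite (mulrC (I1 _)) (mulrC (J1 _)); apply: slice => //.
    by rewrite /r divr_gt0.
  by rewrite /r mulfVK// gt_eqF.
have cK : continuous (fun z : R * R => r z.1 * W z + T z.1 * Wx z).
  by apply: ctsD; apply: ctsM => //; apply: cts_comp => //; exact: cts_fst.
have cK1 := continuous_param_integral (c := a) (d := b) cK.
have cH1 := continuous_param_integral (c := a) (d := b) cH.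
have cIT : continuous (fun x => I1 (T x)) by exact: cts_comp.
have cJT : continuous (fun x => J1 (T x)) by exact: cts_comp.
(* With the x-integral moved inside, the integrand is the x-derivative of T1 W, and W vanishes on
   both vertical sides. *)
have K0 : \int[mu]_(x in `[a, b]) \int[mu]_(y in `[a, b]) (r x * W (x, y) + T x * Wx (x, y)) = 0.
  rewrite (Rintegral_swap a b a b cK) /=.
  rewrite -[RHS](mul0r (b - a)) -(Rintegral_itv_cst 0 (ltW ab)).
  apply: eq_Rintegral => y _.
  transitivity (T b * W (b, y) - T a * W (a, y)).
    apply: (@Rintegral_itv_primitive _ _ (fun x => T x * W (x, y))) => //.
  - exact: (continuous_pair2 (f := fun z => r z.1 * W z + T z.1 * Wx z)).
  - by apply: ctsM => //; exact: continuous_pair2.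
  - move=> x xab; have dTx := dT x xab; have dW := dWx x y.
    apply: is_derive_eq.
    by rewrite /GRing.scale/= addrC mulrC.
  by rewrite Wa1 Wb1 !mulr0 subrr.
have := @le_Rintegral_comb _ (fun x => I1 (T x) * r x)
  (fun x => \int[mu]_(y in `[a, b]) (r x * W (x, y) + T x * Wx (x, y)))
  (cst 0) (fun x => \int[mu]_(y in `[a, b]) H (x, y))
  (fun x => J1 (T x) * r x) 2 (2 * e * C * (b - a)) k a b (ltW ab).
rewrite !sT// K0 add0r (Rintegral_itv_cst 0 (ltW ab)) mul0r add0r expr2 !mulrA.
apply; [by cts|exact: cK1|exact: cts_cst|exact: cH1|by cts|].
by move=> x xab; rewrite addr0 sl.
Qed.

End knothe.

(** * Powers of the absolute value and weighted AM-GM *)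

Section signed_power.
Context {R : realType}.
Implicit Types (a b v x y t : R).

Lemma is_derive_normr_powR_neq0 a v : v != 0 ->
  is_derive v (1 : R) (fun v => `|v| `^ a) (a * (`|v| `^ (a - 1) * Num.sg v)).
Proof.
have [v0 _|v0 _|//] := ltgtP v 0.
- apply: (@near_eq_is_derive _ _ _ ((fun v => v `^ a) \o -%R)).
    by near=> w; rewrite /= ltr0_norm//; near: w; exact: lt_nbhsl.
  rewrite ltr0_norm// ltr0_sg// mulrA.
  have Nv0 : 0 < - v by rewrite oppr_gt0.
  have dp := is_derive1_powR a Nv0.
  have dN : is_derive v (1 : R) -%R (-1) by apply: is_derive_eq.
  exact: is_derive1_comp.
- apply: (@near_eq_is_derive _ _ _ (fun v => v `^ a)).
    by near=> w; rewrite gtr0_norm//; near: w; exact: lt_nbhsr.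
  by rewrite gtr0_norm// gtr0_sg// mulr1; exact: is_derive1_powR.
Unshelve. all: by end_near. Qed.

Lemma continuous_normr_powR b : 0 < b -> continuous (fun v : R => `|v| `^ b).
Proof.
move=> b0 v; have [->|v0] := eqVneq v 0; last first.
  have [dv _] := is_derive_normr_powR_neq0 b v0.
  exact/differentiable_continuous/derivable1_diffP.
apply/cvgrPdist_lt => e e0; rewrite normr0 powR0 ?gt_eqF//.
near=> w; rewrite sub0r normrN ger0_norm ?powR_ge0//.
have -> : e = (e `^ b^-1) `^ b by rewrite -powRrM mulVf ?gt_eqF// powRr1// ltW.
rewrite gt0_ltr_powR ?nnegrE ?powR_ge0//.
near: w; apply/nbhs_ballP; exists (e `^ b^-1); first by rewrite /= powR_gt0.
by move=> w; rewrite /ball/= sub0r normrN.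
Unshelve. all: by end_near. Qed.

Lemma cvg0_sg_powR b : 0 < b ->
  (`|w| `^ b * Num.sg w) @[w --> (0 : R)] --> (0 : R).
Proof.
move=> b0; have h : (`|w| `^ b) @[w --> (0 : R)] --> (0 : R).
  have := @continuous_normr_powR b b0 (0 : R).
  by rewrite /continuous_at normr0 powR0 ?gt_eqF.
apply: norm_cvg0; apply: (squeeze_cvgr _ (cvg_cst 0) h); near=> w.
rewrite normr_ge0/= normrM (ger0_norm (powR_ge0 _ _)) ler_piMr ?powR_ge0//.
by rewrite normr_sg lern1 leq_b1.
Unshelve. all: by end_near. Qed.

Lemma continuous_sg_powR b : 0 < b -> continuous (fun v : R => `|v| `^ b * Num.sg v).
Proof.
move=> b0 v; have [->|v0] := eqVneq v 0.
  by rewrite /continuous_at sgr0 mulr0; exact: cvg0_sg_powR.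
have [v1|v1|] := ltgtP v 0; last by move/eqP; rewrite (negbTE v0).
  have h : {near v, (fun w => `|w| `^ b * Num.sg v) =1 (fun v => `|v| `^ b * Num.sg v)}.
    by near=> w; rewrite (ltr0_sg v1) ltr0_sg//; near: w; exact: lt_nbhsl.
  apply: cvg_trans (near_eq_cvg h) _; apply: cvgM (cvg_cst _).
  exact: continuous_normr_powR.
have h : {near v, (fun w => `|w| `^ b * Num.sg v) =1 (fun v => `|v| `^ b * Num.sg v)}.
  by near=> w; rewrite (gtr0_sg v1) gtr0_sg//; near: w; exact: lt_nbhsr.
apply: cvg_trans (near_eq_cvg h) _; apply: cvgM (cvg_cst _).
exact: continuous_normr_powR.
Unshelve. all: by end_near. Qed.

(** At 0 Caratheodory's criterion applies: the difference quotient is |w|^(a-1) sg w, continuous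
    there because a > 1. With a = 1/t this makes |phi|^(1/t) continuously differentiable across the
    zeros of phi. *)
Lemma is_derive_normr_powR a v : 1 < a ->
  is_derive v (1 : R) (fun v => `|v| `^ a) (a * (`|v| `^ (a - 1) * Num.sg v)).
Proof.
move=> a1; have a0 : 0 < a by exact: lt_trans a1.
have [->|] := eqVneq v 0; last exact: is_derive_normr_powR_neq0.
rewrite sgr0 !mulr0; apply/is_derive1_caratheodory.
exists (fun w => `|w| `^ (a - 1) * Num.sg w); split.
- move=> w; rewrite normr0 powR0 ?gt_eqF// !subr0 -mulrA -normrEsg.
  by rewrite mulrC mulr_powRB1.
- by apply: continuous_sg_powR; rewrite subr_gt0.
- by rewrite /= sgr0 mulr0.
Qed.

(** Young's inequality with exponents 1/t and 1/(1-t), applied to x^t and y^(1-t). *)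
Lemma powR_AMGM t x y : 0 < t < 1 -> 0 <= x -> 0 <= y ->
  x `^ t * y `^ (1 - t) <= t * x + (1 - t) * y.
Proof.
move=> /andP[t0 t1] x0 y0; have t1' : 0 < 1 - t by rewrite subr_gt0.
have := @conjugate_powR R (x `^ t) (y `^ (1 - t)) t^-1 (1 - t)^-1.
rewrite !powR_ge0 !invr_gt0 !invrK -!powRrM !mulfV ?gt_eqF// !powRr1//.
by rewrite (addrC t) subrK (mulrC x) (mulrC y); exact.
Qed.

End signed_power.

(** * Radial integrals and the Gamma function *)

(** Monotone convergence along an exhaustion; it serves for intervals in the half-line, squares in
    the plane and the sublevel sets of |f|. *)
Lemma le_integral_nondecreasing_cover d (T : measurableType d) (R : realType)
    (mu : {measure set T -> \bar R}) (F : (set T)^nat) (D : set T) (f : T -> \bar R)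
    (B : \bar R) :
  nondecreasing_seq F -> (forall n, measurable (F n)) -> \bigcup_n F n = D ->
  measurable_fun D f -> (forall x, D x -> (0 <= f x)%E) ->
  (forall n, (\int[mu]_(x in F n) f x <= B)%E) -> (\int[mu]_(x in D) f x <= B)%E.
Proof.
move=> ndF mF <- mf f0 FB.
have mfF n : measurable_fun (F n) f.
  by apply: measurable_funS mf; [exact: bigcup_measurable|exact: bigcup_sup].
have f0F n x : F n x -> (0 <= f x)%E by move=> Fx; apply: f0; exists n.
have h := @ge0_nondecreasing_set_cvg_integral _ _ _ F f mu ndF mF mfF f0F.
rewrite -(cvg_lim _ h)//; apply: lime_le; first by apply: cvgP h.
exact: nearW.
Qed.

Section half_line.
Context {R : realType}.
Notation mu := (@lebesgue_measure R).

Lemma EFin_Rintegral_itv (f : R -> R) a b : continuous f ->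
  (\int[mu]_(x in `[a, b]) f x)%:E = (\int[mu]_(x in `[a, b]) (f x)%:E)%E.
Proof.
by move=> cf; rewrite /Rintegral fineK//; apply: integrable_fin_num => //; exact: continuous_itv_integrable.
Qed.

Lemma measurable_half_line (f : R -> R) (D : set R) : continuous f -> measurable D ->
  measurable_fun D (EFin \o f).
Proof.
move=> cf mD; apply/measurable_EFinP.
exact: measurable_funS (continuous_measurable_fun cf).
Qed.

Lemma ge0_integral_itvy_le (f : R -> R) (B : \bar R) : continuous f ->
  (forall x, 0 <= x -> 0 <= f x) ->
  (forall n : nat, ((\int[mu]_(x in `[0, n%:R]) f x)%:E <= B)%E) ->
  (\int[mu]_(x in `[0%R, +oo[) (f x)%:E <= B)%E.
Proof.
move=> cf f0 fB.
apply: (@le_integral_nondecreasing_cover _ _ _ mu (fun n => `[0%R, n%:R]%classic)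
  `[0%R, +oo[%classic (EFin \o f)).
- apply/nondecreasing_seqP => n; apply/subsetPset; apply: subset_itvl.
  by rewrite bnd_simp ler_nat.
- by move=> n.
- apply/seteqP; split => x /=.
    by move=> [n _]; rewrite /= !in_itv/= => /andP[->].
  rewrite in_itv/= andbT => x0; exists (Num.truncn x).+1 => //=.
  by rewrite in_itv/= x0 ltW// truncnS_gt.
- exact: measurable_half_line.
- by move=> x; rewrite /= in_itv/= andbT lee_fin; exact: f0.
- by move=> n; rewrite -EFin_Rintegral_itv.
Qed.

Lemma ge0_integral_itvy_ge (f : R -> R) (b : R) : continuous f ->
  (forall x, 0 <= x -> 0 <= f x) ->
  ((\int[mu]_(x in `[0, b]) f x)%:E <= \int[mu]_(x in `[0%R, +oo[) (f x)%:E)%E.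
Proof.
move=> cf f0; rewrite EFin_Rintegral_itv//; apply: ge0_subset_integral => //.
- exact: measurable_half_line.
- by move=> x; rewrite /= in_itv/= andbT lee_fin; exact: f0.
- by move=> x; rewrite /= !in_itv/= => /andP[->].
Qed.

Lemma Rintegral_itv_le_ge0 (f : R -> R) b c : continuous f ->
  (forall x, 0 <= x -> 0 <= f x) -> 0 <= b -> b <= c ->
  \int[mu]_(x in `[0, b]) f x <= \int[mu]_(x in `[0, c]) f x.
Proof.
move=> cf f0 b0 bc; rewrite (Rintegral_itv_split cf b0 bc) lerDl.
apply: Rintegral_ge0 => x; rewrite /= in_itv/= => /andP[bx _]; apply: f0.
exact: le_trans bx.
Qed.

(** The substitution is exact from [0, b] to [0, F b]; since k is nonnegative and F unbounded, each
    of the two half-line integrals is bounded by the other. *)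
Lemma ge0_substitution_half_line (k F F' : R -> R) :
  continuous k -> (forall x, 0 <= x -> 0 <= k x) ->
  continuous F -> continuous F' -> (forall x, 0 <= x -> 0 <= F' x) ->
  (forall x : R, 0 < x -> is_derive x (1 : R) F (F' x)) ->
  F 0 = 0 -> (forall x, 0 < x -> 0 < F x) ->
  (forall A, exists2 x, 0 < x & A <= F x) ->
  (\int[mu]_(x in `[0%R, +oo[) (k (F x) * F' x)%:E =
   \int[mu]_(x in `[0%R, +oo[) (k x)%:E)%E.
Proof.
move=> ck k0 cF cF' F'0 dF F00 Fgt0 Fy.
have F0 (x : R) : 0 <= x -> 0 <= F x.
  by rewrite le_eqVlt => /predU1P[<-|/Fgt0/ltW//]; rewrite F00.
have ckF : continuous (fun x => k (F x) * F' x).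
  by apply: ctsM => //; exact: cts_comp.
have kF0 (x : R) : 0 <= x -> 0 <= k (F x) * F' x.
  by move=> x0; rewrite mulr_ge0 ?k0 ?F0 ?F'0.
have sub (b : R) : 0 < b -> \int[mu]_(x in `[0, b]) (k (F x) * F' x) = \int[mu]_(x in `[0, (F b)]) k x.
  (* The lower limit -1 makes [P] differentiable, hence continuous, at 0 too; [Num.max 0] then
     yields a function continuous on the whole line. *)
  move=> b0; pose P (u : R) := \int[mu]_(x in `[(-1), u]) k x.
  have dP (u : R) : 0 <= u -> is_derive u (1 : R) P (k u).
    by move=> u0; apply: is_derive_Rintegral_itv => //; rewrite (lt_le_trans _ u0)// ltrN10.
  have PB (u : R) : 0 <= u -> \int[mu]_(x in `[0, u]) k x = P u - P 0.
    move=> u0; have N10 : -1 <= 0 :> R by rewrite oppr_le0.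
    by rewrite /P (Rintegral_itv_split ck N10 u0) addrC addKr.
  have cP : continuous (fun u : R => P (Num.max 0 u)).
    move=> u; apply: (@continuous_comp R R R (fun u : R => Num.max 0 u) P u).
      by apply: continuous_max; [exact: cst_continuous|exact: cvg_id].
    have u0 : 0 <= Num.max 0 u by rewrite le_max lexx.
    have [d _] := dP _ u0.
    exact/differentiable_continuous/derivable1_diffP.
  rewrite PB ?F0 ?(ltW b0)//.
  transitivity (P (Num.max 0 (F b)) - P (Num.max 0 (F 0))).
    apply: (@Rintegral_itv_primitive _ _ (fun x : R => P (Num.max 0 (F x)))) => //.
      exact: (cts_comp cP cF).
    move=> x; rewrite in_itv/= => /andP[x0 xb].
    apply: (@near_eq_is_derive _ _ _ (P \o F)).
      near=> y; rewrite /= max_r// F0// ltW//; near: y; exact: lt_nbhsr.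
    have d1 := dF x x0; have d2 := dP (F x) (F0 x (ltW x0)).
    exact: is_derive1_comp.
  by rewrite F00 maxxx max_r// F0// ltW.
apply/eqP; rewrite eq_le; apply/andP; split.
  apply: ge0_integral_itvy_le => // n.
  have [->|n0] := eqVneq n 0%N.
    by rewrite set_itv1 Rintegral_set1; apply: integral_ge0 => x; rewrite /= in_itv/= andbT lee_fin; exact: k0.
  rewrite sub ?ltr0n ?lt0n//; exact: ge0_integral_itvy_ge.
apply: ge0_integral_itvy_le => // n.
have [b b0 nb] := Fy n%:R.
apply: le_trans (ge0_integral_itvy_ge b ckF kF0); rewrite sub// lee_fin.
exact: Rintegral_itv_le_ge0.
Unshelve. all: by end_near. Qed.

End half_line.

Section plane_integrals.
Context {R : realType}.
Notation mu := (@lebesgue_measure R).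
Notation plane := (measurableTypeR R * measurableTypeR R)%type.

Let patch_setX (A B : set R) (f : R * R -> \bar R) x y :
  (f \_ (A `*` B)) (x, y) = ((fun x => ((fun y => f (x, y)) \_ B) y) \_ A) x.
Proof. by rewrite /patch in_setX/=; case: (x \in A); case: (y \in B). Qed.

Let patch_setX2 (A B : set R) (f : R * R -> \bar R) x y :
  (f \_ (A `*` B)) (x, y) = ((fun y => ((fun x => f (x, y)) \_ A) x) \_ B) y.
Proof. by rewrite /patch in_setX/=; case: (x \in A); case: (y \in B). Qed.

Lemma tonelli_setX1 (A B : set (measurableTypeR R)) (f : plane -> \bar R) :
  measurable A -> measurable B -> measurable_fun setT f -> (forall z, (0 <= f z)%E) ->
  (\int[@mu2 R]_(z in A `*` B) f z =
   \int[mu]_(x in A) \int[mu]_(y in B) f (x, y))%E.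
Proof.
move=> mA mB mf f0.
have mAB : measurable (A `*` B : set plane) by exact: measurableX.
have f0' z : (0 <= (f \_ (A `*` B)) z)%E by rewrite /patch; case: ifP.
have mfAB : measurable_fun setT (f \_ (A `*` B) : plane -> \bar R).
  by apply/(measurable_restrictT _ _).1 => //; exact: measurable_funTS.
rewrite integral_mkcond [LHS]fubini_tonelli1// [RHS]integral_mkcond.
apply: eq_integral => x _; rewrite /fubini_F.
transitivity (\int[mu]_y ((fun x => ((fun y => f (x, y)) \_ B) y) \_ A) x)%E.
  by apply: eq_integral => y _; exact: patch_setX.
rewrite [RHS]/patch; case: ifP => xA.
  by rewrite [RHS]integral_mkcond; apply: eq_integral => y _; rewrite {1}/patch xA.
by apply: integral0_eq => y _; rewrite {1}/patch xA.
Qed.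

Lemma tonelli_setX2 (A B : set (measurableTypeR R)) (f : plane -> \bar R) :
  measurable A -> measurable B -> measurable_fun setT f -> (forall z, (0 <= f z)%E) ->
  (\int[@mu2 R]_(z in A `*` B) f z =
   \int[mu]_(y in B) \int[mu]_(x in A) f (x, y))%E.
Proof.
move=> mA mB mf f0.
have mAB : measurable (A `*` B : set plane) by exact: measurableX.
have f0' z : (0 <= (f \_ (A `*` B)) z)%E by rewrite /patch; case: ifP.
have mfAB : measurable_fun setT (f \_ (A `*` B) : plane -> \bar R).
  by apply/(measurable_restrictT _ _).1 => //; exact: measurable_funTS.
rewrite integral_mkcond [LHS]fubini_tonelli2// [RHS]integral_mkcond.
apply: eq_integral => y _; rewrite /fubini_G.
transitivity (\int[mu]_x ((fun y => ((fun x => f (x, y)) \_ A) x) \_ B) y)%E.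
  by apply: eq_integral => x _; exact: patch_setX2.
rewrite [RHS]/patch; case: ifP => yB.
  by rewrite [RHS]integral_mkcond; apply: eq_integral => x _; rewrite {1}/patch yB.
by apply: integral0_eq => x _; rewrite {1}/patch yB.
Qed.

Lemma measurable_integral_section1 (B : set (measurableTypeR R)) (f : plane -> \bar R) :
  measurable B -> measurable_fun setT f -> (forall z, (0 <= f z)%E) ->
  measurable_fun (setT : set (measurableTypeR R)) (fun x => \int[mu]_(y in B) f (x, y))%E.
Proof.
move=> mB mf f0.
have f0' z : (0 <= (f \_ (setT `*` B)) z)%E by rewrite /patch; case: ifP.
have mfB : measurable_fun setT (f \_ (setT `*` B) : plane -> \bar R).
  apply/(measurable_restrictT _ _).1; first exact: measurableX.
  exact: measurable_funTS.
have := measurable_fun_fubini_tonelli_F (m2 := mu) _ mfB f0'.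
apply: eq_measurable_fun => x _; rewrite /fubini_F [RHS]integral_mkcond.
by apply: eq_integral => y _; rewrite /patch in_setX/= in_setT.
Qed.

Lemma measurable_integral_section2 (A : set (measurableTypeR R)) (f : plane -> \bar R) :
  measurable A -> measurable_fun setT f -> (forall z, (0 <= f z)%E) ->
  measurable_fun (setT : set (measurableTypeR R)) (fun y => \int[mu]_(x in A) f (x, y))%E.
Proof.
move=> mA mf f0.
have f0' z : (0 <= (f \_ (A `*` setT)) z)%E by rewrite /patch; case: ifP.
have mfA : measurable_fun setT (f \_ (A `*` setT) : plane -> \bar R).
  apply/(measurable_restrictT _ _).1; first exact: measurableX.
  exact: measurable_funTS.
have := measurable_fun_fubini_tonelli_G (m1 := mu) _ mfA f0'.
apply: eq_measurable_fun => y _; rewrite /fubini_G [RHS]integral_mkcond.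
by apply: eq_integral => x _; rewrite /patch in_setX/= in_setT andbT.
Qed.

Lemma tonelli_swap (A B : set (measurableTypeR R)) (f : R * R -> R) :
  measurable A -> measurable B -> continuous f -> (forall z, 0 <= f z) ->
  (\int[mu]_(x in A) \int[mu]_(y in B) (f (x, y))%:E =
   \int[mu]_(y in B) \int[mu]_(x in A) (f (x, y))%:E)%E.
Proof.
move=> mA mB cf f0.
have mf : measurable_fun setT (EFin \o f : plane -> \bar R).
  by apply/measurable_EFinP; exact: continuous_measurable_plane.
rewrite -(tonelli_setX1 mA mB mf) ?(tonelli_setX2 mA mB mf)// => z; rewrite lee_fin; exact: f0.
Qed.

Lemma integral_rect (f : R * R -> R) a b c d : continuous f -> (forall z, 0 <= f z) ->
  (\int[@mu2 R]_(z in `[a, b] `*` `[c, d]) (f z)%:E)%E =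
  (\int[mu]_(x in `[a, b]) \int[mu]_(y in `[c, d]) f (x, y))%:E.
Proof.
move=> cf f0.
have mf : measurable_fun setT (EFin \o f : plane -> \bar R).
  by apply/measurable_EFinP; exact: continuous_measurable_plane.
rewrite (tonelli_setX1 _ _ mf)//.
rewrite EFin_Rintegral_itv; last exact: continuous_param_integral.
apply: eq_integral => x _; rewrite EFin_Rintegral_itv//; exact: continuous_pair1.
Qed.

(** Laplace's device for the Gaussian integral replaces polar coordinates: reduce to a quadrant,
    substitute y = x u, exchange the integrals and substitute s = x^2 (1 + u^2). The variable u
    leaves the integral of 1 / (1 + u^2), which is pi / 2, and 4 * (1/2) * (pi / 2) = pi. *)
Lemma integral_radial (k : R -> R) : continuous k -> (forall x, 0 <= x -> 0 <= k x) ->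
  (\int[@mu2 R]_z (k (z.1 ^+ 2 + z.2 ^+ 2))%:E =
   pi%:E * \int[mu]_(s in `[0%R, +oo[) (k s)%:E)%E.
Proof.
move=> ck k0.
pose f (z : R * R) := k (z.1 ^+ 2 + z.2 ^+ 2).
have cf : continuous f by apply: (cts_comp ck); cts.
have f0 z : 0 <= f z by rewrite k0// addr_ge0// sqr_ge0.
have mf : measurable_fun setT (EFin \o f : plane -> \bar R).
  by apply/measurable_EFinP; exact: continuous_measurable_plane.
have ef0 z : (0 <= (EFin \o f) z)%E by rewrite lee_fin.
have mH : measurable (`[0%R, +oo[%classic : set (measurableTypeR R)) by [].
have mO : measurable (`]0%R, +oo[%classic : set (measurableTypeR R)) by [].
have sym2 x : (\int[mu]_y (f (x, y))%:E = 2%:E * \int[mu]_(y in `[0%R, +oo[) (f (x, y))%:E)%E.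
  rewrite ge0_symfun_integralT ?set_itvcy//; first exact: continuous_pair1.
  by move=> y; rewrite /f/= sqrrN.
(* The endpoint 0 is dropped here because y = x u is a substitution in y only for x > 0. *)
have sym1 y : (\int[mu]_x (f (x, y))%:E = 2%:E * \int[mu]_(x in `]0%R, +oo[) (f (x, y))%:E)%E.
  rewrite ge0_symfun_integralT//; [|exact: continuous_pair2|by move=> x; rewrite /f/= sqrrN].
  rewrite -set_itvcy integral_itv_obnd_cbnd//.
  by apply: measurable_half_line => //; exact: continuous_pair2.
rewrite -[LHS]/(\int[@mu2 R]_z (EFin \o f) z)%E -setXTT (tonelli_setX1 _ _ mf)//.
transitivity (4%:E * \int[mu]_(x in `]0%R, +oo[) \int[mu]_(y in `[0%R, +oo[) (f (x, y))%:E)%E.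
  transitivity (2%:E * \int[mu]_(x in setT) \int[mu]_(y in `[0%R, +oo[) (f (x, y))%:E)%E.
    rewrite -ge0_integralZl//=; last first.
    - by move=> x _; apply: integral_ge0 => y _; rewrite lee_fin.
    - exact: (measurable_integral_section1 mH mf).
    by apply: eq_integral => x _; rewrite -sym2.
  rewrite (tonelli_swap measurableT mH cf f0).
  transitivity (2%:E * \int[mu]_(y in `[0%R, +oo[) (2%:E * \int[mu]_(x in `]0%R, +oo[) (f (x, y))%:E))%E.
    by congr (_ * _)%E; apply: eq_integral => y _; rewrite -sym1.
  rewrite ge0_integralZl//=; last first.
  - by move=> x _; apply: integral_ge0 => y _; rewrite lee_fin.
  - exact: measurable_funTS (measurable_integral_section2 mO mf ef0).
  by rewrite muleA -EFinM -natrM (tonelli_swap mO mH cf f0).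
transitivity (4%:E * \int[mu]_(u in `[0%R, +oo[) \int[mu]_(x in `]0%R, +oo[) (k (x ^+ 2 * (1 + u ^+ 2)) * `|x|)%:E)%E.
  congr (_ * _)%E.
  pose h (z : R * R) := k (z.1 ^+ 2 * (1 + z.2 ^+ 2)) * `|z.1|.
  have ch : continuous h.
    apply: ctsM; first by apply: (cts_comp ck); cts.
    by move=> z; apply: cvg_norm; exact: cvg_fst.
  have h0 z : 0 <= h z.
    by rewrite mulr_ge0// k0// mulr_ge0 ?sqr_ge0// addr_ge0// sqr_ge0.
  rewrite -(tonelli_swap mO mH ch h0); apply: eq_integral => x; rewrite inE/= in_itv/= andbT => x0.
  transitivity (\int[mu]_(u in `[0%R, +oo[) (f (x, (x * u)%R) * x)%:E)%E; last first.
    by apply: eq_integral => u _; rewrite /f /h /= gtr0_norm// mulrDr mulr1 exprMn.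
  symmetry; apply: (@ge0_substitution_half_line _ (fun y => f (x, y)) (fun u => x * u) (fun=> x)).
  - exact: continuous_pair1.
  - by [].
  - by cts.
  - exact: cts_cst.
  - by move=> _ _; exact: ltW.
  - by move=> u _; apply: is_derive_eq; rewrite /GRing.scale/= mulr1.
  - by rewrite mulr0.
  - by move=> u; exact: mulr_gt0.
  - move=> a; exists (Num.max 1 (a / x)); first by rewrite lt_max ltr01.
    by rewrite mulrC -ler_pdivrMr// le_max lexx orbT.
set L := (\int[mu]_(s in `[0%R, +oo[) (k s)%:E)%E.
have L0 : (0 <= L)%E.
  by apply: integral_ge0 => s; rewrite /= in_itv/= andbT lee_fin; exact: k0.
transitivity (4%:E * \int[mu]_(u in `[0%R, +oo[) ((oneDsqr u)^-1%:E * ((2^-1)%:E * L)))%E.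
  congr (_ * _)%E; apply: eq_integral => u; rewrite inE/= in_itv/= andbT => u0.
  have c0 : 0 < 2 * (1 + u ^+ 2) by rewrite mulr_gt0// ltr_wpDr// sqr_ge0.
  have ckx : continuous (fun x : R => k (x ^+ 2 * (1 + u ^+ 2))).
    by apply: (cts_comp ck); cts.
  rewrite integral_itv_obnd_cbnd; last first.
    apply: measurable_half_line => //; apply: ctsM => // x.
    by apply: cvg_norm; exact: cvg_id.
  have -> : L = (\int[mu]_(x in `[0%R, +oo[) (k (x ^+ 2 * (1 + u ^+ 2)) * (2 * (1 + u ^+ 2) * x))%:E)%E.
    symmetry; apply: (@ge0_substitution_half_line _ k (fun x => x ^+ 2 * (1 + u ^+ 2))
      (fun x => 2 * (1 + u ^+ 2) * x)) => //.
    - by cts.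
    - by cts.
    - by move=> x x0; rewrite mulr_ge0// ltW.
    - move=> x x0; apply: is_derive_eq.
      rewrite /GRing.scale/=; ring.
    - by rewrite expr0n mul0r.
    - by move=> x x0; rewrite mulr_gt0 ?exprn_gt0// ltr_wpDr// sqr_ge0.
    - move=> a; exists (1 + `|a|); first by rewrite ltr_wpDr.
      apply: (@le_trans _ _ (`|a| * (1 + u ^+ 2))).
        by rewrite (le_trans (ler_norm a))// ler_peMr// lerDl sqr_ge0.
      rewrite ler_wpM2r ?addr_ge0 ?sqr_ge0// sqrrD expr1n mul1r.
      by have := normr_ge0 a; have := sqr_ge0 `|a|; lra.
  rewrite muleA -EFinM -ge0_integralZl//=.
  + apply: eq_integral => x; rewrite inE/= in_itv/= andbT => x0.
    rewrite -EFinM; congr _%:E; rewrite ger0_norm// /oneDsqr; field.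
    by rewrite gt_eqF// ltr_wpDr// sqr_ge0.
  + apply: (@measurable_half_line _ (fun x : R => k (x ^+ 2 * (1 + u ^+ 2)) * (2 * (1 + u ^+ 2) * x))) => //.
    by apply: ctsM; [exact: ckx|apply: ctsM; [exact: cts_cst|exact: cts_id]].
  + move=> x; rewrite in_itv/= andbT lee_fin => x0.
    by rewrite mulr_ge0 ?k0 ?mulr_ge0 ?sqr_ge0 ?addr_ge0 ?sqr_ge0.
rewrite ge0_integralZr//.
- rewrite integral0y_oneDsqr !muleA -!EFinM; congr (_%:E * _)%E.
  by field.
- apply: measurable_half_line => //; exact: continuous_oneDsqrV.
- by rewrite mule_ge0// lee_fin.
Qed.

End plane_integrals.

(** * The moments of x^2 exp(-c x) on the half-line *)

Section gamma_product.
Context {R : realType}.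
Notation mu := (@lebesgue_measure R).

Lemma integral_sqr_expRN :
  (\int[mu]_(x in `[0%R, +oo[) (x ^+ 2 * expR (- x))%:E = 2%:E)%E.
Proof.
pose F (x : R) := - ((x ^+ 2 + 2 * x + 2) * expR (- x)).
have cE : continuous (fun x : R => expR (- x)).
  by apply: cts_comp; [exact: continuous_expR|exact: (ctsN cts_id)].
have cP : continuous (fun x : R => x ^+ 2 + 2 * x + 2) by cts.
have cF : continuous F by exact: ctsN (ctsM cP cE).
have dF (x : R) : is_derive x (1 : R) F (x ^+ 2 * expR (- x)).
  have dE : is_derive x (1 : R) (fun x : R => expR (- x)) (- expR (- x)).
    have dN : is_derive x (1 : R) -%R (-1) by apply: is_derive_eq.
    have := @is_derive1_comp _ expR -%R x _ _ (is_derive_expR (- x)) dN.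
    by rewrite mulrN1.
  rewrite /F; apply: is_derive_eq.
  by rewrite /GRing.scale/=; ring.
rewrite (@ge0_continuous_FTC2y _ _ F 0 0).
- have -> : F 0 = - 2 by rewrite /F oppr0 expR0; ring.
  by rewrite -EFinB sub0r opprK.
- by move=> x _; rewrite mulr_ge0 ?sqr_ge0 ?expR_ge0.
- by apply: continuous_subspaceT; apply: ctsM => //; cts.
- rewrite -oppr0; apply: cvgN; apply/cvgrPdist_lt => e e0; near=> x.
  have x0 : 0 <= x by near: x; exact: nbhs_pinfty_ge.
  rewrite sub0r normrN ger0_norm; last first.
    by rewrite mulr_ge0 ?expR_ge0// !addr_ge0 ?sqr_ge0 ?mulr_ge0.
  have x1 : 0 < 1 + x / 4 by rewrite ltr_wpDr// divr_ge0.
  (* Of these four factors two absorb the polynomial, as x^2 + 2 x + 2 <= 32 (1 + x / 4)^2, and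
     another one gives the decay 32 / (1 + x / 4). *)
  have Ex : (1 + x / 4) ^+ 4 <= expR x.
    have -> : expR x = expR (x / 4) ^+ 4 by rewrite -expRM_natl mulrC divfK.
    by rewrite lerXn2r ?nnegrE ?expR_ge0 ?expR_ge1Dx// ltW.
  apply: (@le_lt_trans _ _ (32 / (1 + x / 4))).
    rewrite expRN ler_pdivrMr ?expR_gt0// mulrAC ler_pdivlMr//.
    apply: (@le_trans _ _ (32 * (1 + x / 4) ^+ 4)); last by rewrite ler_wpM2l.
    have h : x ^+ 2 + 2 * x + 2 <= 32 * (1 + x / 4) ^+ 2.
      by have := sqr_ge0 x; rewrite sqrrD; lra.
    have h1 : 1 + x / 4 <= (1 + x / 4) ^+ 2.
      by rewrite expr2; apply: ler_peMl; [exact: ltW|rewrite lerDl divr_ge0].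
    have -> : 32 * (1 + x / 4) ^+ 4 = (32 * (1 + x / 4) ^+ 2) * (1 + x / 4) ^+ 2 by ring.
    apply: ler_pM => //; last exact: ltW.
    by rewrite !addr_ge0 ?sqr_ge0 ?mulr_ge0.
  rewrite ltr_pdivrMr// -ltr_pdivrMl//.
  apply: (@lt_le_trans _ _ (1 + (4 * (e^-1 * 32)) / 4)).
    by set q := e^-1 * 32; lra.
  rewrite lerD2l ler_pM2r//; near: x; apply: nbhs_pinfty_ge; exact: num_real.
- by move=> x _; case: (dF x).
- by apply: cvg_at_right_filter; exact: cF.
- by move=> x _; rewrite derive1E; case: (dF x).
Unshelve. all: by end_near. Qed.

Lemma integral_sqr_expRMN (c : R) : 0 < c ->
  (\int[mu]_(x in `[0%R, +oo[) (x ^+ 2 * expR (- (x * c)))%:E = (2 / c ^+ 3)%:E)%E.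
Proof.
move=> c0.
have cE : continuous (fun x : R => expR (- x)).
  by apply: cts_comp; [exact: continuous_expR|exact: (ctsN cts_id)].
have ck : continuous (fun x : R => x ^+ 2 * expR (- x)) by apply: ctsM => //; cts.
have h : (\int[mu]_(x in `[0%R, +oo[) ((c * x) ^+ 2 * expR (- (c * x)) * c)%:E = 2%:E)%E.
  rewrite -integral_sqr_expRN.
  apply: (@ge0_substitution_half_line _ (fun x => x ^+ 2 * expR (- x)) (fun x => c * x) (fun=> c)) => //.
  - by move=> x _; rewrite mulr_ge0 ?sqr_ge0 ?expR_ge0.
  - by cts.
  - exact: cts_cst.
  - by move=> x _; exact: ltW.
  - by move=> x _; apply: is_derive_eq; rewrite /GRing.scale/= mulr1.
  - by rewrite mulr0.
  - by move=> x x0; rewrite mulr_gt0.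
  - move=> a; exists (Num.max 1 (a / c)); first by rewrite lt_max ltr01.
    by rewrite mulrC -ler_pdivrMr// le_max lexx orbT.
transitivity ((c ^+ 3)^-1%:E * \int[mu]_(x in `[0%R, +oo[) ((c * x) ^+ 2 * expR (- (c * x)) * c)%:E)%E.
  rewrite -ge0_integralZl//=.
  - apply: eq_integral => x _; rewrite -EFinM; congr _%:E.
    by rewrite (mulrC c x); field; rewrite gt_eqF.
  - apply: (@measurable_half_line _ (fun x => (c * x) ^+ 2 * expR (- (c * x)) * c)) => //.
    apply: ctsM; last exact: cts_cst.
    by apply: (cts_comp (f := fun x : R => c * x) ck); apply: ctsM; [exact: cts_cst|exact: cts_id].
  - by move=> x _; rewrite lee_fin (mulr_ge0 (mulr_ge0 (sqr_ge0 _) (expR_ge0 _)) (ltW c0)).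
  - by rewrite lee_fin invr_ge0 exprn_ge0 ?(ltW c0).
by rewrite h -EFinM mulrC.
Qed.

End gamma_product.

(** * Integrals of the bubble in the variable s = |z|^2 *)

Section bubble_profile.
Context {R : realType}.
Notation mu := (@lebesgue_measure R).
Variable a : R.
Hypothesis a01 : 0 < a < 1.
Let a0 : 0 < a. Proof. by case/andP: a01. Qed.
Let a1 : a < 1. Proof. by case/andP: a01. Qed.
Let m := a^-1.
Let m0 : 0 < m. Proof. by rewrite invr_gt0. Qed.
Let m1 : 1 < m. Proof. by rewrite invf_gt1. Qed.

(** With a = 1 - t and s = |z|^2 its square is the bubble. The absolute value makes it continuous on
    the whole line. *)
Definition profile (s : R) : R := (1 + `|s| `^ a^-1)^-1.
Notation g := profile.
Let p (s : R) : R := `|s| `^ m.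

Let p0 s : 0 <= p s. Proof. exact: powR_ge0. Qed.
Let p1 s : 0 < 1 + p s. Proof. by rewrite ltr_wpDr. Qed.
Let cp : continuous p. Proof. exact: continuous_normr_powR. Qed.

Lemma profile_gt0 s : 0 < g s. Proof. by rewrite invr_gt0; exact: p1. Qed.

Lemma continuous_profile : continuous g.
Proof.
apply: ctsV; first by apply: ctsD; [exact: cts_cst|exact: cp].
by move=> s; rewrite gt_eqF//; exact: p1.
Qed.

Let pE s : p s = (g s)^-1 - 1. Proof. by rewrite /g invrK addrAC subrr add0r. Qed.

Let cg := continuous_profile.

Let is_derive_profile s : is_derive s (1 : R) g (- (g s ^+ 2 * (m * (`|s| `^ (m - 1) * Num.sg s)))).
Proof.
have dp := is_derive_normr_powR s m1.
have d1 : is_derive s (1 : R) (fun s => 1 + p s) (m * (`|s| `^ (m - 1) * Num.sg s)).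
  apply: is_derive_eq. by rewrite add0r mul1r.
have h : 1 + p s != 0 by rewrite gt_eqF.
have dV := is_deriveV (f := fun s => 1 + p s) h d1.
apply: (@is_derive_eq _ _ _ _ _ _ _ _ dV).
by rewrite /GRing.scale/= mulNr exprVn.
Qed.

Let sg_powRM s : s * (`|s| `^ (m - 1) * Num.sg s) = p s.
Proof.
rewrite mulrCA (mulrC s) -normrEsg mulrC.
by rewrite mulr_powRB1.
Qed.

(** From s g' = - m g^2 p and g = g^2 (1 + p) one gets (s g)' = g^2 - (m - 1) g^2 p. *)
Lemma profile_parts1 S : 0 < S ->
  \int[mu]_(s in `[0, S]) g s ^+ 2 =
  (m - 1) * \int[mu]_(s in `[0, S]) (g s ^+ 2 * p s) + S * g S.
Proof.
move=> S0; rewrite -RintegralZl_itv; last by cts.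
apply/eqP; rewrite addrC -subr_eq -RintegralB_itv; [|by cts|by cts].
apply/eqP; transitivity (S * g S - 0 * g 0); last by rewrite mul0r subr0.
apply: (@Rintegral_itv_primitive _ _ (fun s => s * g s)) => //; [by cts|by cts|].
move=> s _; have dg := is_derive_profile s; apply: is_derive_eq.
have pgs := sg_powRM s; rewrite /GRing.scale/=.
move: pgs; set w := `|s| `^ (m - 1) * Num.sg s => pgs.
have gp : g s = g s ^+ 2 + g s ^+ 2 * p s.
  by have g0 := profile_gt0 s; rewrite pE; field; rewrite gt_eqF.
have -> : s * - (g s ^+ 2 * (m * w)) = - (g s ^+ 2 * m * p s) by rewrite -pgs; ring.
by rewrite mulr1 [X in _ + X]gp; ring.
Qed.

(** Here (s g^2)' = g^2 - 2 m p g^3. The last weight is the one produced by the product of two Gamma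
    integrals below, which links the bubble to Gamma. *)
Lemma profile_parts2 S : 0 < S ->
  \int[mu]_(s in `[0, S]) g s ^+ 2 =
  \int[mu]_(s in `[0, S]) (2 * m * p s * g s ^+ 3) + S * g S ^+ 2.
Proof.
move=> S0.
apply/eqP; rewrite addrC -subr_eq -RintegralB_itv; [|by cts|by cts].
apply/eqP; transitivity (S * g S ^+ 2 - 0 * g 0 ^+ 2); last by rewrite mul0r subr0.
apply: (@Rintegral_itv_primitive _ _ (fun s => s * g s ^+ 2)) => //; [by cts|by cts|].
move=> s _; have dg := is_derive_profile s; apply: is_derive_eq.
have pgs := sg_powRM s; rewrite /GRing.scale/=.
by rewrite -pgs; ring.
Qed.

Lemma profile_sum S : \int[mu]_(s in `[0, S]) g s =
  \int[mu]_(s in `[0, S]) g s ^+ 2 + \int[mu]_(s in `[0, S]) (g s ^+ 2 * p s).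
Proof.
rewrite -RintegralD_itv; [|by cts|by cts]; apply: eq_Rintegral => s _.
have g0 := profile_gt0 s.
by rewrite pE; field; rewrite gt_eqF.
Qed.

(** The boundary terms of the two integrations by parts disappear at infinity because S g(S) <=
    S^(1-m) with m > 1. *)
Lemma profile_tail e : 0 < e -> exists S0 : R, forall S, S0 <= S -> S * g S <= e.
Proof.
move=> e0; exists (Num.max 1 ((e^-1) `^ (m - 1)^-1)) => S.
rewrite ge_max => /andP[S1 eS].
have S0 : 0 < S by exact: lt_le_trans S1.
rewrite /g -/m ler_pdivrMr ?p1//.
have h : e^-1 <= S `^ (m - 1).
  have -> : e^-1 = (e^-1 `^ (m - 1)^-1) `^ (m - 1).
    rewrite -powRrM mulVf ?powRr1 ?invr_ge0 ?(ltW e0)//.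
    by rewrite subr_eq0 gt_eqF.
  apply: ge0_ler_powR => //; first by rewrite subr_ge0 ltW.
    by rewrite nnegrE powR_ge0.
  by rewrite nnegrE ltW.
have pS : p S = S * S `^ (m - 1) by rewrite /p gtr0_norm// mulr_powRB1// ltW.
rewrite -ler_pdivrMl// -/(p S) mulrC pS.
by apply: le_trans (ler_wpM2l (ltW S0) h) _; rewrite lerDr.
Qed.

(** A crude bound whose purpose is the finiteness of the Gamma integrals. It compares g^2 with 4 /
    (1 + s)^2, as 1 + s <= 2 (1 + p s): clear for s <= 1, and p s >= s beyond. *)
Lemma profile_sqr_bounded S : 0 < S -> \int[mu]_(s in `[0, S]) g s ^+ 2 <= 4.
Proof.
move=> S0; pose h (s : R) := (1 + `|s|)^-1 ^+ 2.
have n1 (s : R) : 0 < 1 + `|s| by rewrite ltr_wpDr.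
have ch : continuous h.
  apply: ctsX; apply: ctsV; last by move=> s; rewrite gt_eqF.
  by apply: ctsD; [exact: cts_cst|move=> s; apply: cvg_norm; exact: cvg_id].
apply: (@le_trans _ _ (\int[mu]_(s in `[0, S]) (4 * h s))).
  apply: le_Rintegral_itv; [by cts|by apply: ctsM => //; exact: cts_cst|].
  move=> s; rewrite in_itv/= => /andP[s0 _].
  have -> : 4 * h s = (2 * (1 + `|s|)^-1) ^+ 2 by rewrite exprMn; congr (_ * _); ring.
  rewrite lerXn2r ?nnegrE ?mulr_ge0 ?invr_ge0 ?(ltW (n1 _)) ?(ltW (profile_gt0 _))//.
  rewrite (ler_pdivlMr _ _ (n1 s)) mulrC (ler_pdivrMr _ _ (p1 s)) ger0_norm//; have [s1|s1] := leP s 1.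
    by have := p0 s; lra.
  have : s <= p s.
    rewrite /p ger0_norm// -[leLHS](powRr1 s0); apply: ler_powR; exact: ltW.
  by move=> ?; lra.
rewrite RintegralZl_itv// ler_piMr//.
pose H (s : R) := - (1 + `|s|)^-1.
have -> : \int[mu]_(s in `[0, S]) h s = H S - H 0.
  apply: (@Rintegral_itv_primitive _ _ H) => //.
    apply: ctsN; apply: ctsV; last by move=> s; rewrite gt_eqF.
    by apply: ctsD; [exact: cts_cst|move=> s; apply: cvg_norm; exact: cvg_id].
  move=> s; rewrite in_itv/= => /andP[s0 _].
  apply: (@near_eq_is_derive _ _ _ (fun s : R => - (1 + s)^-1 : R)).
    by near=> u; rewrite /H gtr0_norm//; near: u; exact: lt_nbhsr.
  have s1 : 1 + s != 0 by rewrite gt_eqF// ltr_wpDl.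
  have d1 : is_derive s (1 : R) (fun s : R => 1 + s : R) 1.
    by apply: is_derive_eq; rewrite add0r mulr1.
  have d2 := is_deriveV (f := fun s => 1 + s) s1 d1; apply: is_derive_eq.
  by rewrite /h gtr0_norm// /GRing.scale/= mulr1 opprK exprVn.
by rewrite /H normr0 addr0 invr1 opprK gerDr oppr_le0 invr_ge0 ltW.
Unshelve. all: by end_near. Qed.

(** Gamma (b + 1) before its finiteness is known; the real-valued [Gamma] would send an infinite
    integral to 0. *)
Definition egamma (b : R) : \bar R :=
  (\int[mu]_(x in `[0%R, +oo[) (`|x| `^ b * expR (- x))%:E)%E.

Lemma GammaE (b : R) : 0 < b -> Gamma (b + 1) = fine (egamma b).
Proof.
move=> b0; rewrite /Gamma /Rintegral addrK; congr fine.
rewrite integral_itv_obnd_cbnd; last first.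
  apply/measurable_EFinP; apply: measurable_funM.
    exact: measurable_funTS (measurable_powR _).
  apply: measurable_funTS; apply: continuous_measurable_fun.
  by apply: cts_comp; [exact: continuous_expR|exact: (ctsN cts_id)].
by apply: eq_integral => x; rewrite inE/= in_itv/= andbT => x0; rewrite ger0_norm.
Qed.

Let egamma_ge0 b : (0 <= egamma b)%E.
Proof.
by apply: integral_ge0 => x _; rewrite lee_fin mulr_ge0 ?powR_ge0 ?expR_ge0.
Qed.

Let q s := 2 * m * p s * g s ^+ 3.
Let q0 s : 0 <= q s.
Proof. by rewrite /q !mulr_ge0 ?exprn_ge0 ?(ltW m0) ?(ltW (profile_gt0 _)). Qed.
Let cq : continuous q. Proof. by rewrite /q; cts. Qed.

(* Substituting x = y |s|^(1/a) in the inner integral turns the product into an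
   integral over s of the weight q. *)
Lemma egamma_product :
  (egamma a * egamma (1 - a) = \int[mu]_(s in `[0%R, +oo[) (q s)%:E)%E.
Proof.
have b0 : 0 < 1 - a by rewrite subr_gt0.
have cE : continuous (fun x : R => expR (- x)).
  by apply: cts_comp; [exact: continuous_expR|exact: (ctsN cts_id)].
have cgam (b : R) : 0 < b -> continuous (fun x : R => `|x| `^ b * expR (- x)).
  by move=> hb; apply: ctsM => //; exact: continuous_normr_powR.
(* The integrand after x = y p(s). Since p^a = s and s p' = m p, the powers y^(1-a), y^a and y
   combine to y^2, and integrating in y gives 2 / (1 + p)^3. *)
pose f (z : R * R) := m * (p z.2 * (z.1 ^+ 2 * expR (- (z.1 * (1 + p z.2))))).
have cp2 : continuous (fun z : R * R => p z.2) by apply: (cts_comp cp); exact: cts_snd.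
have cf : continuous f.
  rewrite /f; apply: ctsM; first exact: cts_cst.
  apply: ctsM => //; apply: ctsM; first by cts.
  by apply: (cts_comp (f := fun z : R * R => z.1 * (1 + p z.2)) cE); cts.
have f0 z : 0 <= f z.
  by rewrite /f mulr_ge0 ?(ltW m0)// mulr_ge0// mulr_ge0 ?sqr_ge0 ?expR_ge0.
have gam0 (b x : R) : 0 <= `|x| `^ b * expR (- x) by rewrite mulr_ge0 ?powR_ge0 ?expR_ge0.
have mH : measurable (`[0%R, +oo[%classic : set (measurableTypeR R)) by [].
have mgam (b : R) : 0 < b -> measurable_fun (`[0%R, +oo[%classic : set (measurableTypeR R)) (fun x : R => (`|x| `^ b * expR (- x))%:E).
  by move=> hb; exact: (measurable_half_line (cgam b hb) mH).
transitivity (\int[mu]_(y in `[0%R, +oo[) \int[mu]_(s in `[0%R, +oo[) (f (y, s))%:E)%E.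
  rewrite muleC {1}/egamma -ge0_integralZr//; last exact: mgam.
  apply: eq_integral => y; rewrite inE/= in_itv/= andbT le_eqVlt => /predU1P[<-|y0].
    rewrite normr0 powR0 ?gt_eqF// mul0r mul0e integral0_eq// => s _.
    by rewrite /f /= expr0n/= mul0r !mulr0.
  have cF' : continuous (fun s : R => y * (m * (`|s| `^ (m - 1) * Num.sg s))).
    apply: ctsM; first exact: cts_cst.
    apply: ctsM; first exact: cts_cst.
    by apply: continuous_sg_powR; rewrite subr_gt0.
  have ck := cgam a a0.
  have cF : continuous (fun s => y * p s) by apply: ctsM => //; exact: cts_cst.
  have -> : egamma a = (\int[mu]_(s in `[0%R, +oo[)
      (`|y * p s| `^ a * expR (- (y * p s)) * (y * (m * (`|s| `^ (m - 1) * Num.sg s))))%:E)%E.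
    symmetry; apply: (@ge0_substitution_half_line _ (fun x => `|x| `^ a * expR (- x))
      (fun s => y * p s) (fun s => y * (m * (`|s| `^ (m - 1) * Num.sg s)))) => //.
    - move=> s s0; rewrite mulr_ge0 ?(ltW y0)// mulr_ge0 ?(ltW m0)//.
      by rewrite mulr_ge0 ?powR_ge0// sgr_ge0.
    - move=> s _; have dp := is_derive_normr_powR s m1; apply: is_derive_eq.
      rewrite /GRing.scale/=; reflexivity.
    - by rewrite /p normr0 powR0 ?mulr0// gt_eqF.
    - by move=> s s0; rewrite mulr_gt0// powR_gt0// normr_gt0 gt_eqF.
    - move=> A; exists (Num.max 1 (A / y)); first by rewrite lt_max ltr01.
      set s := Num.max _ _; have s1 : 1 <= s by rewrite le_max lexx.
      have sp : s <= p s.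
        rewrite /p ger0_norm ?(le_trans _ s1)// -[leLHS]powRr1 ?(le_trans _ s1)//.
        by apply: ler_powR => //; exact: ltW.
      rewrite mulrC -ler_pdivrMr//; apply: le_trans sp.
      by rewrite le_max lexx orbT.
  rewrite -ge0_integralZl//; last 2 first.
  - exact: (measurable_half_line (ctsM (cts_comp ck cF) cF') mH).
  - move=> s; rewrite /= in_itv/= andbT => s0; rewrite lee_fin mulr_ge0//.
    rewrite mulr_ge0 ?(ltW y0)// mulr_ge0 ?(ltW m0)//.
    by rewrite mulr_ge0 ?powR_ge0// sgr_ge0.
  apply: eq_integral => s; rewrite inE/= in_itv/= andbT => s0.
  rewrite -EFinM; congr _%:E; rewrite /f /=.
  rewrite (ger0_norm (mulr_ge0 (ltW y0) (p0 s))) (gtr0_norm y0) powRM ?(ltW y0)//.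
  have -> : p s `^ a = s by rewrite /p -powRrM mulVf ?gt_eqF// powRr1// ger0_norm.
  have -> : expR (- (y * (1 + p s))) = expR (- y) * expR (- (y * p s)).
    by rewrite mulrDr mulr1 opprD expRD.
  have yy : y `^ (1 - a) * y `^ a = y.
    rewrite -powRD ?subrK ?powRr1 ?(ltW y0)//.
    by rewrite (gt_eqF y0) implybT.
  set E1 := expR (- (y * p s)).
  rewrite -(sg_powRM s); set w := `|s| `^ (m - 1) * Num.sg s.
  transitivity ((y `^ (1 - a) * y `^ a) * (y * expR (- y) * E1 * m * (s * w))).
    by ring.
  by rewrite yy; ring.
rewrite tonelli_swap//; apply: eq_integral => s _.
transitivity (\int[mu]_(y in `[0%R, +oo[) ((m * p s)%:E * (y ^+ 2 * expR (- (y * (1 + p s))))%:E))%E.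
  by apply: eq_integral => y _; rewrite /f -EFinM; congr _%:E => /=; ring.
have cy : continuous (fun y : R => y ^+ 2 * expR (- (y * (1 + p s)))).
  apply: ctsM; first by cts.
  by apply: (cts_comp (f := fun y : R => y * (1 + p s)) cE); apply: ctsM; [exact: cts_id|exact: cts_cst].
have cy0 y : 0 <= y ^+ 2 * expR (- (y * (1 + p s))) by rewrite mulr_ge0 ?sqr_ge0 ?expR_ge0.
have mp0 : 0 <= m * p s by rewrite mulr_ge0 ?(ltW m0).
have my := measurable_half_line cy mH.
rewrite ge0_integralZl//=; last by move=> y _; rewrite lee_fin.
rewrite integral_sqr_expRMN// -EFinM; congr _%:E; rewrite /q /g -/(p s).
by field; rewrite gt_eqF.
Qed.

Lemma egamma_product_bound : (\int[mu]_(s in `[0%R, +oo[) (q s)%:E <= 4%:E)%E.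
Proof.
apply: ge0_integral_itvy_le => // n.
have [->|n0] := eqVneq n 0%N; first by rewrite set_itv1 Rintegral_set1 lee_fin.
have nn0 : 0 < n%:R :> R by rewrite ltr0n lt0n.
rewrite lee_fin; apply: le_trans (profile_sqr_bounded nn0).
rewrite (profile_parts2 nn0) lerDl mulr_ge0 ?sqr_ge0//.
Qed.

Lemma egamma_product_gt0 : (0 < \int[mu]_(s in `[0%R, +oo[) (q s)%:E)%E.
Proof.
have := @ge0_integral_itvy_ge _ q 2 cq (fun s _ => q0 s); apply: lt_le_trans.
have h12 : 1 <= 2 :> R by rewrite ler1n.
rewrite lte_fin (Rintegral_itv_split cq ler01 h12) ltr_wpDl//.
  by apply: Rintegral_ge0.
apply: Rintegral_itv_gt0 => //; first by rewrite ltr1n.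
move=> s; rewrite in_itv/= => /andP[s1 _].
rewrite /q !mulr_gt0 ?exprn_gt0 ?profile_gt0// /p powR_gt0// normr_gt0 gt_eqF//.
exact: lt_le_trans s1.
Qed.

(** Each factor is finite because the product lies strictly between 0 and +oo: an infinite factor
    would make it +oo, or 0 by the convention +oo * 0 = 0. *)
Lemma Gamma_product : let G := Gamma (a + 1) * Gamma (1 - a + 1) in
  0 < G /\ (\int[mu]_(s in `[0%R, +oo[) (q s)%:E)%E = G%:E.
Proof.
have b0 : 0 < 1 - a by rewrite subr_gt0.
have := egamma_product_gt0; have := egamma_product_bound; rewrite -egamma_product.
have fin (A B : \bar R) : (0 <= A)%E -> (0 <= B)%E -> (A * B <= 4%:E)%E -> (0 < A * B)%E ->
    A \is a fin_num.
  move=> A0 B0 AB4 AB0; rewrite ge0_fin_numE// ltey; apply/eqP => Aoo.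
  move: AB4 AB0; rewrite Aoo; have [->|Bn0] := eqVneq B 0%E.
    by rewrite mule0 ltxx.
  by rewrite gt0_mulye// lt0e Bn0.
move=> h4 h0.
rewrite /= (GammaE a0) (GammaE b0).
move: (egamma a) (egamma (1 - a)) (egamma_ge0 a) (egamma_ge0 (1 - a)) h4 h0.
move=> A B A0 B0 AB4 AB0.
have fA := fin A B A0 B0 AB4 AB0.
have fB : B \is a fin_num by apply: (fin B A) => //; rewrite muleC.
rewrite -fineM// fineK ?fin_numM//; split=> //.
by rewrite -lte_fin fineK ?fin_numM.
Qed.

(** In the limit S to +oo the second integration by parts gives G for g^2, the first then gives G /
    (m - 1) for g^2 p, and their sum is the integral of g. The directions are those of the transport
    inequality, with g on its smaller side. *)
Lemma profile_constants : let G := Gamma (a + 1) * Gamma (1 - a + 1) in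
  [/\ 0 < G, (\int[mu]_(s in `[0%R, +oo[) (g s ^+ 2)%:E <= G%:E)%E,
    (\int[mu]_(s in `[0%R, +oo[) (g s ^+ 2 * p s)%:E <= (G / (m - 1))%:E)%E &
    ((G * m / (m - 1))%:E <= \int[mu]_(s in `[0%R, +oo[) (g s)%:E)%E].
Proof.
have [G0 GE] := Gamma_product; move: G0 GE; set G := Gamma _ * _ => G0 GE /=.
have g1 s : g s <= 1 by rewrite /g invf_le1 ?lerDl// p1.
have mm : 0 < m - 1 by rewrite subr_gt0.
have qG n : 0 <= n -> \int[mu]_(s in `[0, n]) q s <= G.
  by move=> n0; rewrite -lee_fin -GE; exact: ge0_integral_itvy_ge.
have g2c : continuous (fun s => g s ^+ 2) by cts.
have NG (n : R) : 0 <= n -> \int[mu]_(s in `[0, n]) g s ^+ 2 <= G.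
  move=> n0; apply/ler_addgt0Pr => e e0.
  have [S0 hS] := profile_tail e0.
  pose S := Num.max (Num.max 1 n) S0.
  have S1 : 0 < S by rewrite !lt_max ltr01.
  apply: (@le_trans _ _ (\int[mu]_(s in `[0, S]) g s ^+ 2)).
    apply: Rintegral_itv_le_ge0 => //; first by move=> x _; exact: sqr_ge0.
    by rewrite !le_max lexx orbT.
  rewrite (profile_parts2 S1) lerD ?qG ?(ltW S1)//.
  apply: le_trans (hS S _); last by rewrite le_max lexx orbT.
  by rewrite expr2 mulrA ler_piMr ?mulr_ge0 ?(ltW S1) ?(ltW (profile_gt0 _)).
have JG (n : R) : 0 < n -> \int[mu]_(s in `[0, n]) (g s ^+ 2 * p s) <= G / (m - 1).
  move=> n0; rewrite ler_pdivlMr// mulrC; apply: le_trans (NG _ (ltW n0)).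
  by rewrite (profile_parts1 n0) lerDl mulr_ge0 ?(ltW n0) ?(ltW (profile_gt0 _)).
split => //.
- by apply: ge0_integral_itvy_le => // [x _|n]; rewrite ?sqr_ge0// lee_fin NG.
- apply: ge0_integral_itvy_le => [|x _|n]; [by cts|by rewrite mulr_ge0 ?sqr_ge0|].
  have [->|n0] := eqVneq n 0%N.
    by rewrite set_itv1 Rintegral_set1 lee_fin divr_ge0// ltW.
  by rewrite lee_fin JG// ltr0n lt0n.
have mG0 : 0 < m / (m - 1) by rewrite divr_gt0.
have -> : (G * m / (m - 1))%:E = ((m / (m - 1))%:E * \int[mu]_(s in `[0%R, +oo[) (q s)%:E)%E.
  by rewrite GE -EFinM; congr _%:E; ring.
rewrite muleC -lee_pdivlMr//.
apply: ge0_integral_itvy_le => // n.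
rewrite lee_pdivlMr//.
have : (forall e, 0 < e -> ((\int[mu]_(s in `[0, n%:R]) q s * (m / (m - 1)))%:E <=
    \int[mu]_(s in `[0%R, +oo[) (g s)%:E + e%:E)%E).
  (* The boundary term is made smaller than e (m - 1), because it gets divided by m - 1. *)
  move=> e e0.
  have e1 : 0 < e * (m - 1) by rewrite mulr_gt0.
  have [S0 hS] := profile_tail e1.
  pose S := Num.max (Num.max 1 n%:R) S0.
  have S1 : 0 < S by rewrite !lt_max ltr01.
  have Sg : S * g S <= e * (m - 1) by apply: hS; rewrite le_max lexx orbT.
  have h1 : \int[mu]_(s in `[0, n%:R]) q s <= \int[mu]_(s in `[0, S]) q s.
    by apply: Rintegral_itv_le_ge0 => //; rewrite !le_max lexx orbT.
  have h2 := profile_parts2 S1; have h3 := profile_parts1 S1.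
  have h4 : 0 <= S * g S ^+ 2 by rewrite mulr_ge0 ?sqr_ge0// ltW.
  apply: (@le_trans _ _ ((\int[mu]_(s in `[0, S]) g s)%:E + e%:E)%E); last first.
    rewrite leeD2r//; apply: ge0_integral_itvy_ge => // x _.
    exact: ltW (profile_gt0 _).
  rewrite -EFinD lee_fin mulrA ler_pdivrMr// profile_sum.
  move: h1 h2 h3 h4 Sg; rewrite -/q.
  set A := \int[mu]_(s in _) _; set B := \int[mu]_(s in _) _ => h1.
  set C := \int[mu]_(s in _) _; set D := \int[mu]_(s in _) _ => h2 h3 h4 h5.
  have h6 : A * m <= (C - S * g S ^+ 2) * m by rewrite ler_wpM2r ?(ltW m0)//; lra.
  nra.
by move=> h; apply/lee_addgt0Pr => e e0; exact: h.
Qed.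

End bubble_profile.

(** * The sharp inequality for test functions *)

Section test_functions.
Context {R : realType}.
Variable phi : R * R -> R.
Hypothesis tphi : test_fun (@unit_disc R) phi.

Lemma test_fun_continuous : continuous phi.
Proof. by case: tphi => /(_ [::])[]. Qed.

Lemma test_fun_partial_continuous j : continuous (partial j phi).
Proof. by case: tphi => /(_ [:: j])[]. Qed.

Lemma test_fun_is_derive1 x y :
  is_derive x (1 : R) (fun x => phi (x, y)) (partial false phi (x, y)).
Proof.
have [/(_ [::])[_ /(_ (x, y))[d _]] _ _] := tphi.
have E : (fun h : R => h^-1 *: (phi (h *: ((1, 0) : R * R) + (x, y)) - phi (x, y))) =
         (fun h : R => h^-1 *: (phi (h *: (1 : R) + x, y) - phi (x, y))).
  apply/funext => h; congr (_ *: (phi _ - _)).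
  by rewrite -[LHS]/(h *: (1 : R) + x, h *: (0 : R) + y) scaler0 add0r.
apply: DeriveDef.
  by move: d; rewrite /derivable /= E.
by rewrite /partial /derive E.
Qed.

Lemma test_fun_is_derive2 x y :
  is_derive y (1 : R) (fun y => phi (x, y)) (partial true phi (x, y)).
Proof.
have [/(_ [::])[_ /(_ (x, y))[_ d]] _ _] := tphi.
have E : (fun h : R => h^-1 *: (phi (h *: ((0, 1) : R * R) + (x, y)) - phi (x, y))) =
         (fun h : R => h^-1 *: (phi (x, h *: (1 : R) + y) - phi (x, y))).
  apply/funext => h; congr (_ *: (phi _ - _)).
  by rewrite -[LHS]/(h *: (0 : R) + x, h *: (1 : R) + y) scaler0 add0r.
apply: DeriveDef.
  by move: d; rewrite /derivable /= E.
by rewrite /partial /derive E.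
Qed.

Lemma test_fun_support z : phi z != 0 -> unit_disc z.
Proof. by move=> z0; case: tphi => _ _; apply; exact: subset_closure. Qed.

Lemma test_fun_out z : 1 <= z.1 ^+ 2 + z.2 ^+ 2 -> phi z = 0.
Proof.
move=> z1; apply/eqP; apply: contraTT z1 => /test_fun_support.
rewrite /unit_disc/= /euclid -ltNge => h.
have z0 : 0 <= z.1 ^+ 2 + z.2 ^+ 2 by rewrite addr_ge0// sqr_ge0.
by move: h; rewrite -{1}sqrtr1 ltr_sqrt.
Qed.

End test_functions.

(** * The transport estimate for a test function on squares *)

Section talenti_box.
Context {R : realType}.
Notation mu := (@lebesgue_measure R).
Variables (t : R) (phi : R * R -> R).
Hypothesis t01 : 0 < t < 1.
Hypothesis tphi : test_fun (@unit_disc R) phi.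

Let t0 : 0 < t. Proof. by case/andP: t01. Qed.
Let t1 : t < 1. Proof. by case/andP: t01. Qed.

Definition bubble_pow (z : R * R) : R := (z.1 ^+ 2 + z.2 ^+ 2) `^ (1 - t)^-1.
Notation V := bubble_pow.

Lemma bubble_pow_ge0 z : 0 <= V z. Proof. exact: powR_ge0. Qed.

Lemma continuous_bubble_pow : continuous V.
Proof.
have -> : V = (fun z => `|z.1 ^+ 2 + z.2 ^+ 2| `^ (1 - t)^-1).
  by apply/funext => z; rewrite ger0_norm// addr_ge0// sqr_ge0.
apply: (@cts_comp _ _ (fun s => `|s| `^ (1 - t)^-1)).
  by apply: continuous_normr_powR; rewrite invr_gt0 subr_gt0.
by cts.
Qed.

Let W z := `|phi z| `^ t^-1.
Let D j z := t^-1 * (`|phi z| `^ (t^-1 - 1) * Num.sg (phi z)) * partial j phi z.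

Let tV1 : 1 < t^-1. Proof. by rewrite invf_gt1. Qed.
Let cphi : continuous phi := test_fun_continuous tphi.
Let cpartial j : continuous (partial j phi).
Proof. exact: test_fun_partial_continuous. Qed.
Let cW : continuous W.
Proof.
apply: (@cts_comp _ _ (fun v => `|v| `^ t^-1)) => //.
by apply: continuous_normr_powR; rewrite invr_gt0.
Qed.
Let cD j : continuous (D j).
Proof.
apply: ctsM => //; apply: ctsM; first exact: cts_cst.
apply: (@cts_comp _ _ (fun v => `|v| `^ (t^-1 - 1) * Num.sg v)) => //.
by apply: continuous_sg_powR; rewrite subr_gt0.
Qed.

Let dW1 x y : is_derive x (1 : R) (fun x => W (x, y)) (D false (x, y)).
Proof.
have d := test_fun_is_derive1 tphi x y.
have h := is_derive_normr_powR (phi (x, y)) tV1.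
exact: (@is_derive1_comp _ (fun v => `|v| `^ t^-1) (fun x => phi (x, y))).
Qed.

Let dW2 x y : is_derive y (1 : R) (fun y => W (x, y)) (D true (x, y)).
Proof.
have d := test_fun_is_derive2 tphi x y.
have h := is_derive_normr_powR (phi (x, y)) tV1.
exact: (@is_derive1_comp _ (fun v => `|v| `^ t^-1) (fun y => phi (x, y))).
Qed.

Let Wout x y : 1 <= x ^+ 2 + y ^+ 2 -> W (x, y) = 0.
Proof.
move=> xy; rewrite /W (@test_fun_out _ _ tphi (x, y)) ?normr0 ?powR0//.
by rewrite gt_eqF// invr_gt0.
Qed.

Section pointwise.
Variables (al be ga : R) (K : R * R -> R).
Hypotheses (al0 : 0 < al) (be0 : 0 < be) (ga0 : 0 < ga).
Hypothesis albega : al * be `^ t * ga `^ (1 - t) = 1.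
Hypothesis K0 : forall z, 0 <= K z.
Hypothesis K1 : forall z, unit_disc z -> 1 <= K z.

(** Young's inequality is used twice: with weight [al] to separate the gradient from W^(1-t) T, then
    through [powR_AMGM] with weights [be] and [ga], where the normalisation rewrites 1/al as be^t
    ga^(1-t). Where phi vanishes so does c; elsewhere z is in the disc and K z >= 1. *)
Lemma transport_young z u v :
  - (u * D false z + v * D true z) <=
  (2 * t)^-1 * (al * (partial false phi z ^+ 2 + partial true phi z ^+ 2) +
    t * be * K z) +
  (2 * t)^-1 * ((1 - t) * ga) * (W z ^+ 2 * V (u, v)).
Proof.
rewrite /D; set c := `|phi z| `^ (t^-1 - 1) * Num.sg (phi z).
set p := partial false phi z; set q := partial true phi z.
have key : c ^+ 2 * (u ^+ 2 + v ^+ 2) / al <=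
    t * be * K z + (1 - t) * ga * (W z ^+ 2 * V (u, v)).
  have [phi0|phi0] := eqVneq (phi z) 0.
    rewrite /c phi0 sgr0 mulr0 expr2 !mul0r addr_ge0//.
      by rewrite !mulr_ge0// ltW.
    by rewrite !mulr_ge0 ?subr_ge0 ?powR_ge0// ltW.
  have c2 : c ^+ 2 = `|phi z| `^ (t^-1 - 1) ^+ 2.
    by rewrite /c exprMn sqr_sg phi0 mulr1.
  have alV : al^-1 = be `^ t * ga `^ (1 - t).
    by apply: (mulfI (lt0r_neq0 al0)); rewrite mulfV ?gt_eqF// mulrA albega.
  have V1 : W z ^+ 2 * V (u, v) = (c ^+ 2 * (u ^+ 2 + v ^+ 2)) `^ (1 - t)^-1.
    rewrite powRM ?sqr_ge0 ?addr_ge0 ?sqr_ge0//; congr (_ * _).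
    have pX b : (`|phi z| `^ b) ^+ 2 = `|phi z| `^ (b * 2).
      by rewrite powRrM powR_mulrn// powR_ge0.
    rewrite c2 pX -powRrM /W pX; congr (_ `^ _).
    by field; rewrite !gt_eqF// subr_gt0.
  have s0 : 0 <= c ^+ 2 * (u ^+ 2 + v ^+ 2).
    by rewrite mulr_ge0 ?sqr_ge0 ?addr_ge0 ?sqr_ge0.
  rewrite V1 alV; set s := c ^+ 2 * _ in s0 *.
  have sE : s = (s `^ (1 - t)^-1) `^ (1 - t).
    by rewrite -powRrM mulVf ?powRr1// gt_eqF// subr_gt0.
  rewrite {1}sE [leLHS]mulrC -[leLHS]mulrA -(powRM _ (ltW ga0) (powR_ge0 _ _)).
  apply: (@le_trans _ _ (t * be + (1 - t) * (ga * s `^ (1 - t)^-1))).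
    by apply: powR_AMGM => //; rewrite ?mulr_ge0 ?powR_ge0// ltW.
  rewrite mulrA lerD2r ler_peMr ?K1//; first by rewrite mulr_ge0// ltW.
  exact: test_fun_support phi0.
have sq : - (2 * (u * (c * p) + v * (c * q))) <=
    al * (p ^+ 2 + q ^+ 2) + c ^+ 2 * (u ^+ 2 + v ^+ 2) / al.
  rewrite -subr_ge0.
  have -> : al * (p ^+ 2 + q ^+ 2) + c ^+ 2 * (u ^+ 2 + v ^+ 2) / al -
      - (2 * (u * (c * p) + v * (c * q))) =
      ((al * p + c * u) ^+ 2 + (al * q + c * v) ^+ 2) / al.
    by field; rewrite gt_eqF.
  by rewrite divr_ge0 ?addr_ge0 ?sqr_ge0// ltW.
have -> : - (u * (t^-1 * c * p) + v * (t^-1 * c * q)) =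
    (2 * t)^-1 * (- (2 * (u * (c * p) + v * (c * q)))).
  by field; rewrite gt_eqF.
rewrite -[X in _ <= _ + X]mulrA -mulrDr; apply: ler_wpM2l.
  by rewrite invr_ge0 mulr_ge0// ltW.
apply: le_trans sq _; rewrite -addrA lerD2l; exact: key.
Qed.

End pointwise.

Section box.
Variables S E M I N J : R.
Hypothesis SE : S = \int[mu]_(x in `[-1, 1]) \int[mu]_(y in `[-1, 1]) W (x, y) ^+ 2.
Hypothesis EE : E = \int[mu]_(x in `[-1, 1]) \int[mu]_(y in `[-1, 1])
  (partial false phi (x, y) ^+ 2 + partial true phi (x, y) ^+ 2).
Hypothesis M0 : 0 < M.

Let g z := (1 + V z)^-1.
Hypothesis IE : I = \int[mu]_(u in `[-M, M]) \int[mu]_(v in `[-M, M]) g (u, v).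
Hypothesis NE : N = \int[mu]_(u in `[-M, M]) \int[mu]_(v in `[-M, M]) g (u, v) ^+ 2.
Hypothesis JE : J = \int[mu]_(u in `[-M, M]) \int[mu]_(v in `[-M, M]) (g (u, v) ^+ 2 * V (u, v)).

Let g0 z : 0 < g z.
Proof. by rewrite invr_gt0 ltr_wpDr// bubble_pow_ge0. Qed.

Let cg : continuous g.
Proof.
apply: ctsV; first by apply: ctsD; [exact: cts_cst|exact: continuous_bubble_pow].
by move=> z; rewrite gt_eqF// -invr_gt0; exact: g0.
Qed.

Let MM : - M < M. Proof. by rewrite gtrN. Qed.

Let cV : continuous V. Proof. exact: continuous_bubble_pow. Qed.

Let Rintegral2_gt0 (h : R * R -> R) : continuous h -> (forall z, 0 < h z) ->
  0 < \int[mu]_(u in `[-M, M]) \int[mu]_(v in `[-M, M]) h (u, v).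
Proof.
move=> ch h0; apply: Rintegral_itv_gt0 => //; first exact: continuous_param_integral.
by move=> x _; apply: Rintegral_itv_gt0 => //; exact: continuous_pair1.
Qed.

Let RintegralZ2 (h : R * R -> R) k a b : continuous h ->
  \int[mu]_(u in `[a, b]) \int[mu]_(v in `[a, b]) (k * h (u, v)) =
  k * \int[mu]_(u in `[a, b]) \int[mu]_(v in `[a, b]) h (u, v).
Proof.
move=> ch; rewrite -RintegralZl_itv; last exact: continuous_param_integral.
by apply: eq_Rintegral => u _; rewrite RintegralZl_itv//; exact: continuous_pair1.
Qed.

Let RintegralD2 (h h' : R * R -> R) a b : continuous h -> continuous h' ->
  \int[mu]_(u in `[a, b]) \int[mu]_(v in `[a, b]) (h (u, v) + h' (u, v)) =
  \int[mu]_(u in `[a, b]) \int[mu]_(v in `[a, b]) h (u, v) +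
  \int[mu]_(u in `[a, b]) \int[mu]_(v in `[a, b]) h' (u, v).
Proof.
move=> ch ch'; rewrite -RintegralD_itv; [|exact: continuous_param_integral..].
by apply: eq_Rintegral => u _; rewrite RintegralD_itv//; exact: continuous_pair1.
Qed.

Let N0 : 0 < N.
Proof.
rewrite NE; apply: (@Rintegral2_gt0 (fun z => g z ^+ 2)); first by cts.
by move=> z; rewrite exprn_gt0.
Qed.

Let I0 : 0 < I. Proof. by rewrite IE; exact: Rintegral2_gt0. Qed.

Let S_ge0 : 0 <= S.
Proof. by rewrite SE; apply: Rintegral_ge0 => x _; apply: Rintegral_ge0 => y _; exact: sqr_ge0. Qed.

Let E_ge0 : 0 <= E.
Proof.
by rewrite EE; apply: Rintegral_ge0 => x _; apply: Rintegral_ge0 => y _; rewrite addr_ge0// sqr_ge0.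
Qed.

(** [ka] is the multiple of the bubble whose mass on the target square is that of W^2 + e, the 4
    being the area of [-1, 1]^2. The same area turns the error 2 e C of [knothe_ineq] into 8 e C. *)
Lemma talenti_box_eps (al be ga : R) (K : R * R -> R) (e C : R) :
  0 < al -> 0 < be -> 0 < ga -> al * be `^ t * ga `^ (1 - t) = 1 ->
  continuous K -> (forall z, 0 <= K z) -> (forall z, unit_disc z -> 1 <= K z) ->
  0 < e ->
  (forall u v, u \in `[-M, M] -> v \in `[-M, M] -> 1 <= C * g (u, v)) ->
  forall ka : R, ka = (S + 4 * e) / N ->
  2 * (Num.sqrt ka * I) - 8 * e * (C / Num.sqrt ka) <=
  (2 * t)^-1 * (al * E +
    t * be * \int[mu]_(x in `[-1, 1]) \int[mu]_(y in `[-1, 1]) K (x, y) +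
    (1 - t) * ga * (ka * J)).
Proof.
move=> al0 be0 ga0 albega cK K0 K1 e0 gC ka kaE.
have ka0 : 0 < ka by rewrite kaE divr_gt0// ltr_wpDl// mulr_gt0.
have ska0 : 0 < Num.sqrt ka by rewrite sqrtr_gt0.
pose G z := ka * g z ^+ 2.
have sG z : Num.sqrt (G z) = Num.sqrt ka * g z.
  by rewrite sqrtrM ?ltW// sqrtr_sqr gtr0_norm.
pose H z := (2 * t)^-1 * (al * (partial false phi z ^+ 2 + partial true phi z ^+ 2) + t * be * K z).
have cE : continuous (fun z => partial false phi z ^+ 2 + partial true phi z ^+ 2).
  by apply: ctsD; apply: ctsX; exact: cpartial.
have cH : continuous H.
  apply: ctsM; first exact: cts_cst.
  by apply: ctsD; apply: ctsM => //; exact: cts_cst.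
have cG : continuous G by rewrite /G; cts.
have n11 : -1 < 1 :> R by rewrite gtrN.
have mass : \int[mu]_(x in `[-1, 1]) \int[mu]_(y in `[-1, 1]) (W (x, y) ^+ 2 + e) =
    \int[mu]_(u in `[-M, M]) \int[mu]_(v in `[-M, M]) G (u, v).
  rewrite /G (@RintegralZ2 (fun z => g z ^+ 2)); last by cts.
  rewrite -NE kaE mulfVK; last by rewrite gt_eqF.
  rewrite (@RintegralD2 (fun z => W z ^+ 2) (cst e)); [|by cts|exact: cts_cst].
  rewrite -SE; congr (_ + _); rewrite /= (Rintegral_itv_cst _ (ltW n11)) (Rintegral_itv_cst _ (ltW n11)).
  by ring.
have := @knothe_ineq R (-1) 1 (- M) M W (D false) (D true) G V H e (C / Num.sqrt ka)
  ((2 * t)^-1 * ((1 - t) * ga)) n11 MM cW (@cD false) (@cD true) cG cV cH dW1 dW2.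
have out x y : (x ^+ 2 == 1) || (y ^+ 2 == 1) -> W (x, y) = 0.
  by move=> /orP[] /eqP xy1; apply: Wout; rewrite xy1 ?lerDl ?lerDr sqr_ge0.
have h0 : 0 <= (2 * t)^-1 * ((1 - t) * ga).
  by rewrite mulr_ge0 ?invr_ge0 ?mulr_ge0 ?subr_ge0// ltW.
have hC u v : u \in `[-M, M] -> v \in `[-M, M] ->
    1 <= C / Num.sqrt ka * Num.sqrt (G (u, v)).
  by move=> uM vM; rewrite sG mulrA divfK ?gt_eqF// gC.
have hW x y u v : x \in `[(-1), 1] -> y \in `[(-1), 1] -> u \in `[(-M), M] -> v \in `[(-M), M] ->
    - (u * D false (x, y) + v * D true (x, y)) <=
    H (x, y) + (2 * t)^-1 * ((1 - t) * ga) * (W (x, y) ^+ 2 * V (u, v)).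
  by move=> _ _ _ _; exact: transport_young.
move=> /(_ _ _ _ _ _ _ _ e0 h0 hC mass hW).
have -> : \int[mu]_(x in `[-1, 1]) \int[mu]_(y in `[-1, 1]) H (x, y) = (2 * t)^-1 * (al * E +
    t * be * \int[mu]_(x in `[-1, 1]) \int[mu]_(y in `[-1, 1]) K (x, y)).
  rewrite /H (@RintegralZ2 (fun z => al * (partial false phi z ^+ 2 + partial true phi z ^+ 2) +
    t * be * K z)); last by apply: ctsD; apply: ctsM => //; exact: cts_cst.
  rewrite (@RintegralD2 (fun z => al * (partial false phi z ^+ 2 + partial true phi z ^+ 2))
    (fun z => t * be * K z)); [|by apply: ctsM => //; exact: cts_cst..].
  rewrite (@RintegralZ2 (fun z => partial false phi z ^+ 2 + partial true phi z ^+ 2))//.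
  by rewrite (@RintegralZ2 K)// -EE.
have -> : \int[mu]_(u in `[-M, M]) \int[mu]_(v in `[-M, M]) Num.sqrt (G (u, v)) = Num.sqrt ka * I.
  rewrite IE -(@RintegralZ2 g _ _ _ cg); apply: eq_Rintegral => u _; apply: eq_Rintegral => v _.
  exact: sG.
have -> : \int[mu]_(u in `[-M, M]) \int[mu]_(v in `[-M, M]) (G (u, v) * V (u, v)) = ka * J.
  rewrite JE -(@RintegralZ2 (fun z => g z ^+ 2 * V z)); last by cts.
  by apply: eq_Rintegral => u _; apply: eq_Rintegral => v _; rewrite mulrA.
set Q := \int[mu]_(x in `[-1, 1]) \int[mu]_(y in `[-1, 1]) K (x, y).
move=> hk.
have -> : (2 * t)^-1 * (al * E + t * be * Q + (1 - t) * ga * (ka * J)) =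
    (2 * t)^-1 * (al * E + t * be * Q) + (2 * t)^-1 * ((1 - t) * ga) * (ka * J).
  by ring.
have -> : 8 * e * (C / Num.sqrt ka) = 2 * e * (C / Num.sqrt ka) * (1 - -1) ^+ 2.
  by ring.
apply: hk.
- by move=> y; rewrite out// sqrrN expr1n eqxx.
- by move=> y; rewrite out// expr1n eqxx.
- by move=> x; rewrite out// sqrrN expr1n eqxx orbT.
- by move=> x; rewrite out// expr1n eqxx orbT.
- by move=> z; exact: powR_ge0.
- by move=> z; apply: mulr_gt0 => //; rewrite exprn_gt0.
- by move=> z; exact: powR_ge0.
Qed.

Lemma talenti_box_young (al be ga P : R) : 0 < S ->
  0 < al -> 0 < be -> 0 < ga -> al * be `^ t * ga `^ (1 - t) = 1 ->
  (forall de, 0 < de -> exists K : R * R -> R, [/\ continuous K, (forall z, 0 <= K z),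
    (forall z, unit_disc z -> 1 <= K z) &
    \int[mu]_(x in `[-1, 1]) \int[mu]_(y in `[-1, 1]) K (x, y) <= P + de]) ->
  4 * t * (Num.sqrt (S / N) * I) <=
  al * E + t * be * P + (1 - t) * ga * (S / N * J).
Proof.
move=> S0 al0 be0 ga0 albega KP.
have c1V : continuous (fun z => 1 + V z) by apply: ctsD => //; exact: cts_cst.
have [C0 C00 hC0] := continuous_bounded_rect (- M) M (- M) M c1V.
have gC u v : u \in `[-M, M] -> v \in `[-M, M] -> 1 <= C0 * g (u, v).
  move=> uM vM; rewrite -ler_pdivrMr// /g invrK mul1r.
  exact: le_trans (ler_norm _) (hC0 _ _ uM vM).
set X := Num.sqrt (S / N).
have X0 : 0 < X by rewrite sqrtr_gt0 divr_gt0.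
have J0 : 0 <= J.
  rewrite JE; apply: Rintegral_ge0 => u _; apply: Rintegral_ge0 => v _.
  by rewrite mulr_ge0 ?sqr_ge0 ?bubble_pow_ge0.
(* The total coefficient of d after multiplication by 2 t: the loss 8 d C0 / X, the excess d of the
   integral of K, and the excess 4 d / N of ka over S / N. *)
pose L := 16 * t * (C0 / X) + t * be + (1 - t) * ga * (4 / N * J).
have L0 : 0 <= L.
  rewrite /L !addr_ge0// ?mulr_ge0 ?divr_ge0 ?invr_ge0 ?subr_ge0//; exact: ltW.
apply/ler_addgt0Pr => e e0.
pose d := e / (L + 1).
have d0 : 0 < d by rewrite divr_gt0// ltr_wpDl.
have L1 : 0 < L + 1 by rewrite ltr_wpDl.
have dL : d * L <= e.
  by rewrite /d -mulrA (mulrC _ L) mulrA (ler_pdivrMr _ _ L1) (ler_pM2l e0) lerDl ler01.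
have [K [cK K0 K1 KPd]] := KP d d0.
set ka := (S + 4 * d) / N.
have h := talenti_box_eps al0 be0 ga0 albega cK K0 K1 d0 gC (erefl ka).
have kaX : X <= Num.sqrt ka.
  apply: ler_wsqrtr; rewrite ler_pM2r ?invr_gt0// lerDl mulr_ge0//; exact: ltW.
have h1 : X * I <= Num.sqrt ka * I by rewrite ler_wpM2r// ltW.
have h2 : C0 / Num.sqrt ka <= C0 / X.
  by rewrite ler_wpM2l// lef_pV2 ?posrE// (lt_le_trans X0).
have h3 : 8 * d * (C0 / Num.sqrt ka) <= 8 * d * (C0 / X).
  by rewrite ler_wpM2l// mulr_ge0// ltW.
have h4 : t * be * \int[mu]_(x in `[-1, 1]) \int[mu]_(y in `[-1, 1]) K (x, y) <= t * be * (P + d).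
  by rewrite ler_wpM2l// mulr_ge0// ltW.
move: h; rewrite [leRHS]mulrC ler_pdivlMr ?mulr_gt0//.
have -> : ka * J = S / N * J + d * (4 / N * J) by rewrite /ka; ring.
move=> h.
have h5 : 2 * (X * I) - 8 * d * (C0 / X) <= 2 * (Num.sqrt ka * I) - 8 * d * (C0 / Num.sqrt ka).
  by rewrite lerB// ler_wpM2l.
have h6 := ler_wpM2r (ltW (mulr_gt0 (ltr0n R 2) t0)) h5.
move: h h4 h6 dL; rewrite /L; set Q := \int[mu]_(x in _) _.
lra.
Qed.

End box.

End talenti_box.

(* The hypothesis is used with the weights for which be * P and
   ga * (S / N * J) are both half of its left-hand side. *)
Lemma young_optimum (R : realType) (t S E I N J P : R) : 0 < t < 1 ->
  0 < S -> 0 < I -> 0 < N -> 0 < J -> 0 < P ->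
  (forall al be ga : R, 0 < al -> 0 < be -> 0 < ga ->
    al * be `^ t * ga `^ (1 - t) = 1 ->
    4 * t * (Num.sqrt (S / N) * I) <=
    al * E + t * be * P + (1 - t) * ga * (S / N * J)) ->
  4 * t ^+ 2 * S `^ t * I ^+ 2 <= E * P `^ t * N `^ t * J `^ (1 - t).
Proof.
move=> /andP[t0 t1] S0 I0 N0 J0 P0.
have y0 : 0 < S / N by rewrite divr_gt0.
have SyN : S `^ t = (S / N) `^ t * N `^ t.
  by rewrite -powRM ?ltW// divfK// gt_eqF.
rewrite SyN; set y := S / N in y0 *; clearbody y => h.
set X := 4 * t * (Num.sqrt y * I) in h.
have X0 : 0 < X by rewrite /X !mulr_gt0// sqrtr_gt0.
pose th := X / 2; have th0 : 0 < th by rewrite divr_gt0.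
have yJ0 : 0 < y * J by rewrite mulr_gt0.
(* With be = th / P and ga = th / (y J) the normalisation forces al = c / th. The hypothesis becomes
   X <= c E / th + th, which for th = X / 2 says th^2 <= c E. *)
pose c := P `^ t * (y * J) `^ (1 - t).
have c0 : 0 < c by rewrite mulr_gt0// powR_gt0.
have gE x s : 0 < x -> (th / x) `^ s = th `^ s * (x `^ s)^-1.
  move=> x0; rewrite powRM ?invr_ge0 ?ltW//; congr (_ * _).
  by rewrite -(powR_inv1 (ltW x0)) -powRrM mulN1r powRN.
have {}h := h (c / th) (th / P) (th / (y * J)) (divr_gt0 c0 th0) (divr_gt0 th0 P0) (divr_gt0 th0 yJ0).
have : X <= c / th * E + th.
  have -> : c / th * E + th = c / th * E + t * (th / P) * P + (1 - t) * (th / (y * J)) * (y * J).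
    by field; rewrite !gt_eqF.
  apply: h; rewrite !gE// /c.
  have thE : th `^ t * th `^ (1 - t) = th.
    rewrite -powRD; last by rewrite (gt_eqF th0) implybT.
    by rewrite addrC subrK powRr1// ltW.
  have a0 : P `^ t != 0 by rewrite gt_eqF// powR_gt0.
  have b0 : (y * J) `^ (1 - t) != 0 by rewrite gt_eqF// powR_gt0.
  move: thE; set u := th `^ t; set v := th `^ (1 - t) => uv.
  transitivity (u * v / th); last by rewrite uv divff// gt_eqF.
  by field; rewrite a0 b0 gt_eqF.
rewrite {h} -(ler_pM2r th0) => h.
have XE : th * 2 = X by rewrite /th divfK.
have h2 : th ^+ 2 <= c * E.
  move: h; rewrite -XE (_ : (_ / th * E + th) * th = c * E + th ^+ 2).
    by rewrite (_ : th * 2 * th = th ^+ 2 + th ^+ 2) ?lerD2r//; ring.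
  by field; rewrite gt_eqF.
have sy : Num.sqrt y ^+ 2 = y by rewrite sqr_sqrtr// ltW.
have h3 : 4 * t ^+ 2 * y * I ^+ 2 <= c * E.
  apply: le_trans h2; rewrite (_ : 4 * t ^+ 2 * y * I ^+ 2 = th ^+ 2)//.
  by rewrite /th /X -{1}sy; field.
have yE : y = y `^ t * y `^ (1 - t).
  rewrite -powRD; last by rewrite (gt_eqF y0) implybT.
  by rewrite addrC subrK powRr1// ltW.
have y1 : 0 < y `^ (1 - t) by rewrite powR_gt0.
rewrite -(ler_pM2r y1).
have -> : 4 * t ^+ 2 * (y `^ t * N `^ t) * I ^+ 2 * y `^ (1 - t) =
    N `^ t * (4 * t ^+ 2 * (y `^ t * y `^ (1 - t)) * I ^+ 2) by ring.
rewrite -yE.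
have -> : E * P `^ t * N `^ t * J `^ (1 - t) * y `^ (1 - t) = N `^ t * (c * E).
  by rewrite /c powRM ?ltW//; ring.
by rewrite ler_wpM2l// powR_ge0.
Qed.

Section disc_majorant.
Context {R : realType}.
Notation mu := (@lebesgue_measure R).

(** The piecewise linear k equals 1 up to 1 and 0 from 1 + d on. Evaluated at |z|^2 it majorises the
    indicator of the disc, with integral at most pi (1 + d). *)
Lemma unit_disc_majorant (d : R) : 0 < d -> exists k : R -> R,
  [/\ continuous k, (forall s, 0 <= k s), (forall s, s < 1 -> 1 <= k s) &
    (\int[mu]_(s in `[0%R, +oo[) (k s)%:E <= (1 + d)%:E)%E].
Proof.
move=> d0; pose k (s : R) := clip 0 1 (1 + (1 - s) / d).
have ck : continuous k.
  rewrite /k; apply: (@cts_comp R R (clip 0 1) (fun s : R => 1 + (1 - s) / d)).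
    exact: continuous_clip.
  by cts.
have k0 s : 0 <= k s by rewrite le_max lexx.
have k1 s : k s <= 1 by rewrite ge_max ler01 ge_min lexx.
exists k; split => //.
  move=> s s1; rewrite le_max le_min lexx/= lerDl divr_ge0 ?orbT// ?subr_ge0 ltW//.
have d1 : 0 <= 1 + d by rewrite addr_ge0// ltW.
have h1 c : 0 <= c -> \int[mu]_(s in `[0, c]) k s <= c.
  move=> c0; apply: (@le_trans _ _ (\int[mu]_(s in `[0, c]) 1)).
    by apply: le_Rintegral_itv => //; exact: cst_continuous.
  by rewrite (Rintegral_itv_cst _ c0) mul1r subr0.
apply: ge0_integral_itvy_le => // n; rewrite lee_fin.
have [nd|nd] := leP n%:R (1 + d); first exact: le_trans (h1 _ (ler0n _ _)) nd.
rewrite (Rintegral_itv_split ck d1 (ltW nd)) -[leRHS]addr0; apply: lerD; first exact: h1.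
rewrite -(mul0r (n%:R - (1 + d))) -(Rintegral_itv_cst 0 (ltW nd)).
apply: le_Rintegral_itv => //; first exact: cst_continuous.
move=> s; rewrite in_itv/= => /andP[ds _].
rewrite /k /clip ge_max lexx ge_min /= -lerBrDl sub0r ler_pdivrMr// mulN1r.
by apply/orP; right; lra.
Qed.

End disc_majorant.

(** * Passage to the whole plane *)

Section talenti_test.
Context {R : realType}.
Notation mu := (@lebesgue_measure R).
Variables (t : R) (phi : R * R -> R).
Hypothesis t01 : 0 < t < 1.
Hypothesis tphi : test_fun (@unit_disc R) phi.

Let t0 : 0 < t. Proof. by case/andP: t01. Qed.
Let t1 : t < 1. Proof. by case/andP: t01. Qed.
Let a01 : 0 < 1 - t < 1. Proof. by rewrite subr_gt0 t1 gtrBl. Qed.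

Let nsq (z : R * R) := z.1 ^+ 2 + z.2 ^+ 2.
Let nsq0 z : 0 <= nsq z. Proof. by rewrite addr_ge0// sqr_ge0. Qed.
Let cnsq : continuous nsq. Proof. by rewrite /nsq; cts. Qed.

Let radial (k : R -> R) : continuous k -> (forall s, 0 <= k s) ->
  (\int[@mu2 R]_z (k (nsq z))%:E = pi%:E * \int[mu]_(s in `[0%R, +oo[) (k s)%:E)%E.
Proof. by move=> ck k0; exact: integral_radial. Qed.

Let rect_le (k : R -> R) (c d : R) (B : R) : continuous k -> (forall s, 0 <= k s) ->
  (\int[mu]_(s in `[0%R, +oo[) (k s)%:E <= B%:E)%E ->
  \int[mu]_(x in `[c, d]) \int[mu]_(y in `[c, d]) k (nsq (x, y)) <= pi * B.
Proof.
move=> ck k0 kB; rewrite -lee_fin.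
have ckn : continuous (fun z => k (nsq z)) by exact: cts_comp.
rewrite -(@integral_rect _ (fun z => k (nsq z)))//.
apply: (@le_trans _ _ (\int[@mu2 R]_z (k (nsq z))%:E)%E).
  apply: ge0_subset_integral => //.
  - exact: measurableX.
  - by apply/measurable_EFinP; exact: continuous_measurable_plane.
  - by move=> z _; rewrite lee_fin.
rewrite radial//.
by rewrite EFinM lee_wpmul2l// lee_fin pi_ge0.
Qed.

Let rect_sup (k : R -> R) (B : R) : continuous k -> (forall s, 0 <= k s) ->
  (forall n : nat, \int[mu]_(x in `[- n.+1%:R, n.+1%:R])
    \int[mu]_(y in `[- n.+1%:R, n.+1%:R]) k (nsq (x, y)) <= B) ->
  (pi%:E * \int[mu]_(s in `[0%R, +oo[) (k s)%:E <= B%:E)%E.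
Proof.
move=> ck k0 kB; rewrite -radial//.
have ckn : continuous (fun z => k (nsq z)) by exact: cts_comp.
apply: (@le_integral_nondecreasing_cover _ _ _ (@mu2 R)
  (fun n => `[- n.+1%:R, n.+1%:R]%classic `*` `[- n.+1%:R, n.+1%:R]%classic)) => //.
- apply/nondecreasing_seqP => n; apply/subsetPset => -[x y] [].
  rewrite /= !in_itv/= => /andP[x1 x2] /andP[y1 y2].
  have h : n.+1%:R <= n.+2%:R :> R by rewrite ler_nat.
  by split; apply/andP; split; lra.
- by move=> n; exact: measurableX.
- apply/seteqP; split => // -[x y] _; exists (Num.truncn (`|x| + `|y|)) => //.
  have h := truncnS_gt (`|x| + `|y|).
  rewrite /= !in_itv/= -!ler_norml; split; apply: ltW; apply: le_lt_trans h.
    by rewrite lerDl.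
  by rewrite lerDr.
- by apply/measurable_EFinP; exact: continuous_measurable_plane.
- by move=> z _; rewrite lee_fin.
- move=> n; have h := @integral_rect _ (fun z => k (nsq z)) (- n.+1%:R) n.+1%:R
    (- n.+1%:R) n.+1%:R ckn (fun z => k0 (nsq z)).
  apply: (@le_trans _ _ (\int[mu]_(x in `[- n.+1%:R, n.+1%:R])
    \int[mu]_(y in `[- n.+1%:R, n.+1%:R]) k (nsq (x, y)))%:E); last by rewrite lee_fin.
  by rewrite -h.
Qed.

(** The conclusion of [young_optimum] at P = pi with the bubble integrals N = pi G, J = pi G (1 - t)
    / t and I = pi G / t, solved for S^t: the powers t^2 cancel and a single 1/G remains. *)
Let const_algebra (S E G : R) : 0 <= S -> 0 < G ->
  4 * t ^+ 2 * S `^ t * (pi * (G / t)) ^+ 2 <=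
    E * pi `^ t * (pi * G) `^ t * (pi * (G * ((1 - t) / t))) `^ (1 - t) ->
  S `^ t <= pi `^ (t - 1) * ((1 - t) / t) `^ (1 - t) / (4 * G) * E.
Proof.
move=> S0 G0; have p0 := @pi_gt0 R.
have x0 : 0 < (1 - t) / t by rewrite divr_gt0// subr_gt0.
have pG0 : 0 < pi * G :> R by rewrite mulr_gt0.
rewrite (mulrA pi G ((1 - t) / t)).
have -> : (pi * G * ((1 - t) / t)) `^ (1 - t) =
    (pi * G) `^ (1 - t) * ((1 - t) / t) `^ (1 - t) by rewrite powRM ?(ltW pG0) ?(ltW x0).
have pGE : (pi * G) `^ t * (pi * G) `^ (1 - t) = pi * G :> R.
  by rewrite -powRD ?(gt_eqF pG0) ?implybT// addrC subrK powRr1// ltW.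
have piE : pi `^ t = pi `^ (t - 1) * pi :> R.
  by rewrite -[X in _ * X]powRr1 ?(ltW p0)// -powRD ?subrK// (gt_eqF p0) implybT.
have -> : 4 * t ^+ 2 * S `^ t * (pi * (G / t)) ^+ 2 = S `^ t * (4 * pi ^+ 2 * G ^+ 2).
  by field; rewrite gt_eqF.
set q := ((1 - t) / t) `^ (1 - t).
have -> : E * pi `^ t * (pi * G) `^ t * ((pi * G) `^ (1 - t) * q) =
    E * pi `^ t * q * ((pi * G) `^ t * (pi * G) `^ (1 - t)) by ring.
rewrite pGE piE => h.
have c0 : 0 < 4 * pi ^+ 2 * G ^+ 2 :> R by rewrite !mulr_gt0 ?exprn_gt0.
rewrite -(ler_pM2r c0); apply: (le_trans h).
rewrite le_eqVlt; apply/orP; left; apply/eqP.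
by field; rewrite gt_eqF.
Qed.

(** On each square N and J are at most their values over the plane, so [young_optimum] bounds I
    independently of the square. When the squares fill the plane, the lower bound pi G / t takes the
    place of I. *)
Lemma talenti_test_fun :
  let S := \int[mu]_(x in `[-1, 1]) \int[mu]_(y in `[-1, 1]) (`|phi (x, y)| `^ t^-1) ^+ 2 in
  let E := \int[mu]_(x in `[-1, 1]) \int[mu]_(y in `[-1, 1])
    (partial false phi (x, y) ^+ 2 + partial true phi (x, y) ^+ 2) in
  let G := Gamma (1 + t) * Gamma (2 - t) in
  0 < G /\ S `^ t <= pi `^ (t - 1) * ((1 - t) / t) `^ (1 - t) / (4 * G) * E.
Proof.
move=> S E G.
have [] := profile_constants a01.
rewrite (_ : 1 - (1 - t) + 1 = 1 + t); last by ring.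
rewrite (_ : 1 - t + 1 = 2 - t); last by ring.
rewrite mulrC -/G => G0 NG JG IG; split=> //.
have tt : (1 - t)^-1 - 1 = t / (1 - t) by field; rewrite subr_eq0 gt_eqF.
have S_ge0 : 0 <= S.
  by apply: Rintegral_ge0 => x _; apply: Rintegral_ge0 => y _; exact: sqr_ge0.
have E_ge0 : 0 <= E.
  by apply: Rintegral_ge0 => x _; apply: Rintegral_ge0 => y _; rewrite addr_ge0// sqr_ge0.
have SE : S = \int[mu]_(x in `[-1, 1]) \int[mu]_(y in `[-1, 1]) (`|phi (x, y)| `^ t^-1) ^+ 2 by [].
have EE : E = \int[mu]_(x in `[-1, 1]) \int[mu]_(y in `[-1, 1])
    (partial false phi (x, y) ^+ 2 + partial true phi (x, y) ^+ 2) by [].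
clearbody S E.
have [->|Sn0] := eqVneq S 0.
  rewrite powR0; last by rewrite gt_eqF.
  apply: mulr_ge0 => //; apply: divr_ge0; first by rewrite mulr_ge0 ?powR_ge0.
  by apply: mulr_ge0 => //; exact: ltW.
have S0 : 0 < S by rewrite lt_neqAle eq_sym Sn0.
apply: const_algebra => //.
pose g := profile (1 - t).
have cg : continuous g by exact: continuous_profile.
have g0 s : 0 < g s by exact: profile_gt0.
pose p (s : R) := `|s| `^ (1 - t)^-1.
have cp : continuous p by apply: continuous_normr_powR; rewrite invr_gt0 subr_gt0.
have p0 s : 0 <= p s by exact: powR_ge0.
have VE z : bubble_pow t z = p (nsq z) by rewrite /p ger0_norm.
have gVE z : (1 + bubble_pow t z)^-1 = g (nsq z) by rewrite VE.
set B := E * _ * _ * _.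
have B0 : 0 <= B by rewrite /B !mulr_ge0 ?powR_ge0.
have X0 : 0 < 4 * t ^+ 2 * S `^ t by rewrite !mulr_gt0 ?exprn_gt0 ?powR_gt0.
have KP de : 0 < de -> exists K : R * R -> R, [/\ continuous K, forall z : R * R, 0 <= K z,
    forall z : R * R, unit_disc z -> 1 <= K z &
    \int[mu]_(x in `[-1, 1]) \int[mu]_(y in `[-1, 1]) K (x, y) <= pi + de].
  move=> de0; have [|k [ck k0 k1 kB]] := @unit_disc_majorant R (de / pi).
    by rewrite divr_gt0// pi_gt0.
  exists (fun z => k (nsq z)); split => //.
  - exact: cts_comp.
  - move=> z; rewrite /unit_disc/= /euclid => h; apply: k1.
    by move: h; rewrite -{1}sqrtr1 ltr_sqrt.
  - apply: le_trans (rect_le (-1) 1 ck k0 kB) _.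
    by rewrite mulrDr mulr1 mulrC divfK ?gt_eqF ?pi_gt0.
have J'0 : 0 < pi * (G * ((1 - t) / t)) :> R.
  by rewrite mulr_gt0 ?pi_gt0// mulr_gt0// divr_gt0// subr_gt0.
have box (n : nat) : \int[mu]_(x in `[- n.+1%:R, n.+1%:R])
    \int[mu]_(y in `[- n.+1%:R, n.+1%:R]) g (nsq (x, y)) <= Num.sqrt (B / (4 * t ^+ 2 * S `^ t)).
  pose M : R := n.+1%:R; have M0 : 0 < M by rewrite ltr0n.
  have MM : - M < M by rewrite gtrN.
  have cgn : continuous (fun z => g (nsq z)) by exact: cts_comp.
  pose I := \int[mu]_(u in `[- M, M]) \int[mu]_(v in `[- M, M]) g (nsq (u, v)).
  pose N := \int[mu]_(u in `[- M, M]) \int[mu]_(v in `[- M, M]) g (nsq (u, v)) ^+ 2.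
  pose J := \int[mu]_(u in `[- M, M]) \int[mu]_(v in `[- M, M])
    (g (nsq (u, v)) ^+ 2 * p (nsq (u, v))).
  have pos (h : R * R -> R) : continuous h -> (forall z, 0 < h z) ->
      0 < \int[mu]_(u in `[- M, M]) \int[mu]_(v in `[- M, M]) h (u, v).
    move=> ch h0; apply: Rintegral_itv_gt0 => //; first exact: continuous_param_integral.
    by move=> x _; apply: Rintegral_itv_gt0 => //; exact: continuous_pair1.
  have I0 : 0 < I by exact: (pos (fun z => g (nsq z))).
  have N0 : 0 < N.
    apply: (pos (fun z => g (nsq z) ^+ 2)); first exact: ctsX.
    by move=> z; rewrite exprn_gt0.
  have NM : N <= pi * G.
    apply: (@rect_le (fun s => g s ^+ 2)) => //; first exact: ctsX.
    by move=> s; exact: sqr_ge0.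
  have JM : J <= pi * (G * ((1 - t) / t)).
    apply: (@rect_le (fun s => g s ^+ 2 * p s)).
    - by apply: ctsM => //; exact: ctsX.
    - by move=> s; rewrite mulr_ge0 ?sqr_ge0.
    - move: JG; rewrite tt (_ : G / (t / (1 - t)) = G * ((1 - t) / t))//.
      by rewrite invf_div.
  have IE : I = \int[mu]_(u in `[- M, M]) \int[mu]_(v in `[- M, M])
      (fun z => (1 + bubble_pow t z)^-1) (u, v).
    by apply: eq_Rintegral => u _; apply: eq_Rintegral => v _; rewrite gVE.
  have NE : N = \int[mu]_(u in `[- M, M]) \int[mu]_(v in `[- M, M])
      (fun z => (1 + bubble_pow t z)^-1) (u, v) ^+ 2.
    by apply: eq_Rintegral => u _; apply: eq_Rintegral => v _; rewrite gVE.
  have JE : J = \int[mu]_(u in `[- M, M]) \int[mu]_(v in `[- M, M])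
      ((fun z => (1 + bubble_pow t z)^-1) (u, v) ^+ 2 * bubble_pow t (u, v)).
    by apply: eq_Rintegral => u _; apply: eq_Rintegral => v _; rewrite gVE VE.
  rewrite -/M -/I; clearbody I N J.
  have : 4 * t ^+ 2 * S `^ t * I ^+ 2 <=
      E * pi `^ t * N `^ t * (pi * (G * ((1 - t) / t))) `^ (1 - t).
    apply: young_optimum => //; first exact: pi_gt0.
    move=> al be ga al0 be0 ga0 albega.
    apply: le_trans (talenti_box_young t01 tphi SE EE M0 IE NE JE S0 al0 be0 ga0 albega KP) _.
    rewrite lerD2l ler_wpM2l//; first by rewrite mulr_ge0 ?subr_ge0 ?(ltW t1) ?(ltW ga0).
    by rewrite ler_wpM2l// divr_ge0// ltW.
  move=> h.
  have {}h : 4 * t ^+ 2 * S `^ t * I ^+ 2 <= B.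
    apply: le_trans h _; rewrite /B ler_wpM2r ?powR_ge0// ler_wpM2l ?mulr_ge0 ?powR_ge0//.
    apply: ge0_ler_powR => //; [exact: ltW|by rewrite nnegrE ltW|].
    by rewrite nnegrE; apply: mulr_ge0; [exact: pi_ge0|exact: ltW].
  rewrite -[leLHS]ger0_norm ?(ltW I0)// -sqrtr_sqr ler_wsqrtr//.
  by rewrite ler_pdivlMr// mulrC.
have := rect_sup cg (fun s => ltW (g0 s)) box.
move=> h; have {}h : pi * (G / t) <= Num.sqrt (B / (4 * t ^+ 2 * S `^ t)).
  rewrite -lee_fin; apply: le_trans h; rewrite EFinM lee_wpmul2l ?lee_fin ?pi_ge0//.
  apply: le_trans IG; rewrite lee_fin tt le_eqVlt; apply/orP; left; apply/eqP.
  by field; rewrite !gt_eqF ?subr_gt0.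
rewrite mulrC -ler_pdivlMr//.
have q0 : 0 <= B / (4 * t ^+ 2 * S `^ t) by rewrite divr_ge0// ltW.
rewrite -[leRHS](sqr_sqrtr q0) lerXn2r ?nnegrE ?sqrtr_ge0//.
by rewrite mulr_ge0 ?pi_ge0// divr_ge0// ltW.
Qed.

End talenti_test.

Lemma le_integral_comb d (T : measurableType d) (R : realType)
    (mu : {measure set T -> \bar R}) (D : set T) (f g : T -> R) (A B F G : R) :
  measurable D -> measurable_fun D f -> measurable_fun D g ->
  (forall x, 0 <= f x) -> (forall x, 0 <= g x) -> 0 <= A -> 0 <= B ->
  (\int[mu]_(x in D) (f x)%:E <= F%:E)%E -> (\int[mu]_(x in D) (g x)%:E <= G%:E)%E ->
  (\int[mu]_(x in D) (A * f x + B * g x)%:E <= (A * F + B * G)%:E)%E.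
Proof.
move=> mD mf mg f0 g0 A0 B0 fF gG.
have mZ (c : R) h : measurable_fun D h -> measurable_fun D (fun x => (c * h x)%:E).
  by move=> mh; apply/measurable_EFinP; apply: measurable_funM => //; exact: measurable_cst.
rewrite (eq_integral (fun x => (A * f x)%:E + (B * g x)%:E)%E)//.
rewrite ge0_integralD//; [|by move=> x _; rewrite lee_fin mulr_ge0|exact: mZ|
  by move=> x _; rewrite lee_fin mulr_ge0|exact: mZ].
have -> : (\int[mu]_(x in D) (A * f x)%:E = \int[mu]_(x in D) (A%:E * (f x)%:E))%E by [].
have -> : (\int[mu]_(x in D) (B * g x)%:E = \int[mu]_(x in D) (B%:E * (g x)%:E))%E by [].
have Z (c : R) (h : T -> R) : 0 <= c -> (forall x, 0 <= h x) -> measurable_fun D h ->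
    (\int[mu]_(x in D) (c%:E * (h x)%:E) = c%:E * \int[mu]_(x in D) (h x)%:E)%E.
  move=> c0 h0 mh; rewrite ge0_integralZl//; first exact/measurable_EFinP.
  by move=> x _; rewrite lee_fin.
by rewrite !Z// EFinD !EFinM; apply: leeD; rewrite lee_wpmul2l// lee_fin.
Qed.

(** * Integrals over the disc *)

Section disc_integrals.
Context {R : realType}.
Notation mu := (@lebesgue_measure R).
Notation plane := (measurableTypeR R * measurableTypeR R)%type.
Notation D := (@unit_disc R).

Lemma unit_discE (z : R * R) : unit_disc z = (z.1 ^+ 2 + z.2 ^+ 2 < 1) :> Prop.
Proof.
rewrite /unit_disc/= /euclid; apply/propext; rewrite -{1}sqrtr1 ltr_sqrt//.
Qed.

Lemma measurable_unit_disc : measurable (D : set plane).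
Proof.
apply: open_measurable_plane.
have -> : D = (fun z : R * R => z.1 ^+ 2 + z.2 ^+ 2) @^-1` [set x | x < 1].
  by apply/seteqP; split => z; rewrite unit_discE.
apply: open_comp; last exact: open_lt.
by move=> z _; move: z; cts.
Qed.

Lemma area_unit_disc_le : (@mu2 R D <= pi%:E)%E.
Proof.
apply/lee_addgt0Pr => e e0.
have [|k [ck k0 k1 kB]] := @unit_disc_majorant R (e / pi).
  by rewrite divr_gt0// pi_gt0.
have ckn : continuous (fun z : R * R => k (z.1 ^+ 2 + z.2 ^+ 2)) by apply: (cts_comp ck); cts.
have mk : measurable_fun (setT : set plane) (fun z : R * R => (k (z.1 ^+ 2 + z.2 ^+ 2))%:E).
  by apply/measurable_EFinP; exact: continuous_measurable_plane.
rewrite -(mul1e (@mu2 R D)) -integral_cst; last exact: measurable_unit_disc.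
apply: (@le_trans _ _ (\int[@mu2 R]_(z in D) (k (z.1 ^+ 2 + z.2 ^+ 2))%:E)%E).
  apply: ge0_le_integral => //.
  - exact: measurable_unit_disc.
  - exact: measurable_funTS.
  - by move=> z; rewrite unit_discE => /k1; rewrite lee_fin.
apply: (@le_trans _ _ (\int[@mu2 R]_z (k (z.1 ^+ 2 + z.2 ^+ 2))%:E)%E).
  apply: ge0_subset_integral => //; first exact: measurable_unit_disc.
  by move=> z _; rewrite lee_fin.
rewrite integral_radial//; apply: (@le_trans _ _ (pi%:E * (1 + e / pi)%:E)%E).
  by rewrite lee_wpmul2l// lee_fin pi_ge0.
rewrite -EFinM -EFinD lee_fin mulrDr mulr1 lerD2l.
by rewrite mulrC divfK// gt_eqF// pi_gt0.
Qed.

Lemma integral_unit_disc_cst1 : (\int[@mu2 R]_(z in D) (1 : R)%:E <= pi%:E)%E.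
Proof.
rewrite integral_cst ?mul1e; [exact: area_unit_disc_le|exact: measurable_unit_disc].
Qed.

(** Connects the integrals over the disc, in which norms are expressed, with the iterated integrals
    over a square that transport uses. *)
Lemma integral_unit_disc (h : R * R -> R) : continuous h -> (forall z, 0 <= h z) ->
  (forall z, ~ D z -> h z = 0) ->
  (\int[@mu2 R]_(z in D) (h z)%:E)%E =
  (\int[mu]_(x in `[-1, 1]) \int[mu]_(y in `[-1, 1]) h (x, y))%:E.
Proof.
move=> ch h0 hD; rewrite -integral_rect// integral_mkcond [RHS]integral_mkcond.
apply: eq_integral => z _; rewrite /patch; case: ifPn => [|/negP]; rewrite inE => zD.
  rewrite ifT// inE; move: zD; rewrite unit_discE => zD.
  have [h1 h2] := (sqr_ge0 z.1, sqr_ge0 z.2).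
  split; rewrite /= in_itv/= -ler_norml -(@expr_le1 _ 2)// -normrX ger0_norm//;
    apply: le_trans (ltW zD).
    by rewrite lerDl.
  by rewrite lerDr.
by case: ifP => // _; rewrite hD.
Qed.

(** The support is closed and inside the open disc, so phi vanishes near z even when z lies on the
    unit circle. *)
Lemma test_fun_partial_out (phi : R * R -> R) j (z : R * R) :
  test_fun D phi -> ~ D z -> partial j phi z = 0.
Proof.
move=> [_ _ sD] zD; rewrite /partial.
have : \forall w \near z, phi w = cst 0 w.
  have oC : open (~` closure [set w : R * R | phi w != 0]).
    by apply: closed_openC; exact: closed_closure.
  have : nbhs z (~` closure [set w : R * R | phi w != 0]).
    by apply: open_nbhs_nbhs; split => // /sD.
  apply: filterS => w wC /=; apply/eqP; apply: contra_notT wC => w0.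
  exact: subset_closure.
by move=> /near_eq_derive ->; exact: derive_cst.
Qed.

End disc_integrals.

(** * Lowering the exponent to r *)

Section sobolev_test_functions.
Context {R : realType}.
Notation mu := (@lebesgue_measure R).
Notation plane := (measurableTypeR R * measurableTypeR R)%type.
Notation D := (@unit_disc R).

(** The constant between squared norms: c_t times pi^(2/r - t), the power of the area coming from
    Hoelder's inequality. *)
Definition disc_const (r t : R) : R :=
  pi `^ (2 / r - 1) * ((1 - t) / t) `^ (1 - t) / (4 * (Gamma (1 + t) * Gamma (2 - t))).

Variables (r t : R) (phi : R * R -> R).
Hypothesis r2 : 2 <= r.
Hypothesis tr : 0 < t < 2 / r.
Hypothesis tphi : test_fun D phi.

Let r0 : 0 < r. Proof. exact: lt_le_trans r2. Qed.
Let t0 : 0 < t. Proof. by case/andP: tr. Qed.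
Let rt2 : r * t / 2 < 1.
Proof. by case/andP: tr => _; rewrite ltr_pdivlMr// => h; rewrite ltr_pdivrMr// mul1r mulrC. Qed.
Let t01 : 0 < t < 1.
Proof. by rewrite t0/=; case/andP: tr => _ /lt_le_trans; apply; rewrite ler_pdivrMr// mul1r. Qed.

Lemma sobolev_test_fun (e : R) : 0 < e ->
  (\int[@mu2 R]_(z in D) (partial false phi z ^+ 2 + partial true phi z ^+ 2)%:E <= e%:E)%E ->
  (\int[@mu2 R]_(z in D) (`|phi z| `^ r)%:E <= ((disc_const r t * e) `^ (r / 2))%:E)%E.
Proof.
move=> e0.
have cphi := test_fun_continuous tphi.
have pc j : continuous (partial j phi) by exact: test_fun_partial_continuous.
rewrite integral_unit_disc; last first.
- by move=> z zD; rewrite !(test_fun_partial_out _ tphi)// expr0n addr0.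
- by move=> z; rewrite addr_ge0// sqr_ge0.
- by apply: ctsD; apply: ctsX.
have [G0] := talenti_test_fun t01 tphi.
set c := _ / (4 * _).
have c0 : 0 < c.
  rewrite divr_gt0//; last by rewrite mulr_gt0.
  by rewrite mulr_gt0 ?powR_gt0 ?pi_gt0// divr_gt0// subr_gt0; case/andP: t01.
rewrite lee_fin => Sc Ee; have {Sc}Ss := le_trans Sc (ler_wpM2l (ltW c0) Ee).
have ce0 : 0 < c * e by rewrite mulr_gt0.
pose s := (c * e) `^ t^-1; have s0 : 0 < s by rewrite powR_gt0.
have pi0 : 0 < pi :> R by exact: pi_gt0.
have mphi : measurable_fun (D : set plane) phi.
  by apply: measurable_funTS; exact: continuous_measurable_plane.
have Sle : (\int[@mu2 R]_(z in D) ((`|phi z| `^ t^-1) ^+ 2)%:E <= s%:E)%E.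
  rewrite integral_unit_disc; last first.
  - move=> z zD; rewrite (_ : phi z = 0) ?normr0 ?powR0 ?expr0n// ?invr_eq0 ?gt_eqF//.
    by apply/eqP; apply: contra_notT zD; exact: test_fun_support.
  - by move=> z; rewrite sqr_ge0.
  - apply: ctsX; apply: (@cts_comp _ _ (fun s => `|s| `^ t^-1) phi) => //; apply: continuous_normr_powR.
    by rewrite invr_gt0.
  rewrite lee_fin; move: Ss; set S := Rintegral _ _ _ => Ss.
  have S0 : 0 <= S.
    by apply: Rintegral_ge0 => x _; apply: Rintegral_ge0 => y _; exact: sqr_ge0.
  have tt : t * t^-1 = 1 by rewrite mulfV// gt_eqF.
  rewrite -[leLHS]powRr1// -tt powRrM.
  by apply: ge0_ler_powR => //; rewrite ?nnegrE ?powR_ge0// ?invr_ge0 ltW.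
(* The interpolation exponent: |phi|^r is the power si of |phi|^(2/t), and si < 1 because t <
   2/r. *)
pose si := r * t / 2.
have si01 : 0 < si < 1 by rewrite rt2 andbT !mulr_gt0// invr_gt0.
pose L := s `^ si * pi `^ (1 - si).
have L0 : 0 < L by rewrite mulr_gt0 ?powR_gt0 ?pi_gt0.
(* Hoelder's inequality on the disc, whose area is at most pi, as an integrated
   Young inequality. *)
have young z : `|phi z| `^ r <= L * (si / s * (`|phi z| `^ t^-1) ^+ 2 + (1 - si) / pi).
  set x := (_ ^+ 2); have x0 : 0 <= x by exact: sqr_ge0.
  have xr : `|phi z| `^ r = x `^ si.
    rewrite /x expr2 -powRD; last by rewrite (_ : _ == 0 = false)// gt_eqF// addr_gt0// invr_gt0.
    by rewrite -powRrM; congr (_ `^ _); rewrite /si; field; rewrite gt_eqF.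
  have pV0 : 0 <= (pi^-1 : R) by rewrite invr_ge0 ltW.
  have := powR_AMGM si01 (divr_ge0 x0 (ltW s0)) pV0.
  rewrite xr => h.
  have -> : x `^ si = L * ((x / s) `^ si * (pi^-1) `^ (1 - si)).
    rewrite powRM ?invr_ge0 ?(ltW s0)//.
    have -> : L * (x `^ si * s^-1 `^ si * pi^-1 `^ (1 - si)) =
      x `^ si * (s `^ si * s^-1 `^ si) * (pi `^ (1 - si) * pi^-1 `^ (1 - si)).
      by rewrite /L; ring.
    rewrite -!powRM ?invr_ge0 ?(ltW s0) ?pi_ge0// !mulfV ?gt_eqF//.
    by rewrite !powR1 !mulr1.
  rewrite ler_wpM2l ?(ltW L0)//; apply: le_trans h _.
  by rewrite le_eqVlt (_ : si / s * x = si * (x / s)) ?eqxx// mulrAC mulrA.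
have area1 := @integral_unit_disc_cst1 R.
have mW : measurable_fun (D : set plane) (fun z => (`|phi z| `^ t^-1) ^+ 2).
  apply: measurable_funTS; apply: continuous_measurable_plane.
  apply: ctsX; apply: (@cts_comp _ _ (fun s => `|s| `^ t^-1) phi) => //.
  by apply: continuous_normr_powR; rewrite invr_gt0.
have m1 : measurable_fun (D : set plane) (fun _ => 1 : R) by exact: measurable_cst.
have mr : measurable_fun (D : set plane) (fun z => `|phi z| `^ r).
  apply: measurable_funTS; apply: continuous_measurable_plane.
  by apply: (@cts_comp _ _ (fun s => `|s| `^ r) phi) => //; exact: continuous_normr_powR.
have si0 : 0 <= L * si / s.
  by apply: mulr_ge0; [apply: mulr_ge0; [exact: ltW|case/andP: si01 => /ltW]|rewrite invr_ge0 ltW].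
have si1 : 0 <= L * (1 - si) / pi.
  apply: mulr_ge0; last by rewrite invr_ge0 ltW.
  by apply: mulr_ge0; [exact: ltW|rewrite subr_ge0; case/andP: si01 => _ /ltW].
have mcomb : measurable_fun (D : set plane)
    (fun z => L * si / s * (`|phi z| `^ t^-1) ^+ 2 + L * (1 - si) / pi * 1).
  by apply: measurable_funD => //; apply: measurable_funM => //; exact: measurable_cst.
apply: (@le_trans _ _ (\int[@mu2 R]_(z in D)
    (L * si / s * (`|phi z| `^ t^-1) ^+ 2 + L * (1 - si) / pi * 1)%:E)%E).
  apply: ge0_le_integral => //.
  - exact: measurable_unit_disc.
  - exact/measurable_EFinP.
  - exact/measurable_EFinP.
  - move=> z _; rewrite lee_fin; apply: le_trans (young z) _.
    by rewrite le_eqVlt; apply/orP; left; apply/eqP; ring.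
have := @le_integral_comb _ _ _ (@mu2 R) D _ _ _ _ _ _ (@measurable_unit_disc R) mW m1
  (fun z => sqr_ge0 _) (fun _ => ler01) si0 si1 Sle area1.
move/le_trans; apply.
rewrite lee_fin (_ : _ + _ = L); last by rewrite divfK ?gt_eqF// divfK ?gt_eqF//; ring.
rewrite le_eqVlt; apply/orP; left; apply/eqP.
have -> : disc_const r t * e = pi `^ (2 / r - t) * (c * e).
  rewrite /disc_const /c (_ : 2 / r - 1 = (2 / r - t) + (t - 1)); last by ring.
  rewrite (@powRD _ pi (2 / r - t)); [ring|by rewrite (gt_eqF pi0) implybT].
rewrite powRM ?powR_ge0 ?(ltW ce0)// -powRrM /L /s -powRrM mulrC.
congr (_ `^ _ * _ `^ _); rewrite /si; field; rewrite gt_eqF//.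
Qed.

End sobolev_test_functions.

(** * Density of the test functions *)

Section lnorm.
Context {R : realType}.
Notation plane := (measurableTypeR R * measurableTypeR R)%type.
Implicit Types (D : set (R * R)) (f : R * R -> R).

Lemma poweR_LnormOn D (r : R) f : r != 0 ->
  (LnormOn D r f `^ r = \int[@mu2 R]_(z in D) (`|f z| `^ r)%:E)%E.
Proof.
move=> r0; rewrite /LnormOn (poweR_Lnorm _ _ r0).
rewrite [RHS]integral_mkcond; apply: eq_integral => z _.
rewrite {2}/patch; have [zD|zD] := boolP (z \in D).
  by rewrite -poweR_EFin /= /patch zD.
rewrite (_ : (EFin \o f \_ D) z = 0%E); last by rewrite /= /patch (negbTE zD).
by rewrite abse0 poweR0r.
Qed.

Lemma LnormOn_sqr (B : set (R * R)) (f : R * R -> R) :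
  (LnormOn B 2 f `^ 2 = \int[@mu2 R]_(z in B) (f z ^+ 2)%:E)%E.
Proof.
rewrite poweR_LnormOn//; apply: eq_integral => z _.
by rewrite powR_mulrn// real_normK// num_real.
Qed.

Lemma LnormOn_lt_sqr D f (e : R) : 0 <= e -> (LnormOn D 2 f < e%:E)%E ->
  (\int[@mu2 R]_(z in D) (f z ^+ 2)%:E <= (e ^+ 2)%:E)%E.
Proof.
move=> e0 fe.
rewrite -LnormOn_sqr -powR_mulrn// -poweR_EFin; apply: gt0_ler_poweR => //.
- by rewrite in_itv/= leey andbT Lnorm_ge0.
- by rewrite in_itv/= leey andbT lee_fin.
- exact: ltW.
Qed.

End lnorm.

Section density.
Context {R : realType}.
Notation plane := (measurableTypeR R * measurableTypeR R)%type.
Notation D := (@unit_disc R).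

(** By convexity |b|^r lies above the tangent of x^r at |a|, whose slope is at most r n^(r-1). The
    tangent inequality is AM-GM for |b|^r and |a|^r with weights 1/r and 1 - 1/r. *)
Lemma powR_tangent_le (r n a b : R) : 1 < r -> `|a| <= n ->
  `|a| `^ r <= `|b| `^ r + r * n `^ (r - 1) * `|a - b|.
Proof.
move=> r1 an; have r0 : 0 < r by exact: lt_trans r1.
have n0 : 0 <= n by exact: le_trans an.
have ab := ler_dist_dist a b.
move: {a b} `|a| `|b| `|a - b| (normr_ge0 a) (normr_ge0 b) an ab => x y d x0 y0 xn xyd.
have d0 : 0 <= d by exact: le_trans xyd.
have [xy|yx] := leP x y.
  rewrite -[leLHS]addr0 lerD//.
    by apply: ge0_ler_powR => //; exact: ltW.
  by rewrite !mulr_ge0 ?powR_ge0// ltW.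
have ri : 0 < r^-1 < 1 by rewrite invr_gt0 r0 invf_lt1.
have := powR_AMGM ri (powR_ge0 y r) (powR_ge0 x r).
rewrite -!powRrM mulfV ?gt_eqF// powRr1// (_ : r * (1 - r^-1) = r - 1); last first.
  by field; rewrite gt_eqF.
have xr : x `^ r = x * x `^ (r - 1).
  rewrite -{2}(powRr1 x0) -powRD ?subrKC//.
  by rewrite (gt_eqF r0).
rewrite xr => h.
have q0 := powR_ge0 x (r - 1).
have h1 : r * (y * x `^ (r - 1)) <= y `^ r + (r - 1) * (x * x `^ (r - 1)).
  rewrite -(ler_pM2l r0) in h; apply: le_trans h _; rewrite le_eqVlt; apply/orP; left; apply/eqP.
  by field; rewrite gt_eqF.
have h2 : x `^ (r - 1) * (x - y) <= n `^ (r - 1) * d.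
  apply: ler_pM => //; first by rewrite subr_ge0 ltW.
    by apply: ge0_ler_powR => //; rewrite subr_ge0 ltW.
  exact: le_trans (ler_norm _) xyd.
have h3 := ler_wpM2l (ltW r0) h2.
lra.
Qed.

(** Stands for Cauchy-Schwarz on the disc: if d^2 has integral at most e^2, both terms integrate to
    order e. The factor 1 matches the constant function in [le_integral_comb]. *)
Lemma normr_le_sqr (e d : R) : 0 < e -> `|d| <= e / 2 * 1 + (2 * e)^-1 * d ^+ 2.
Proof.
move=> e0; rewrite -subr_ge0.
have -> : e / 2 * 1 + (2 * e)^-1 * d ^+ 2 - `|d| = (`|d| - e) ^+ 2 / (2 * e).
  by rewrite -(real_normK (num_real d)); field; rewrite gt_eqF.
by rewrite divr_ge0 ?sqr_ge0// mulr_ge0// ltW.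
Qed.

(** The coefficients are chosen so that an error (a - b)^2 of integral e^2 contributes (1 + 1/e) e^2
    = e + e^2, which tends to 0. *)
Lemma sqr_le_perturb (e a b : R) : 0 < e ->
  b ^+ 2 <= (1 + e) * a ^+ 2 + (1 + e^-1) * (a - b) ^+ 2.
Proof.
move=> e0; rewrite -subr_ge0.
have -> : (1 + e) * a ^+ 2 + (1 + e^-1) * (a - b) ^+ 2 - b ^+ 2 = (e * a + (a - b)) ^+ 2 / e.
  by field; rewrite gt_eqF.
by rewrite divr_ge0 ?sqr_ge0// ltW.
Qed.

Lemma le_continuous_right0 (u : R -> R) (x : \bar R) : continuous u ->
  (forall e, 0 < e -> (x <= (u e)%:E)%E) -> (x <= (u 0)%:E)%E.
Proof.
move=> cu xu; apply/lee_addgt0Pr => e e0.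
have [d /= d0 h] : \forall w \near (0 : R), `|u 0 - u w| < e.
  by move/cvgrPdist_lt: (cu 0); exact.
apply: le_trans (xu (d / 2) _) _; first by rewrite divr_gt0.
rewrite -EFinD lee_fin.
have := h (d / 2); rewrite /ball_/= sub0r normrN gtr0_norm ?divr_gt0// => /(_ _) h'.
have : `|u 0 - u (d / 2)| < e by apply: h'; rewrite ltr_pdivrMr// ltr_pMr// ltr1n.
by rewrite ltr_distl => /andP[h1 h2]; lra.
Qed.

Lemma sobolev_density (r C N : R) (f : R * R -> R) (g : R * R -> R * R) :
  2 <= r -> 0 <= C -> 0 <= N ->
  (forall (phi : R * R -> R) (e : R), test_fun D phi -> 0 < e ->
    (\int[@mu2 R]_(z in D) (partial false phi z ^+ 2 + partial true phi z ^+ 2)%:E <= e%:E)%E ->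
    (\int[@mu2 R]_(z in D) (`|phi z| `^ r)%:E <= ((C * e) `^ (r / 2))%:E)%E) ->
  W120 D f g ->
  (\int[@mu2 R]_(z in D) ((g z).1 ^+ 2 + (g z).2 ^+ 2)%:E <= N%:E)%E ->
  (\int[@mu2 R]_(z in D) (`|f z| `^ r)%:E <= ((C * N) `^ (r / 2))%:E)%E.
Proof.
(* No a.e. convergent subsequence is needed: on {|f| <= n} the tangent inequality
   bounds |f|^r by |phi|^r + r n^(r-1) |f - phi|, and n tends to +oo last. *)
move=> r2 C0 N0 test [[[mf _] [mg1 _] [mg2 _] _] appr] gN.
have r0 : 0 < r by exact: lt_le_trans r2.
have r1 : 1 < r by apply: lt_le_trans r2; rewrite ltr1n.
have mD := @measurable_unit_disc R.
pose F (n : nat) : set plane := D `&` f @^-1` `[- n%:R, n%:R].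
have mF n : measurable (F n) by exact: mf.
have mfr : measurable_fun (D : set plane) (fun z => `|f z| `^ r).
  apply: (@measurableT_comp _ _ _ _ _ _ (fun x : R => `|x| `^ r)) => //.
  by apply: continuous_measurable_fun; exact: continuous_normr_powR.
(* The first term is the test-function bound for the perturbed gradient integral; the second is r
   n^(r-1) times the bound e pi / 2 + e / 2 for the integral of |f - phi|. The absolute value makes
   it continuous in every real e. *)
pose u (n : nat) (e : R) := `|C * ((1 + e) * N + (e + e ^+ 2))| `^ (r / 2) +
  r * n%:R `^ (r - 1) * ((pi + 1) / 2) * e.
apply: (@le_integral_nondecreasing_cover _ _ _ (@mu2 R) F) => //.
- apply/nondecreasing_seqP => n; apply/subsetPset => z [Dz]; split => //.
  move: b; rewrite /= !in_itv/= -!ler_norml => /le_trans; apply.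
  by rewrite ler_nat.
- apply/seteqP; split => [z [n _ []]//|z Dz]; exists (Num.truncn `|f z|).+1 => //.
  by split => //=; rewrite in_itv/= -ler_norml ltW// truncnS_gt.
- exact/measurable_EFinP.
move=> n.
have -> : (C * N) `^ (r / 2) = u n 0.
  by rewrite /u expr0n/= !addr0 mul1r mulr0 addr0 ger0_norm ?mulr_ge0.
apply: (@le_continuous_right0 (u n)).
  rewrite /u; apply: (@ctsD R R (fun e => `|C * ((1 + e) * N + (e + e ^+ 2))| `^ (r / 2))
    (fun e => r * n%:R `^ (r - 1) * ((pi + 1) / 2) * e)); last by cts.
  apply: (@cts_comp R R (fun s => `|s| `^ (r / 2)) (fun e => C * ((1 + e) * N + (e + e ^+ 2)))).
    by apply: continuous_normr_powR; rewrite divr_gt0.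
  by cts.
move=> e e0.
have [phi [tphi]] := appr e e0; rewrite /W12_norm => he.
have cphi := test_fun_continuous tphi.
have fphi : (\int[@mu2 R]_(z in D) ((f z - phi z) ^+ 2)%:E <= (e ^+ 2)%:E)%E.
  apply: LnormOn_lt_sqr; first exact: ltW.
  by apply: le_lt_trans he; rewrite leeDl// Lnorm_ge0.
have gphi : (\int[@mu2 R]_(z in D) (euclid (g z - grad phi z) ^+ 2)%:E <= (e ^+ 2)%:E)%E.
  apply: LnormOn_lt_sqr; first exact: ltW.
  by apply: le_lt_trans he; rewrite leeDr// Lnorm_ge0.
have mphi : measurable_fun (D : set plane) phi.
  by apply: measurable_funTS; exact: continuous_measurable_plane.
have mp j : measurable_fun (D : set plane) (partial j phi).
  apply: measurable_funTS; apply: continuous_measurable_plane.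
  exact: test_fun_partial_continuous.
have e'0 : 0 < (1 + e) * N + (e + e ^+ 2).
  by apply: ltr_wpDl; [rewrite mulr_ge0// addr_ge0// ltW|rewrite addr_gt0// exprn_gt0].
have ephi : (\int[@mu2 R]_(z in D) (partial false phi z ^+ 2 + partial true phi z ^+ 2)%:E <=
    ((1 + e) * N + (e + e ^+ 2))%:E)%E.
  have me : measurable_fun (D : set plane) (fun z => euclid (g z - grad phi z) ^+ 2).
    have -> : (fun z => euclid (g z - grad phi z) ^+ 2) = (fun z =>
        ((g z).1 - partial false phi z) ^+ 2 + ((g z).2 - partial true phi z) ^+ 2).
      by apply/funext => z; rewrite /euclid sqr_sqrtr// addr_ge0// sqr_ge0.
    by apply: measurable_funD; apply: measurable_funX; exact: measurable_funB.
  have mgg : measurable_fun (D : set plane) (fun z => (g z).1 ^+ 2 + (g z).2 ^+ 2).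
    by apply: measurable_funD; exact: measurable_funX.
  have e1 : 0 <= 1 + e by rewrite addr_ge0// ltW.
  have e2 : 0 <= 1 + e^-1 by rewrite addr_ge0// invr_ge0 ltW.
  have := @le_integral_comb _ _ _ (@mu2 R) D _ _ _ _ _ _ mD mgg me
    (fun z => addr_ge0 (sqr_ge0 _) (sqr_ge0 _)) (fun z => sqr_ge0 _) e1 e2 gN gphi.
  rewrite (_ : _ + (1 + e^-1) * e ^+ 2 = (1 + e) * N + (e + e ^+ 2)); last first.
    by field; rewrite gt_eqF.
  apply: le_trans; apply: ge0_le_integral => //.
  - by move=> z _; rewrite lee_fin addr_ge0// sqr_ge0.
  - by apply/measurable_EFinP; apply: measurable_funD; exact: measurable_funX.
  - by apply/measurable_EFinP; apply: measurable_funD; apply: measurable_funM => //;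
      exact: measurable_cst.
  - move=> z _; rewrite lee_fin /euclid sqr_sqrtr ?addr_ge0 ?sqr_ge0//.
    have h1 := sqr_le_perturb (g z).1 (partial false phi z) e0.
    have h2 := sqr_le_perturb (g z).2 (partial true phi z) e0.
    apply: le_trans (lerD h1 h2) _; rewrite le_eqVlt; apply/orP; left; apply/eqP.
    by rewrite /=; ring.
have rphi := test phi _ tphi e'0 ephi.
have mfp : measurable_fun (D : set plane) (fun z => (f z - phi z) ^+ 2).
  by apply: measurable_funX; exact: measurable_funB.
have m1 : measurable_fun (D : set plane) (fun _ => 1 : R) by exact: measurable_cst.
have h0 z : 0 <= e / 2 * 1 + (2 * e)^-1 * (f z - phi z) ^+ 2.
  exact: le_trans (normr_ge0 _) (normr_le_sqr _ e0).
have e2 : 0 <= e / 2 by rewrite divr_ge0// ltW.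
have e3 : 0 <= (2 * e)^-1 by rewrite invr_ge0 mulr_ge0// ltW.
have inner := @le_integral_comb _ _ _ (@mu2 R) D _ _ _ _ _ _ mD m1 mfp
  (fun _ => ler01) (fun z => sqr_ge0 _) e2 e3 (@integral_unit_disc_cst1 R) fphi.
have mh : measurable_fun (D : set plane)
    (fun z => e / 2 * 1 + (2 * e)^-1 * (f z - phi z) ^+ 2).
  by apply: measurable_funD; apply: measurable_funM => //; exact: measurable_cst.
have mphir : measurable_fun (D : set plane) (fun z => `|phi z| `^ r).
  apply: (@measurableT_comp _ _ _ _ _ _ (fun x : R => `|x| `^ r)) => //.
  by apply: continuous_measurable_fun; exact: continuous_normr_powR.
pose c := r * n%:R `^ (r - 1).
have c0 : 0 <= c by rewrite mulr_ge0 ?powR_ge0// ltW.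
have outer := @le_integral_comb _ _ _ (@mu2 R) D _ _ _ _ _ _ mD mphir mh
  (fun z => powR_ge0 _ _) h0 ler01 c0 rphi inner.
have uE : u n e = 1 * (C * ((1 + e) * N + (e + e ^+ 2))) `^ (r / 2) +
    c * (e / 2 * pi + (2 * e)^-1 * e ^+ 2).
  rewrite /u -/c ger0_norm ?mulr_ge0// ?(ltW e'0)//.
  by rewrite mul1r; congr (_ + _); field; rewrite gt_eqF.
rewrite uE; apply: le_trans outer.
have mo : measurable_fun (D : set plane) (fun z => 1 * `|phi z| `^ r +
    c * (e / 2 * 1 + (2 * e)^-1 * (f z - phi z) ^+ 2)).
  by apply: measurable_funD; apply: measurable_funM => //; exact: measurable_cst.
have o0 z : 0 <= 1 * `|phi z| `^ r + c * (e / 2 * 1 + (2 * e)^-1 * (f z - phi z) ^+ 2).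
  by apply: addr_ge0; [rewrite mul1r powR_ge0|rewrite mulr_ge0].
have FD : F n `<=` D by move=> z [].
apply: (@le_trans _ _ (\int[@mu2 R]_(z in F n) (1 * `|phi z| `^ r +
    c * (e / 2 * 1 + (2 * e)^-1 * (f z - phi z) ^+ 2))%:E)%E).
  apply: ge0_le_integral => //.
  - by apply/measurable_EFinP; exact: measurable_funS mfr.
  - by apply/measurable_EFinP; exact: measurable_funS mo.
  - move=> z [_]; rewrite /= in_itv/= -ler_norml => fn; rewrite lee_fin mul1r.
    apply: le_trans (powR_tangent_le (phi z) r1 fn) _; apply: lerD => //.
    by apply: ler_wpM2l => //; exact: normr_le_sqr.
apply: ge0_subset_integral => //; first exact/measurable_EFinP.
by move=> z _; rewrite lee_fin; exact: o0.
Qed.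

End density.

(** * The constant in terms of p *)

Section disc_inequality.
Context {R : realType}.
Notation D := (@unit_disc R).

Lemma Gamma_mul_gt0 (t : R) : 0 < t < 1 -> 0 < Gamma (1 + t) * Gamma (2 - t).
Proof.
move=> /andP[t0 t1].
have [|G0 _ _ _] := @profile_constants R (1 - t); first by rewrite subr_gt0 t1 gtrBl.
have E1 : 1 - (1 - t) + 1 = 1 + t by ring.
have E2 : 1 - t + 1 = 2 - t by ring.
by rewrite mulrC -E1 -E2.
Qed.

Lemma disc_const_gt0 (r t : R) : 0 < t < 1 -> 0 < disc_const r t.
Proof.
move=> t01; have /andP[t0 t1] := t01.
rewrite /disc_const divr_gt0//; last by rewrite mulr_gt0// Gamma_mul_gt0.
by rewrite mulr_gt0 ?powR_gt0 ?pi_gt0// divr_gt0// subr_gt0.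
Qed.

(** For t = 2/p - 1 one has (1 - t) / t = 2 (p - 1) / (2 - p) and 1 - t = 2 (p - 1) / p; the powers
    of 2 combine to 2^(2(p-1)/p) / 4 = 2^(-2/p), the square of 2^(-1/p). *)
Lemma sqrt_disc_const (r p : R) : 0 < r -> 1 < p < 2 ->
  Num.sqrt (disc_const r (2 / p - 1)) =
  ((p - 1) / (2 - p)) `^ ((p - 1) / p) * (pi `^ ((2 - r) / (2 * r)) * 2 `^ (- p^-1) /
     Num.sqrt (Gamma (2 / p) * Gamma (3 - 2 / p))).
Proof.
move=> r0 /andP[p1 p2]; have p0 : 0 < p by exact: lt_trans p1.
have pi0 := @pi_gt0 R.
have t01 : 0 < 2 / p - 1 < 1.
  by rewrite subr_gt0 ltr_pdivlMr// mul1r p2 ltrBlDr ltr_pdivrMr//; lra.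
have := Gamma_mul_gt0 t01; rewrite /disc_const.
rewrite (_ : 1 + (2 / p - 1) = 2 / p); last by ring.
rewrite (_ : 2 - (2 / p - 1) = 3 - 2 / p); last by ring.
set G := Gamma _ * _ => G0; set X := (p - 1) / (2 - p).
have X0 : 0 < X by rewrite divr_gt0// subr_gt0.
have -> : (1 - (2 / p - 1)) / (2 / p - 1) = 2 * X.
  by rewrite /X; field; rewrite !gt_eqF ?subr_gt0.
have sq (x a : R) : 0 < x -> x `^ (a * 2) = (x `^ a) ^+ 2.
  by move=> x0; rewrite powRrM powR_mulrn// powR_ge0.
have -> : 2 / r - 1 = (2 - r) / (2 * r) * 2 by field; rewrite gt_eqF.
have -> : 1 - (2 / p - 1) = (p - 1) / p * 2 by field; rewrite gt_eqF.
have X20 : 0 < 2 * X by rewrite mulr_gt0.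
rewrite !sq// powRM ?(ltW X0)//.
have E : (2 : R) `^ ((p - 1) / p) = 2 * 2 `^ (- p^-1).
  rewrite -{2}(@powRr1 _ 2)// -powRD; last by rewrite (_ : 2 == 0 = false) ?implybT// gt_eqF.
  by congr (_ `^ _); field; rewrite gt_eqF.
rewrite E.
set x := X `^ _; set y := pi `^ _; set z := 2 `^ _.
have -> : y ^+ 2 * (2 * z * x) ^+ 2 / (4 * G) = (x * (y * z)) ^+ 2 * G^-1.
  have f4 : 4 / 4 = 1 :> R by rewrite mulfV.
  rewrite invfM (_ : _ * _ = (x * (y * z)) ^+ 2 * (4 / 4) / G); last by ring.
  by rewrite f4 mulr1.
rewrite sqrtrM ?sqr_ge0// sqrtr_sqr ger0_norm ?mulr_ge0 ?powR_ge0//.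
by rewrite sqrtrV ?mulrA// ltW.
Qed.

End disc_inequality.

(** * The inequality on the Sobolev space and its best constant *)

Section sobolev_disc.
Context {R : realType}.
Notation plane := (measurableTypeR R * measurableTypeR R)%type.
Notation D := (@unit_disc R).

Lemma LnormOn_inv_pow (B : set (R * R)) (s : R) (f : R * R -> R) : s != 0 ->
  LnormOn B s f = ((\int[@mu2 R]_(z in B) (`|f z| `^ s)%:E) `^ s^-1)%E.
Proof.
by move=> s0; rewrite -poweR_LnormOn// -poweRrM mulfV// poweRe1// Lnorm_ge0.
Qed.

Lemma gradient_integral_lty (B : set plane) (g : R * R -> R * R) : measurable B ->
  in_L2 B (fun z => (g z).1) -> in_L2 B (fun z => (g z).2) ->
  (\int[@mu2 R]_(z in B) ((g z).1 ^+ 2 + (g z).2 ^+ 2)%:E < +oo)%E.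
Proof.
move=> mB [m1 g1] [m2 g2].
rewrite -[ltLHS]/(\int[@mu2 R]_(z in B) (((g z).1 ^+ 2)%:E + ((g z).2 ^+ 2)%:E))%E.
rewrite ge0_integralD//=.
- by rewrite -!LnormOn_sqr lte_add_pinfty// poweR_lty.
- by move=> z _; rewrite lee_fin sqr_ge0.
- by apply/measurable_EFinP; exact: measurable_funX.
- by move=> z _; rewrite lee_fin sqr_ge0.
- by apply/measurable_EFinP; exact: measurable_funX.
Qed.

Lemma LnormOn_euclid (B : set (R * R)) (g : R * R -> R * R) :
  (LnormOn B 2 (fun z => euclid (g z)) =
   (\int[@mu2 R]_(z in B) ((g z).1 ^+ 2 + (g z).2 ^+ 2)%:E) `^ 2^-1)%E.
Proof.
rewrite LnormOn_inv_pow//; congr (_ `^ _)%E; apply: eq_integral => z _.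
by rewrite powR_mulrn// real_normK ?num_real// sqr_sqrtr// addr_ge0// sqr_ge0.
Qed.

Lemma sobolev_disc (r t : R) : 2 <= r -> 0 < t < 2 / r ->
  sobolev_ineq D r (Num.sqrt (disc_const r t))%:E.
Proof.
move=> r2 tr f g W; have [[_ g1 g2 _] _] := W.
have r0 : 0 < r by exact: lt_le_trans r2.
have t01 : 0 < t < 1.
  have /andP[-> t2] := tr; apply: lt_le_trans t2 _; by rewrite ler_pdivrMr// mul1r.
have C0 := disc_const_gt0 r t01.
have := gradient_integral_lty (@measurable_unit_disc R) g1 g2.
rewrite LnormOn_euclid; set I := integral _ _ _ => Ioo.
have I0 : (0 <= I)%E.
  by apply: integral_ge0 => z _; rewrite lee_fin addr_ge0// sqr_ge0.
have IE : I = (fine I)%:E by rewrite fineK// ge0_fin_numE.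
have N0 : 0 <= fine I by exact: fine_ge0.
have test (phi : R * R -> R) (e : R) tphi e0 := @sobolev_test_fun R r t phi r2 tr tphi e e0.
have gN : (I <= (fine I)%:E)%E by rewrite -IE.
have fr := sobolev_density r2 (ltW C0) N0 test W gN.
rewrite IE LnormOn_inv_pow ?gt_eqF//.
apply: (@le_trans _ _ (((disc_const r t * fine I) `^ (r / 2))%:E `^ r^-1)%E).
  apply: gt0_ler_poweR => //; first by rewrite invr_ge0 ltW.
  - rewrite in_itv/= leey andbT; apply: integral_ge0 => z _.
    by rewrite lee_fin powR_ge0.
  - by rewrite in_itv/= leey andbT lee_fin powR_ge0.
rewrite !poweR_EFin -EFinM lee_fin -powRrM.
rewrite (_ : r / 2 / r = 2^-1); last by field; rewrite gt_eqF.
rewrite powR12_sqrt; last by apply: mulr_ge0; [exact: ltW|].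
by rewrite powR12_sqrt// sqrtrM// ltW.
Qed.

Lemma LnormOn_euclid_lty (B : set plane) (f : R * R -> R) (g : R * R -> R * R) :
  measurable B -> W12 B f g -> (LnormOn B 2 (fun z => euclid (g z)) < +oo)%E.
Proof.
by move=> mB [_ g1 g2 _]; rewrite LnormOn_euclid poweR_lty// gradient_integral_lty.
Qed.

Lemma sobolev_const_le (B : set (R * R)) (r A : R) :
  sobolev_ineq B r A%:E -> (sobolev_const B r <= A%:E)%E.
Proof. by move=> h; apply: ereal_inf_lbound; exists A. Qed.

(* The infimum is attained because the gradient norm is finite; some real
   constant must be admissible, as otherwise the product could be +oo * 0. *)
Lemma sobolev_const_ineq (B : set plane) (r A : R) : measurable B ->
  sobolev_ineq B r A%:E -> sobolev_ineq B r (sobolev_const B r).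
Proof.
move=> mB hA f g W; have [W1 _] := W.
have := hA f g W; have := LnormOn_euclid_lty mB W1.
set N := LnormOn B 2 _ => Noo.
have N0 : (0 <= N)%E by exact: Lnorm_ge0.
have NE : N = (fine N)%:E by rewrite fineK// ge0_fin_numE.
have := fine_ge0 N0; rewrite le_eqVlt => /predU1P[n0|n0].
  by rewrite NE -n0 !mule0.
move=> _; rewrite NE -lee_pdivrMr//; apply: le_ereal_inf_tmp => _ [A' hA' <-].
by rewrite lee_pdivrMr// -NE; exact: hA'.
Qed.

End sobolev_disc.

Theorem theorem2p1 (R : realType) (r : R) (hr : 2 <= r) :
  (forall (f : R * R -> R) (g : R * R -> R * R),
     W120 (@unit_disc R) f g ->
     (LnormOn (@unit_disc R) r f <=
        sobolev_const (@unit_disc R) r *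
        LnormOn (@unit_disc R) 2 (fun z => euclid (g z)))%E) /\
  (sobolev_const (@unit_disc R) r <=
     ereal_inf
       [set (((p - 1) / (2 - p)) `^ ((p - 1) / p) *
             (pi `^ ((2 - r) / (2 * r)) * 2 `^ (- p^-1) /
              Num.sqrt (Gamma (2 / p) * Gamma (3 - 2 / p))))%R%:E
       | p in [set` `]2 * r / (r + 2), 2[%R]])%E.
Proof.
have r0 : 0 < r by exact: lt_le_trans hr.
split.
  (* Any t in (0, 2/r) provides an admissible real constant; 1/r is one such value. *)
  have h : 0 < r^-1 < 2 / r by rewrite invr_gt0 r0 ltr_pMl ?invr_gt0// ltr1n.
  exact: sobolev_const_ineq (@measurable_unit_disc R) (sobolev_disc hr h).
apply: le_ereal_inf_tmp => _ [p + <-].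
rewrite /= in_itv/= => /andP[]; rewrite ltr_pdivrMr ?addr_gt0// => rp p2.
(* Since r >= 2, the lower end 2 r / (r + 2) is at least 1. *)
have p1 : 1 < p by nra.
have p0 : 0 < p by exact: lt_trans p1.
rewrite -sqrt_disc_const ?p1//; apply/sobolev_const_le/sobolev_disc => //.
(* The bound p < 2 is t > 0, and p > 2 r / (r + 2) is t < 2/r. *)
rewrite subr_gt0 ltr_pdivlMr// mul1r p2/= ltrBlDr ltr_pdivrMr//.
have -> : (2 / r + 1) * p = (r + 2) * p / r by field; rewrite gt_eqF.
by rewrite ltr_pdivlMr// [_ * p]mulrC.
Qed.
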